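(* Let $(G,\Sigma)$ be a twisted Boolean groupoid. Consider the inclusion of $B=C_0(G^{(0)})$ into $A=C^*_{\rm red}(G,\Sigma)$ and the four conditions: (i) $\mathrm{PIN}(B)=\mathrm{Bis}(\Sigma)$ (i.e. every element of $\mathrm{PIN}(B)$ is of the form $\Delta_S$ for some $S\in\mathrm{Bis}(\Sigma)$); (ii) the restriction map $Q$ is separating; (iii) $B$ is maximal abelian in $A$; (iv) $G$ is effective. Then conditions (i) and (ii) are equivalent and imply (iii), which in turn implies (iv). If $G$ is Hausdorff, these four conditions are equivalent.
   Context: $\mathbb T$ is the group of complex numbers of modulus one; $r,d$ are range and domain maps. A Boolean groupoid is an étale groupoid (locally compact, not necessarily Hausdorff, with $r,d$ local homeomorphisms) whose unit space is locally compact Hausdorff totally disconnected. A twisted Boolean groupoid $(G,\Sigma)$ is a central groupoid extension $X\times\mathbb T\rightarrowtail\Sigma\xrightarrow{p}G$ with common unit space $X=G^{(0)}$, $G$ Boolean, $\Sigma$ a locally compact groupoid, $X\times\mathbb T$ (homeomorphically) locally closed in $\Sigma$, $p$ a continuous open surjection. $\mathrm{Bis}(\Sigma)$ is the inverse semigroup of compact continuous bisections of $\Sigma$: compact subsets $S$ such that $r_{|S},d_{|S}$ are homeomorphisms onto open subsets of $X$. For $S\in\mathrm{Bis}(\Sigma)$, $\Delta_S(\sigma)=\overline\theta$ if $\sigma=\theta\tau$ with $\theta\in\mathbb T,\tau\in S$, and $0$ if $\sigma\notin\mathbb TS$. $C_c(G,\Sigma)$ is the $*$-algebra of finite sums of functions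 $\Delta_S\cdot(b\circ d)$, $b\in C_c(X)$, with $f*g(\sigma)=\sum_{\tau'\in r^{-1}(r(\sigma))}f(\tau)g(\tau^{-1}\sigma)$ ($\tau\in \Sigma$ any lift of $\tau'\in G$), $f^*(\sigma)=\overline{f(\sigma^{-1})}$. $C^*_{\rm red}(G,\Sigma)$ is its completion for $\|f\|_{\rm red}=\sup_{x\in X}\|\pi_x(f)\|$, where $\pi_x(f)\xi=f*\xi$ on the Hilbert space of functions $\xi:d^{-1}(x)\to\mathbb C$ ($d^{-1}(x)\subset\Sigma$) with $\xi(\theta\sigma)=\overline\theta\xi(\sigma)$ and $\sum_{\sigma'\in G,\,d(\sigma')=x}|\xi(\sigma)|^2<\infty$. Since $|f(\sigma)|\le\|f\|_{\rm red}$, elements of $C^*_{\rm red}(G,\Sigma)$ are viewed as bounded functions on $\Sigma$. $C_0(X)$ is included by $b\mapsto\tilde b$, $\tilde b(x,\theta)=\overline\theta b(x)$ on $X\times\mathbb T$ and $\tilde b=0$ elsewhere. $Q$ is the map from $C^*_{\rm red}(G,\Sigma)$ to the space of bounded complex functions on $X$ given by $Q(f)(x)=f(x,1)$. $\mathrm{PIN}(B)$ is the inverse semigroup of partial isometries $u\in A$ with $u^*u,uu^*\in B$, $uBu^*\subset B$, $u^*Bu\subset B$; it contains $\{\Delta_S:S\in\mathrm{Bis}(\Sigma)\}$, and $S\mapsto\Delta_S$ is injective. For $u\in\mathrm{PIN}(B)$, $\mathrm{dom}(u)\subset X$ is the compact open set whose characteristic function is $u^*u$. $Q$ is separating if, for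 every $u\in\mathrm{PIN}(B)$ and every $x\in\mathrm{dom}(u)$ such that the germ of $u$ at $x$ is non-trivial, one has $Q(u)(x)=0$. Here the germ of $u$ at $x$ is trivial if there is a projection $e\in B$ with $e(x)=1$ and $ue\in B$. $G$ is effective if the interior of its isotropy bundle $\{\gamma:r(\gamma)=d(\gamma)\}$ is $G^{(0)}$. *)

(* Defs.v *)
From HB Require Import structures.
From mathcomp Require Import all_boot all_order all_algebra.
From mathcomp Require Import complex.
From mathcomp Require Import all_classical all_reals all_analysis.
Set Implicit Arguments.
Unset Strict Implicit.
Unset Printing Implicit Defensive.
Import Order.TTheory GRing.Theory Num.Theory.
Import numFieldNormedType.Exports.
Local Open Scope classical_set_scope.
Local Open Scope ring_scope.
Local Open Scope complex_scope.

(* MathComp-Analysis puts the norm topology on [R[i]^o] only; transfer it to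
   [R[i]]. *)
HB.instance Definition _ (R : realType) :=
  PseudoPointedMetric.copy R[i] R[i]^o.

(* The library's [locally_compact] asks for compact *closed* neighbourhoods,
   which is too strong in the absence of the Hausdorff property. *)
Definition locally_compact_space (T : topologicalType) :=
  forall x : T, exists2 K : set T, nbhs x K & compact K.

Definition locally_closed (T : topologicalType) (A : set T) :=
  exists U F : set T, [/\ open U, closed F & A = U `&` F].

Definition homeo_on (T U : topologicalType) (A : set T) (B : set U)
    (f : T -> U) :=
  [/\ set_bij A B f,
      {within A, continuous f} &
      exists2 g : U -> T, {within B, continuous g} &
        forall t, A t -> g (f t) = t].

Definition homeo_onto_open (T U : topologicalType) (A : set T) (f : T -> U) :=
  open (f @` A) /\ homeo_on A (f @` A) f.

Definition local_homeo (T U : topologicalType) (f : T -> U) :=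
  forall t, exists V : set T, [/\ open V, V t & homeo_onto_open V f].

(* A groupoid with space of units [X] and space of arrows [G]; the product is
   a total function, whose values are meaningful only on composable pairs
   ([gdom g = grng h]). *)
Record groupoid (X G : Type) := Groupoid {
  grng : G -> X;
  gdom : G -> X;
  gunt : X -> G;
  ginv : G -> G;
  gmul : G -> G -> G;
  grng_unt : forall x, grng (gunt x) = x;
  gdom_unt : forall x, gdom (gunt x) = x;
  grng_inv : forall g, grng (ginv g) = gdom g;
  gdom_inv : forall g, gdom (ginv g) = grng g;
  grng_mul : forall g h, gdom g = grng h -> grng (gmul g h) = grng g;
  gdom_mul : forall g h, gdom g = grng h -> gdom (gmul g h) = gdom h;
  gmul_assoc : forall g h k, gdom g = grng h -> gdom h = grng k ->
    gmul g (gmul h k) = gmul (gmul g h) k;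
  gmul_unt_l : forall g, gmul (gunt (grng g)) g = g;
  gmul_unt_r : forall g, gmul g (gunt (gdom g)) = g;
  gmul_inv_l : forall g, gmul (ginv g) g = gunt (gdom g);
  gmul_inv_r : forall g, gmul g (ginv g) = gunt (grng g)
}.

(* Since [grng \o gunt = id], continuity of [grng] and [gunt] makes [gunt] a
   homeomorphism of [X] onto the set of units with its relative topology. *)
Definition topological_groupoid (X G : topologicalType) (g : groupoid X G) :=
  [/\ continuous (grng g), continuous (gdom g), continuous (gunt g),
      continuous (ginv g) &
      {within [set hk : G * G | gdom g hk.1 = grng g hk.2],
        continuous (fun hk => gmul g hk.1 hk.2)}].

Definition etale_groupoid (X G : topologicalType) (g : groupoid X G) :=
  [/\ topological_groupoid g, locally_compact_space G,
      local_homeo (grng g) & local_homeo (gdom g)].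

Definition boolean_groupoid (X G : topologicalType) (g : groupoid X G) :=
  [/\ etale_groupoid g, locally_compact_space X, hausdorff_space X &
      totally_disconnected [set: X]].

Definition effective (X G : topologicalType) (g : groupoid X G) :=
  interior [set h | grng g h = gdom g h] = range (gunt g).

Definition circle (R : realType) : set R[i] := [set z | `|z| = 1].
Arguments circle : clear implicits.

Lemma circle_one_subproof (R : realType) : (1 : R[i]) \in circle R.
Proof. by apply/mem_set; rewrite /circle /= normr1. Qed.

Lemma circle_mul_subproof (R : realType) (a b : circle R) :
  set_val a * set_val b \in circle R.
Proof.
apply/mem_set; rewrite /circle /= normrM.
by rewrite (set_valP a : `|_| = 1) (set_valP b : `|_| = 1) mulr1.
Qed.

Definition circle_one (R : realType) : circle R :=
  exist _ 1 (circle_one_subproof R).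

Definition circle_mul (R : realType) (a b : circle R) : circle R :=
  exist _ (set_val a * set_val b) (circle_mul_subproof a b).

Record twisted_boolean_groupoid (R : realType) (X G Sigma : topologicalType) :=
  TwistedBooleanGroupoid {
    tgrp : groupoid X G;
    text : groupoid X Sigma;
    tproj : Sigma -> G;
    tcirc : X * circle R -> Sigma;
    tgrp_boolean : boolean_groupoid tgrp;
    text_topological : topological_groupoid text;
    text_locally_compact : locally_compact_space Sigma;
    tproj_rng : forall s, grng tgrp (tproj s) = grng text s;
    tproj_dom : forall s, gdom tgrp (tproj s) = gdom text s;
    tproj_unt : forall x, tproj (gunt text x) = gunt tgrp x;
    tproj_mul : forall s t, gdom text s = grng text t ->
      tproj (gmul text s t) = gmul tgrp (tproj s) (tproj t);
    tproj_continuous : continuous tproj;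
    tproj_open : forall U : set Sigma, open U -> open (tproj @` U);
    tproj_surj : forall h, exists s, tproj s = h;
    tcirc_unt : forall x, tcirc (x, circle_one R) = gunt text x;
    tcirc_mul : forall x a b,
      gmul text (tcirc (x, a)) (tcirc (x, b)) = tcirc (x, circle_mul a b);
    tcirc_homeo : homeo_on [set: X * circle R] (range tcirc) tcirc;
    tcirc_locally_closed : locally_closed (range tcirc);
    tcirc_ker : forall s x,
      tproj s = gunt tgrp x <-> exists a, s = tcirc (x, a);
    tcirc_central : forall a s,
      gmul text (tcirc (grng text s, a)) s = gmul text s (tcirc (gdom text s, a))
  }.

Section twisted.
Context (R : realType) (X G Sigma : topologicalType).
Variable T : twisted_boolean_groupoid R X G Sigma.

Local Notation C := R[i].
Local Notation gG := (tgrp T).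
Local Notation gS := (text T).

Definition tact (a : circle R) (s : Sigma) : Sigma :=
  gmul gS (tcirc T (grng gS s, a)) s.

Definition tlift (h : G) : Sigma := projT1 (cid (tproj_surj T h)).

Definition Bis (S : set Sigma) :=
  [/\ compact S, homeo_onto_open S (grng gS) & homeo_onto_open S (gdom gS)].

(* For [S] in [Bis Sigma] the decomposition [s = theta tau] is unique, so the
   choice made by [cid] is immaterial. *)
Definition Delta (S : set Sigma) (s : Sigma) : C :=
  match pselect (exists a : circle R, exists2 t, S t & s = tact a t) with
  | left h => (set_val (projT1 (cid h)))^*
  | right _ => 0
  end.

Definition is_csum (I : choiceType) (D : set I) (F : I -> C) (z : C) :=
  forall e : R, 0 < e -> exists2 E0, fsets D E0 &
    forall E, fsets D E -> E0 `<=` E ->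
      ComplexField.Normc.normc (z - \sum_(i \in E) F i) < e.

(* Sum of an unconditionally summable family, and 0 otherwise. *)
Definition csum (I : choiceType) (D : set I) (F : I -> C) : C :=
  xget 0 (is_csum D F).

Definition convol (f g : Sigma -> C) (s : Sigma) : C :=
  csum [set h : G | grng gG h = grng gS s]
    (fun h => f (tlift h) * g (gmul gS (ginv gS (tlift h)) s)).

Definition fstar (f : Sigma -> C) (s : Sigma) : C := (f (ginv gS s))^*.

Definition Cc_space (b : X -> C) :=
  continuous b /\ compact (closure [set x | b x != 0]).

Definition Cc_twist (f : Sigma -> C) :=
  exists (n : nat) (S : 'I_n -> set Sigma) (b : 'I_n -> X -> C),
    [/\ forall i, Bis (S i), forall i, Cc_space (b i) &
        forall s, f s = \sum_(i < n) Delta (S i) s * b i (gdom gS s)].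

(* [|xi sigma|] depends only on the class of [sigma] in [G], so the choice of
   the lift is immaterial for equivariant functions. *)
Definition hilb_norm (x : X) (xi : Sigma -> C) : \bar R :=
  ((\esum_(h in [set h : G | gdom gG h = x])
      ((ComplexField.Normc.normc (xi (tlift h))) ^+ 2)%:E) `^ 2^-1)%E.

(* Functions on [d^-1(x)] are extended by 0 to the whole of [Sigma]. *)
Definition hilb (x : X) (xi : Sigma -> C) :=
  [/\ forall s, gdom gS s <> x -> xi s = 0,
      forall a s, gdom gS s = x -> xi (tact a s) = (set_val a)^* * xi s &
      (hilb_norm x xi < +oo)%E].

(* Operator norm of [pi_x(f) : xi |-> f * xi]. *)
Definition pi_norm (x : X) (f : Sigma -> C) : \bar R :=
  ereal_sup [set hilb_norm x (convol f xi) |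
    xi in [set xi | hilb x xi /\ (hilb_norm x xi <= 1)%E]].

Definition red_norm (f : Sigma -> C) : \bar R :=
  ereal_sup (range (fun x => pi_norm x f)).

(* The completion of C_c(G, Sigma) realized as functions: since
   [|f sigma| <= red_norm f], evaluation at [sigma] extends to the completion,
   and the class of a Cauchy sequence is identified with its pointwise
   limit. *)
Definition Cred : set (Sigma -> C) :=
  [set f | exists u : nat -> Sigma -> C,
    [/\ forall n, Cc_twist (u n),
        forall e : R, 0 < e -> exists N : nat, forall m n : nat,
          (N <= m)%N -> (N <= n)%N ->
          (red_norm (fun s => (u m s - u n s)%R) < e%:E)%E &
        forall s, (fun n => u n s) @ \oo --> f s]].

Definition C0_space (b : X -> C) :=
  continuous b /\
  forall e : R, 0 < e -> exists2 K : set X, compact K &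
    forall x, ~ K x -> ComplexField.Normc.normc (b x) < e.

Definition tilde (b : X -> C) (s : Sigma) : C :=
  match pselect (exists xa : X * circle R, s = tcirc T xa) with
  | left h => let xa := projT1 (cid h) in (set_val xa.2)^* * b xa.1
  | right _ => 0
  end.

Definition Bdiag : set (Sigma -> C) := [set tilde b | b in C0_space].

Definition Qmap (f : Sigma -> C) (x : X) : C := f (tcirc T (x, circle_one R)).

Definition PIN (u : Sigma -> C) :=
  [/\ Cred u, convol (convol u (fstar u)) u = u,
      Bdiag (convol (fstar u) u) /\ Bdiag (convol u (fstar u)),
      forall b, Bdiag b -> Bdiag (convol (convol u b) (fstar u)) &
      forall b, Bdiag b -> Bdiag (convol (convol (fstar u) b) u)].

Definition PIN_eq_Bis :=
  forall u, PIN u -> exists2 S, Bis S & u = Delta S.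

(* [u^* u] is an element of B; [Qmap] recovers it as a function on [X]. *)
Definition pin_dom (u : Sigma -> C) : set X :=
  [set x | Qmap (convol (fstar u) u) x = 1].

Definition germ_trivial (u : Sigma -> C) (x : X) :=
  exists e, [/\ Bdiag e, convol e e = e /\ fstar e = e, Qmap e x = 1 &
                Bdiag (convol u e)].

Definition Q_separating :=
  forall u x, PIN u -> pin_dom u x -> ~ germ_trivial u x -> Qmap u x = 0.

Definition sub_Cstar_algebra (D : set (Sigma -> C)) :=
  [/\ D `<=` Cred,
      D (fun=> 0) /\ (forall f g, D f -> D g -> D (fun s => f s + g s)),
      forall (c : C) f, D f -> D (fun s => c * f s),
      (forall f g, D f -> D g -> D (convol f g)) /\
      (forall f, D f -> D (fstar f)) &
      forall f, Cred f ->
        (forall e : R, 0 < e -> exists2 g, D g &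
          (red_norm (fun s => (f s - g s)%R) < e%:E)%E) -> D f].

Definition abelian_subalgebra (D : set (Sigma -> C)) :=
  sub_Cstar_algebra D /\ forall f g, D f -> D g -> convol f g = convol g f.

Definition maximal_abelian (D : set (Sigma -> C)) :=
  abelian_subalgebra D /\
  forall E, abelian_subalgebra E -> D `<=` E -> E = D.

End twisted.

(* Main.v *)
(** The representations pi_x act on the fibres d^-1(x) of the twist, so choosing a lift of each
  element of G packs all of them into a single block diagonal matrix with entries
  f (sigma tau^-1).  Thus C*_red(G, Sigma) is the closure of C_c(G, Sigma) inside the equivariant
  functions whose matrix is bounded on l^2(G); convolution is matrix multiplication, and
  associativity, the involution and |f| <= ||f||_red are inherited from matrices.

  (i) => (ii): Delta_S is nonzero at the unit over x only if S meets the open set X x T there, so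
  near x it is a function on the diagonal.
  (ii) => (i): for u in PIN(B) pick sigma over x with u(sigma) <> 0 and a bisection S through it.
  Then v = Delta_S^* u is in PIN(B) with Q(v)(x) <> 0, so its germ is trivial, and u is locally a
  unimodular multiple of Delta_S, hence some Delta_S'.  The points where u = 1, one over each point of dom(u), form the
  required bisection.
  (ii) => (iii): let h = h^* commute with B.  Scale h to be small and cut it to a compact open
  set K; the Cayley transform of i h is a unitary 1_K + 2 w of PIN(B), close enough to 1_K for Q
  not to vanish on K.  All germs being trivial, w and hence h are in B.
  (iii) => (iv): a compact open bisection S inside the isotropy and off the units would give a
  normal element Delta_S commuting with B; the bicommutant of B, Delta_S and Delta_S^* would be an
  abelian subalgebra strictly larger than B.
  (iv) => (ii), G Hausdorff: elements of A are now continuous.  If Q(u)(x) <> 0, the identity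
  b u = u (u^* b u) forces r = d on the support of u near x; this support is open, so it
  consists of units, and the germ is trivial. *)

(* When [G] is not Hausdorff, [Delta_S] and the elements of the algebra need not be continuous, and
   Q(f) need not lie in C_0(X). In the passage from (ii) to (iii), membership in B is therefore
   obtained locally, from trivial germs, and glued over compact open sets. A compact bisection is
   needed through every arrow of the twist; since the extension is only assumed open, local
   triviality of the circle bundle has to be proved, and total disconnectedness of the unit space
   makes this possible. Spectral theory is replaced by a geometric series: if a has norm at most
   1/8, then w = a + a w has norm at most 1/4, so 2 w stays below 1 in modulus and 1 + 2 w cannot
   vanish at a unit. Norms are never computed; only the relation of being bounded by a constant is
   used, tested on finite blocks of the matrix, which makes it stable under entrywise limits.
   Bicommutants are automatically closed under all operations, so no generated subalgebra has to be
   described. *)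
From HB Require Import structures.
Require Import Defs.
From mathcomp Require Import all_boot all_order all_algebra.
From mathcomp Require Import complex.
From mathcomp Require Import finmap.
From mathcomp Require Import all_classical all_reals all_analysis.
From mathcomp Require Import ring lra.
Set Implicit Arguments.
Unset Strict Implicit.
Unset Printing Implicit Defensive.
Import Order.TTheory GRing.Theory Num.Theory.
Import numFieldNormedType.Exports.
Local Open Scope classical_set_scope.
Local Open Scope ring_scope.
Local Open Scope complex_scope.

(** * Compact open sets *)

Section compact_open_sets.
Context (X : topologicalType).
Implicit Types (A D E K U V : set X).

(** If every [D] left a point of [K] outside [U], the traces of the [D] on [K] minus [U] would
    generate a proper filter; its cluster point lies in every closed [D], hence in the open set [U],
    which the traces avoid. *)
Lemma compact_directed (K : set X) (P : set (set X)) (U : set X) :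
  compact K -> P !=set0 -> (forall D, P D -> closed D) ->
  (forall D E, P D -> P E -> exists2 F, P F & F `<=` D `&` E) ->
  open U -> K `&` \bigcap_(D in P) D `<=` U ->
  exists2 D, P D & K `&` D `<=` U.
Proof.
move=> cK P0 Pc Pdir oU KU; apply: contrapT => nD.
pose F := filter_from P (fun D => K `&` D `\` U).
have FF : ProperFilter F.
  apply: filter_from_proper; last first.
    move=> D PD; apply: contrapT => D0; apply: nD; exists D => // x KDx.
    by apply: contrapT => nU; apply: D0; exists x.
  apply: filter_from_filter => // D E PD PE.
  have [G PG GDE] := Pdir _ _ PD PE.
  by exists G => // x [[Kx /GDE [Dx Ex]] nUx]; split; split.
have FK : F K.
  by case: P0 => D PD; exists D => // x [[]].
have [z [Kz clz]] := cK F FF FK.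
have Uz : U z.
  apply: KU; split=> // D PD; apply: (Pc D PD) => W Wz.
  have FD : F (K `&` D `\` U) by exists D.
  by have [y [[[_ Dy] _] Wy]] := clz _ _ FD Wz; exists y.
case: P0 => D PD.
have FD : F (K `&` D `\` U) by exists D.
by have [y [[_ nUy] Uy]] := clz _ _ FD (open_nbhs_nbhs (conj oU Uz)).
Qed.

(** Compactness as a local-to-global principle: if [K] were not in the ideal, the sets whose
    complement in [K] is in the ideal would form a proper filter with no cluster point in [K]. *)
Lemma compact_ideal (K : set X) (I : set X -> Prop) : compact K -> I set0 ->
  (forall A B, I A -> I B -> I (A `|` B)) ->
  (forall A B, A `<=` B -> I B -> I A) ->
  (forall x, K x -> exists2 V, nbhs x V & I V) -> I K.
Proof.
move=> cK I0 IU IS Iloc; apply: contrapT => nIK.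
pose F := [set A | I (K `\` A)].
have FF : ProperFilter F.
  split; first by rewrite /F /= setD0.
  split.
  - by rewrite /F /= setDT.
  - by move=> A B; rewrite /F /= setDIr; exact: IU.
  - by move=> A B AB; rewrite /F /=; apply: IS => z [Kz nB]; split=> // /AB.
have [|z [Kz clz]] := cK F FF; first by rewrite /F /= setDv.
have [V Vz IV] := Iloc z Kz.
have FV : F (~` V).
  by rewrite /F /= setDE setCK; apply: IS IV => y [].
by have [y []] := clz _ _ FV Vz.
Qed.

Hypothesis hX : hausdorff_space X.

(** Normality of a compact Hausdorff set, by two rounds of [compact_directed]: closures of
    neighbourhoods of a point outside [A], then closures of neighbourhoods of [A]. The separating
    sets are open in [X], which is not assumed compact. *)
Lemma separate_compacts (K A E : set X) : compact K -> closed A -> closed E ->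
  A `<=` K -> E `<=` K -> A `&` E = set0 ->
  exists U V, [/\ open U, open V, A `<=` U, E `<=` V & U `&` V = set0].
Proof.
move=> cK cA cE AK EK AE0.
have pt e : ~ A e -> exists V, [/\ open V, V e & closure V `&` A = set0].
  move=> nAe.
  pose P := [set D | exists2 V, open_nbhs e V & D = closure V].
  have [| | | | |D [V [oV Ve] ->] KD] := @compact_directed K P (~` A) cK.
  - by exists (closure setT), setT => //; split=> //; exact: openT.
  - by move=> _ [V _ ->]; exact: closed_closure.
  - move=> _ _ [V [oV Ve] ->] [W [oW We] ->].
    exists (closure (V `&` W)); last exact: closureI.
    by exists (V `&` W) => //; split=> //; exact: openI.
  - exact: closed_openC.
  - move=> y [_ yP] /=; suff <- : e = y by [].
    apply: hX => M N Me Ny.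
    have /yP : P (closure M°).
      by exists M° => //; split; [exact: open_interior|exact: Me].
    move=> /(_ N Ny) [z [Mz Nz]].
    by exists z; split=> //; exact: interior_subset.
  exists V; split=> //; rewrite -subset0 => z [Vz Az].
  by apply: (KD z) => //; split=> //; exact: AK.
pose P := [set D | exists2 U, open U /\ A `<=` U & D = closure U].
have [| | | | |D [U [oU AU] ->] KD] := @compact_directed K P (~` E) cK.
- by exists (closure setT), setT => //; split=> //; exact: openT.
- by move=> _ [V _ ->]; exact: closed_closure.
- move=> _ _ [V [oV AV] ->] [W [oW AW] ->].
  exists (closure (V `&` W)); last exact: closureI.
  exists (V `&` W) => //; split; first exact: openI.
  by move=> z Az; split; [exact: AV|exact: AW].
- exact: closed_openC.
- move=> y [Ky yP] /= Ey.
  have nAy : ~ A y by move=> Ay; have : (A `&` E) y by []; rewrite AE0.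
  have [V [oV Vy VA]] := pt y nAy.
  have /yP : P (closure (~` closure V)).
    exists (~` closure V) => //; split; first exact/closed_openC/closed_closure.
    by move=> z Az Vz; have : (closure V `&` A) z by []; rewrite VA.
  by move=> /(_ V (open_nbhs_nbhs (conj oV Vy))) [z [nVz /subset_closure]].
exists U, (~` closure U); split => //.
- exact/closed_openC/closed_closure.
- by move=> z Ez Uz; apply: (KD z) => //; split => //; exact: EK.
- by rewrite -subset0 => z [Uz]; apply; exact: subset_closure.
Qed.

Hypothesis dX : totally_disconnected [set: X].

(* Compactness makes quasi-components connected, hence reduced to points. *)
Lemma compact_open_sub (K U : set X) (x : X) : compact K -> open U -> U x ->
  U `<=` K -> exists L, [/\ compact L, open L, L x & L `<=` U].
Proof.
move=> cK oU Ux UK.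
have clK : closed K by exact: compact_closed.
(* Closedness of both [D] and its complement in [K] encodes a relatively clopen neighbourhood of
   [x]; the intersection [Q] below is the quasi-component of [x] in [K]. *)
pose P := [set D | [/\ closed D, closed (K `\` D), D x & D `<=` K]].
have PK : P K.
  by split => //; [rewrite setDv; exact: closed0|exact: UK].
have PI D E : P D -> P E -> P (D `&` E).
  move=> [cD cD' Dx DK] [cE cE' Ex EK]; split=> //; first exact: closedI.
    by rewrite setDIr; exact: closedU.
  by move=> z [/DK].
pose Q := \bigcap_(D in P) D.
have Qx : Q x by move=> D [].
have QK : Q `<=` K by move=> z /(_ K PK).
have cQ : closed Q by apply: closed_bigI => D [].
have small V : open V -> Q `<=` V -> exists2 D, P D & D `<=` V.
  move=> oV QV.
  have [| | | |D PD DV] := @compact_directed K P V cK _ _ _ oV.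
  - by exists K.
  - by move=> D [].
  - by move=> D E PD PE; exists (D `&` E) => //; exact: PI.
  - by move=> z [_ /QV].
  by exists D => // z Dz; apply: DV; split=> //; case: PD => _ _ _; apply.
have conQ : connected Q.
  move=> B [b Bb] [C oC BC] [C' cC' BC'].
  have cB : closed B by rewrite BC'; exact: closedI.
  have cB' : closed (Q `\` B).
    suff -> : Q `\` B = Q `&` ~` C by apply: closedI => //; exact: open_closedC.
    rewrite BC; apply/seteqP; split=> z [Qz nC]; split=> //.
      by move=> Cz; apply: nC.
    by move=> [_ Cz].
  have BQ : B `<=` Q by rewrite BC => z [].
  have [U1 [U2 [oU1 oU2 BU1 BU2 U120]]] : exists U V, [/\ open U, open V,
      B `<=` U, Q `\` B `<=` V & U `&` V = set0].
    apply: (@separate_compacts K) => //.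
    - by move=> z /BQ/QK.
    - by move=> z [/QK].
    - by rewrite -subset0 => z [Bz [_]]; apply.
  have [|D PD DU] := small (U1 `|` U2) (openU oU1 oU2).
    move=> z Qz; case: (pselect (B z)) => Bz; [left; exact: BU1|].
    by right; apply: BU2.
  have DU12 : D `&` U1 = D `\` U2.
    apply/seteqP; split=> z [Dz].
      move=> U1z; split=> // U2z.
      by have : (U1 `&` U2) z by []; rewrite U120.
    by move=> nU2; split=> //; case: (DU z Dz).
  have DU21 : D `&` U2 = D `\` U1.
    apply/seteqP; split=> z [Dz].
      move=> U2z; split=> // U1z.
      by have : (U1 `&` U2) z by []; rewrite U120.
    by move=> nU1; split=> //; case: (DU z Dz).
  have [cD cD' Dx DK] := PD.
  have KD1 : closed (K `\` (D `&` U1)) /\ closed (K `\` (D `&` U2)).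
    split; rewrite setDIr; apply: closedU => //;
    by rewrite setDE; apply: closedI => //; exact: open_closedC.
  have cD12 : closed (D `&` U1) /\ closed (D `&` U2).
    by rewrite DU12 DU21 !setDE; split; apply: closedI => //;
      exact: open_closedC.
  (* Cutting [D] by the open set around the half that contains [x] gives a member of [P], so [Q]
     lies entirely in that half. *)
  case: (pselect (B x)) => Bx.
    have PD1 : P (D `&` U1).
      by split; [case: cD12|case: KD1|split=> //; exact: BU1|move=> z [/DK]].
    apply/seteqP; split=> // z Qz; apply: contrapT => nBz.
    have [_ U1z] := Qz _ PD1.
    have : (U1 `&` U2) z by split=> //; apply: BU2.
    by rewrite U120.
  have PD2 : P (D `&` U2).
    by split; [case: cD12|case: KD1|split=> //; apply: BU2|move=> z [/DK]].
  have [_ U2b] := BQ _ Bb _ PD2.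
  have : (U1 `&` U2) b by split=> //; exact: BU1.
  by rewrite U120.
have Q1 : Q `<=` [set x].
  rewrite -(dX (I : [set: X] x)).
  by apply: connected_component_max.
have [|D [cD cD' Dx DK] DU] := small U oU; first by move=> z /Q1 ->.
exists D; split=> //; first exact: (subclosed_compact cD cK).
have -> : D = U `&` ~` (K `\` D).
  apply/seteqP; split=> z.
    by move=> Dz; split; [exact: DU|move=> []].
  by move=> [Uz nz]; apply: contrapT => nD; apply: nz; split=> //; exact: UK.
by apply: openI => //; exact: closed_openC.
Qed.

Lemma compact_open_nbhs (U : set X) (x : X) : locally_compact_space X ->
  nbhs x U -> exists L, [/\ compact L, open L, L x & L `<=` U].
Proof.
move=> lc Ux; have [K Kx cK] := lc x.
have [||L [cL oL Lx LU]] :=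
    @compact_open_sub K (U `&` K)° x cK (@open_interior _ _).
- exact: filterI.
- by move=> z /interior_subset [].
by exists L; split=> // z /LU/interior_subset[].
Qed.

(** [P] is only assumed stable under disjoint unions and need not pass to subsets. The ideal
    therefore consists of the sets inside a compact open [L] all of whose compact open subsets
    satisfy [P], and a subset of [L] union [M] is split into its part in [L] and its part
    outside. *)
Lemma clopen_ind (P : set X -> Prop) (K : set X) : compact K -> open K ->
  P set0 ->
  (forall A B, compact A -> open A -> compact B -> open B ->
     A `&` B = set0 -> P A -> P B -> P (A `|` B)) ->
  (forall x, K x -> exists L, [/\ compact L, open L, L x &
     forall A, compact A -> open A -> A `<=` L -> P A]) ->
  P K.
Proof.
move=> cK oK P0 PU Ploc.
pose I A := exists L, [/\ compact L, open L, A `<=` L &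
  forall B, compact B -> open B -> B `<=` L -> P B].
suff [L [_ _ KL]] : I K by exact.
apply: compact_ideal => //.
- exists set0; split=> //; [exact: compact0|exact: open0|].
  by move=> B _ _; rewrite subset0 => ->.
- move=> A B [L [cL oL AL PL]] [M [cM oM BM PM]]; exists (L `|` M); split.
  + exact: compactU.
  + exact: openU.
  + exact: setUSS.
  + move=> D cD oD DLM; rewrite -(setUIDK D L).
    have clL : closed L by exact: compact_closed.
    have clD : closed D by exact: compact_closed.
    have cDL : compact (D `&` L).
      by apply: (subclosed_compact _ cD) => //; exact: closedI.
    have cDL' : compact (D `\` L).
      rewrite setDE; apply: (subclosed_compact _ cD) => //.
      by apply: closedI => //; exact: open_closedC.
    have oDL' : open (D `\` L).
      by rewrite setDE; apply: openI => //; exact: closed_openC.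
    apply: PU => //; first exact: openI.
    + by rewrite -subset0 => z [[_ Lz] [_]].
    + apply: PL => //; exact: openI.
    + by apply: PM => // z [/DLM[]].
- by move=> A B AB [L [cL oL BL PL]]; exists L; split=> //; exact: subset_trans AB BL.
- move=> x /Ploc [L [cL oL Lx PL]]; exists L; last by exists L; split.
  exact: open_nbhs_nbhs.
Qed.

End compact_open_sets.

(** * Complex numbers and the circle *)

Section complex_modulus.
Context (R : realType).
Implicit Types z w : R[i].

Local Notation nc := (@ComplexField.Normc.normc R).

Lemma normcE z : `|z| = (nc z)%:C.
Proof. by []. Qed.

Lemma nc_ge0 z : 0 <= nc z.
Proof. by case: z => a b; exact: sqrtr_ge0. Qed.

Lemma nc0 : nc 0 = 0. Proof. exact: ComplexField.Normc.normc0. Qed.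

Lemma nc1 : nc 1 = 1. Proof. exact: ComplexField.Normc.normc1. Qed.

Lemma nc_eq0 z : nc z = 0 -> z = 0.
Proof. exact: ComplexField.Normc.eq0_normc. Qed.

Lemma ncM z w : nc (z * w) = nc z * nc w.
Proof. exact: ComplexField.Normc.normcM. Qed.

Lemma ncN z : nc (- z) = nc z.
Proof. exact: (normcN (z : Rcomplex R)). Qed.

Lemma ncD z w : nc (z + w) <= nc z + nc w.
Proof. exact: (le_normcD (z : Rcomplex R)). Qed.

Lemma ncB z w : nc (z - w) <= nc z + nc w.
Proof. by rewrite -(ncN w); exact: ncD. Qed.

Lemma nc_distC z w : nc (z - w) = nc (w - z).
Proof. by rewrite -ncN opprB. Qed.

Lemma nc_dist u z w : nc (z - w) <= nc (z - u) + nc (u - w).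
Proof.
have -> : z - w = (z - u) + (u - w) by ring.
exact: ncD.
Qed.

Lemma nc_conj z : nc z^*%C = nc z.
Proof. by case: z => a b /=; rewrite sqrrN. Qed.

Lemma nc_real (x : R) : nc x%:C = `|x|.
Proof. by rewrite /= expr0n /= addr0 sqrtr_sqr. Qed.

Lemma nc_sqr z : z * z^*%C = (nc z ^+ 2)%:C.
Proof.
case: z => a b; rewrite /= sqr_sqrtr ?addr_ge0 ?sqr_ge0 //.
by apply/eqP; rewrite eq_complex /=; apply/andP; split; apply/eqP; ring.
Qed.

Lemma nc_Re z : `|complex.Re z| <= nc z.
Proof.
case: z => a b /=; rewrite -(sqrtr_sqr a) ler_sqrt ?addr_ge0 ?sqr_ge0 //.
by rewrite lerDl sqr_ge0.
Qed.

Lemma nc_Im z : `|complex.Im z| <= nc z.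
Proof.
case: z => a b /=; rewrite -(sqrtr_sqr b) ler_sqrt ?addr_ge0 ?sqr_ge0 //.
by rewrite lerDr sqr_ge0.
Qed.

Lemma nc_ReIm (a b : R) : nc (a +i* b) <= `|a| + `|b|.
Proof.
have -> : a +i* b = a%:C + (0 +i* b) by apply/eqP; rewrite eq_complex /= addr0 add0r !eqxx.
apply: (le_trans (ncD _ _)); rewrite nc_real lerD2l /=.
by rewrite expr0n /= add0r sqrtr_sqr.
Qed.

Lemma nc_sum (I : Type) (r : seq I) (P : pred I) (F : I -> R[i]) :
  nc (\sum_(i <- r | P i) F i) <= \sum_(i <- r | P i) nc (F i).
Proof.
elim/big_rec2: _ => [|i x y _ le]; first by rewrite nc0.
by apply: (le_trans (ncD _ _)); rewrite lerD2l.
Qed.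

Lemma nc_lt_eq0 z : (forall e : R, 0 < e -> nc z <= e) -> z = 0.
Proof.
move=> H; apply: nc_eq0; apply/eqP; rewrite eq_le nc_ge0 andbT.
by apply/ler_addgt0Pl => e /H; rewrite addr0.
Qed.

Lemma small_invS (e : R) : 0 < e ->
  exists N : nat, forall n, (N <= n)%N -> n.+1%:R^-1 < e.
Proof.
move=> e0; exists (Num.truncn e^-1) => n Nn.
by rewrite invf_plt ?posrE // (lt_le_trans (truncnS_gt _)) // ler_nat ltnS.
Qed.

Lemma nbhs_complexP z (A : set R[i]) :
  nbhs z A <-> exists2 e : R, 0 < e & forall w, nc (z - w) < e -> A w.
Proof.
split.
  move=> /nbhs_ballP [e e0 eA].
  (* In the partial order of [R[i]] a positive number is real. *)
  have [ie re] : complex.Im e = 0 /\ 0 < complex.Re e.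
    by move: e0; rewrite /= ltcE /= => /andP[/eqP -> ->].
  have eE : e = (complex.Re e)%:C by apply/eqP; rewrite eq_complex /= ie !eqxx.
  exists (complex.Re e) => // w zw; apply: eA.
  by rewrite eE /ball /= normcE ltcR.
move=> [e e0 eA]; apply/nbhs_ballP; exists e%:C; first by rewrite /= ltcR.
by move=> w; rewrite /ball /= normcE ltcR => /eA.
Qed.

Lemma cvg_complexP (u : nat -> R[i]) z :
  u @ \oo --> z <-> forall e : R, 0 < e ->
    exists N : nat, forall n, (N <= n)%N -> nc (z - u n) < e.
Proof.
split=> [H e e0|H A /nbhs_complexP [e e0 eA]].
  have /H [N _ NP] : nbhs z [set w | nc (z - w) < e].
    by apply/nbhs_complexP; exists e.
  by exists N => n /NP.
by have [N NP] := H e e0; exists N => // n /= /NP /eA.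
Qed.

Lemma complex_cauchy_cvg (u : nat -> R[i]) :
  (forall e : R, 0 < e -> exists N : nat, forall m n, (N <= m)%N -> (N <= n)%N ->
    nc (u m - u n) < e) -> exists z, u @ \oo --> z.
Proof.
move=> H.
have main (f : R[i] -> R) : (forall z w, `|f z - f w| <= nc (z - w)) ->
    exists l : R, forall e : R, 0 < e ->
      exists N : nat, forall n, (N <= n)%N -> `|l - f (u n)| < e.
  move=> fl.
  have cf : cvg ((f \o u) @ \oo).
    apply/cauchy_cvgP/cauchy_exP => e e0.
    have [N NP] := H e e0; exists (f (u N)); exists N => // n /= Nn.
    by rewrite /ball /=; apply: (le_lt_trans (fl _ _)); exact: NP.
  exists (lim ((f \o u) @ \oo)) => e e0.
  have /cvgrPdist_lt /(_ e e0) [N _ NP] := cf.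
  by exists N => n /NP.
have [|a aP] := main (@complex.Re R); first by move=> z w; rewrite -raddfB; exact: nc_Re.
have [|b bP] := main (@complex.Im R); first by move=> z w; rewrite -raddfB; exact: nc_Im.
exists (a +i* b); apply/cvg_complexP => e e0.
have e20 : 0 < e / 2 by rewrite divr_gt0.
have [N NP] := aP _ e20; have [M MP] := bP _ e20.
exists (maxn N M) => n; rewrite geq_max => /andP[/NP h1 /MP h2].
case: (u n) h1 h2 => c d /= h1 h2.
by apply: (le_lt_trans (nc_ReIm (a - c) (b - d))); lra.
Qed.

Lemma continuous_complexP (T : topologicalType) (f : T -> R[i]) :
  continuous f <-> forall x (e : R), 0 < e -> nbhs x [set y | nc (f x - f y) < e].
Proof.
split=> [H x e e0|H x A /nbhs_complexP [e e0 eA]].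
  by apply: (H x [set w | nc (f x - w) < e]); apply/nbhs_complexP; exists e.
by have := H x e e0; apply: filterS => y /= /eA.
Qed.

Lemma within_continuousP (T U : topologicalType) (A : set T) (f : T -> U) :
  {within A, continuous f} <->
  forall x, A x -> forall N, nbhs (f x) N -> nbhs x [set y | A y -> N (f y)].
Proof.
split=> [/subspace_continuousP H x Ax N fN|H].
  by have := H x Ax N fN.
by apply/subspace_continuousP => x Ax N fN; exact: H.
Qed.

Lemma continuous_bounded (T : topologicalType) (f : T -> R[i]) (K : set T) :
  continuous f -> compact K -> exists2 M : R, 0 < M & forall x, K x -> nc (f x) <= M.
Proof.
move=> /continuous_complexP cf cK.
apply: (compact_ideal (I := fun A => exists2 M : R, 0 < M &
    forall x, A x -> nc (f x) <= M)) => //.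
- by exists 1.
- move=> A B [M M0 MP] [N N0 NP]; exists (M + N); first exact: addr_gt0.
  by move=> x [/MP|/NP] h; apply: (le_trans h); rewrite ?lerDl ?lerDr ltW.
- by move=> A B AB [M M0 MP]; exists M => // x /AB /MP.
- move=> x _; exists [set y | nc (f x - f y) < 1]; first exact: cf.
  exists (nc (f x) + 1); first by rewrite ltr_wpDl ?nc_ge0.
  move=> y /= h; have := nc_dist (f x) (f y) 0; rewrite !subr0 nc_distC.
  by move=> h2; apply: (le_trans h2); rewrite addrC lerD2l ltW.
Qed.

Lemma continuous_complexD (T : topologicalType) (f g : T -> R[i]) :
  continuous f -> continuous g -> continuous (fun x => f x + g x).
Proof. by move=> cf cg x; exact: (@cvgD _ R[i]^o _ _ _ f g _ _ (cf x) (cg x)). Qed.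

Lemma continuous_complexM (T : topologicalType) (f g : T -> R[i]) :
  continuous f -> continuous g -> continuous (fun x => f x * g x).
Proof. by move=> cf cg x; exact: (@cvgM _ _ _ _ f g _ _ (cf x) (cg x)). Qed.

Lemma continuous_complex_conj (T : topologicalType) (f : T -> R[i]) :
  continuous f -> continuous (fun x => (f x)^*%C).
Proof.
move=> /continuous_complexP cf; apply/continuous_complexP => x e e0.
have := cf x e e0; apply: filterS => y /=.
by rewrite -rmorphB nc_conj.
Qed.

Lemma nc_circle (a : circle R) : nc (set_val a) = 1.
Proof.
have h : `|set_val a| = 1 := set_valP a.
by move: h; rewrite normcE => -[].
Qed.

Lemma circle_conj (a : circle R) : set_val a * (set_val a)^*%C = 1.
Proof. by rewrite nc_sqr nc_circle expr1n. Qed.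

Lemma circle_inj (a b : circle R) : set_val a = set_val b -> a = b.
Proof. exact: val_inj. Qed.

Lemma mk_circle_subproof z : nc z = 1 -> z \in circle R.
Proof. by move=> h; apply/mem_set; rewrite /circle /= normcE h. Qed.

Definition mk_circle z (h : nc z = 1) : circle R :=
  exist _ z (mk_circle_subproof h).

Lemma circle_inv_subproof (a : circle R) : nc (set_val a)^*%C = 1.
Proof. by rewrite nc_conj nc_circle. Qed.

Definition circle_inv (a : circle R) : circle R :=
  mk_circle (circle_inv_subproof a).

Lemma nbhs_circleP (a : circle R) (A : set (circle R)) :
  nbhs a A <-> exists2 e : R, 0 < e &
    forall b : circle R, nc (set_val a - set_val b) < e -> A b.
Proof.
split.
  rewrite nbhsE => -[B [[C oC CB] Ba] BA].
  have /nbhs_complexP [e e0 eC] : nbhs (set_val a) C.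
    by apply: open_nbhs_nbhs; split=> //; move: Ba; rewrite -CB.
  by exists e => // b /eC Cb; apply: BA; rewrite -CB.
move=> [e e0 eA].
have h : nbhs (set_val a) [set w | nc (set_val a - w) < e].
  by apply/nbhs_complexP; exists e.
have h' : nbhs a [set b : circle R | nc (set_val a - set_val b) < e].
  exact: (@initial_continuous _ _ (set_val : circle R -> R[i]) a _ h).
by apply: filterS h' => b /= /eA.
Qed.

End complex_modulus.

(** * Unconditional sums *)

Section summation.
Context (R : realType) (I : choiceType).
Local Notation C := R[i].
Local Notation nc := (@ComplexField.Normc.normc R).
Implicit Types (E : {fset I}) (F G x y : I -> C).

(** Unconditional summability over the whole index type, with [{fset I}] in place of finite sets so
    that big operators apply; [csum_setT] and [is_csumT] reduce [csum] to it. *)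
Definition ssum F (z : C) := forall e : R, 0 < e ->
  exists E0 : {fset I}, forall E, (E0 `<=` E)%fset ->
    nc (z - \sum_(i <- E) F i) < e.

Lemma fsum_sub (V : nmodType) (F : I -> V) (E0 E : {fset I}) : (E0 `<=` E)%fset ->
  \sum_(i <- E) F i = \sum_(i <- E0) F i + \sum_(i <- (E `\` E0)%fset) F i.
Proof.
move=> sub; rewrite (big_fsetID _ (fun i => i \in E0)) /=; congr (_ + _).
  congr (\sum_(i <- enum_fset _) _); apply/fsetP => i; rewrite !inE /=.
  by case iE0: (i \in E0); rewrite ?andbF // (fsubsetP sub).
by congr (\sum_(i <- enum_fset _) _); apply/fsetP => i; rewrite !inE /= andbC.
Qed.

Lemma sum_mask (V : nmodType) E E' (F : I -> V) : (E `<=` E')%fset ->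
  (forall i, i \notin E -> F i = 0) -> \sum_(i <- E') F i = \sum_(i <- E) F i.
Proof.
move=> sub F0; rewrite (fsum_sub _ sub) [X in _ + X]big1_seq ?addr0 // => i.
by move=> /andP[_]; rewrite inE => /andP[/F0].
Qed.

Lemma is_csumT F z : is_csum [set: I] F z <-> ssum F z.
Proof.
split=> H e /H.
  move=> [E0 [finE0 _] E0P]; exists (fset_set E0) => E sub.
  have := E0P [set` E]; rewrite fsbig_finite /=; last exact: finite_fset.
  rewrite set_fsetK; apply; first by split => //; exact: finite_fset.
  move=> i E0i; apply: (fsubsetP sub).
  by rewrite in_fset_set // inE.
move=> [E0 E0P]; exists [set` E0]; first by split=> //; exact: finite_fset.
move=> E [finE _] sub; rewrite fsbig_finite //=.
apply: E0P; apply/fsubsetP => i iE0.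
by rewrite in_fset_set // inE; exact: sub.
Qed.

(** Finite partial sums on both sides agree up to zero terms, so the two families have the same set
    of sums; the identity thus holds for families without a sum as well. *)
Lemma csum_setT (D : set I) F :
  csum D F = csum [set: I] (fun i => if i \in D then F i else 0).
Proof.
pose F' i := if i \in D then F i else 0.
have sumE (E : set I) : E `<=` D ->
    \sum_(i \in E) F i = \sum_(i \in E) F' i.
  by move=> ED; apply: eq_fsbigr => i; rewrite inE /F' => /ED Di; rewrite mem_set.
congr xget; apply/seteqP; split=> z H e /H [E0 [fE0 E0D] E0P].
  exists E0 => // E [fE _] sub.
  have eqE : \sum_(i \in E `&` D) F' i = \sum_(i \in E) F' i.
    apply: fsbig_widen; first by move=> i [].
    move=> i [Ei nDi]; rewrite /F' /=; case: ifPn => //; rewrite inE => Di.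
    by case: nDi.
  rewrite -/F' -eqE -sumE; last by move=> i [].
  apply: E0P; first by split; [exact: finite_setIl|move=> i []].
  by move=> i E0i; split; [exact: sub|exact: E0D].
exists (E0 `&` D); first by split; [exact: finite_setIl|move=> i []].
move=> E [fE ED] sub.
have eqE : \sum_(i \in E) F' i = \sum_(i \in E `|` E0) F' i.
  apply: fsbig_widen; first by move=> i; left.
  move=> i [[//|E0i] nEi]; rewrite /F' /=; case: ifPn => //; rewrite inE => Di.
  by case: nEi; apply: sub.
rewrite sumE // eqE; apply: E0P; last by move=> i; right.
by split => //; rewrite finite_setU.
Qed.

Lemma ssum_unique F z w : ssum F z -> ssum F w -> z = w.
Proof.
move=> Fz Fw; apply/eqP; rewrite -subr_eq0; apply/eqP; apply: nc_lt_eq0 => e e0.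
have e20 : 0 < e / 2 by rewrite divr_gt0.
have [E0 E0P] := Fz _ e20; have [E1 E1P] := Fw _ e20.
have := nc_dist (\sum_(i <- (E0 `|` E1)%fset) F i) z w.
have := E0P (E0 `|` E1)%fset (fsubsetUl _ _).
have := E1P (E0 `|` E1)%fset (fsubsetUr _ _).
rewrite (nc_distC w); lra.
Qed.

Lemma csum_eq F z : ssum F z -> csum [set: I] F = z.
Proof.
move=> Fz; rewrite /csum; case: xgetP => [w _ /is_csumT Fw|/(_ z)].
  exact: ssum_unique Fw Fz.
by case; apply/is_csumT.
Qed.

Lemma ssumD F G z w : ssum F z -> ssum G w -> ssum (fun i => F i + G i) (z + w).
Proof.
move=> Fz Gw e e0; have e20 : 0 < e / 2 by rewrite divr_gt0.
have [E0 E0P] := Fz _ e20; have [E1 E1P] := Gw _ e20.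
exists (E0 `|` E1)%fset => E /[dup] /(fsubset_trans (fsubsetUl _ _)) s0
  /(fsubset_trans (fsubsetUr _ _)) s1.
rewrite big_split /= opprD addrACA.
apply: (le_lt_trans (ncD _ _)).
by have := E0P _ s0; have := E1P _ s1; lra.
Qed.

Lemma ssumZ c F z : ssum F z -> ssum (fun i => c * F i) (c * z).
Proof.
move=> Fz e e0; have c0 : 0 < nc c + 1 by rewrite ltr_wpDl ?nc_ge0.
have [E0 E0P] := Fz (e / (nc c + 1)) (divr_gt0 e0 c0).
exists E0 => E /E0P H; rewrite -mulr_sumr -mulrBr ncM.
move: H; rewrite ltr_pdivlMr // => H; apply: le_lt_trans H.
by rewrite mulrC ler_wpM2l ?nc_ge0 // lerDl.
Qed.

Lemma ssum0 : ssum (fun=> 0) 0.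
Proof. by move=> e e0; exists fset0 => E _; rewrite big1 // subr0 nc0. Qed.

Lemma ssum_sum (J : Type) (r : seq J) (H : J -> I -> C) (z : J -> C) :
  (forall j, ssum (H j) (z j)) ->
  ssum (fun i => \sum_(j <- r) H j i) (\sum_(j <- r) z j).
Proof.
move=> Hz; elim: r => [|j r IH].
  by rewrite big_nil; under eq_fun do rewrite big_nil; exact: ssum0.
rewrite big_cons; under eq_fun do rewrite big_cons.
exact: ssumD.
Qed.

Lemma ssum_conj F z : ssum F z -> ssum (fun i => (F i)^*%C) z^*%C.
Proof.
move=> Fz e /Fz [E0 E0P]; exists E0 => E /E0P.
by rewrite -rmorph_sum -rmorphB nc_conj.
Qed.

Lemma ssum_fin F E : (forall i, i \notin E -> F i = 0) ->
  ssum F (\sum_(i <- E) F i).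
Proof.
move=> F0 e e0; exists E => E' sub.
by rewrite (sum_mask sub F0) subrr nc0.
Qed.

Lemma ssum_le F z (M : R) : ssum F z ->
  (exists E0 : {fset I}, forall E, (E0 `<=` E)%fset -> nc (\sum_(i <- E) F i) <= M) ->
  nc z <= M.
Proof.
move=> Fz [E1 FM]; apply/ler_addgt0Pl => e /Fz [E0 E0P].
have := E0P (E0 `|` E1)%fset (fsubsetUl _ _).
have := FM (E0 `|` E1)%fset (fsubsetUr _ _).
have := nc_dist (\sum_(i <- (E0 `|` E1)%fset) F i) z 0; rewrite !subr0; lra.
Qed.

(** Take [E0] whose sum is within [e] of the supremum of all finite sums; a set disjoint from it
    cannot add [e] more. *)
Lemma tail_sum (a : I -> R) (M : R) : (forall i, 0 <= a i) ->
  (forall E, \sum_(i <- E) a i <= M) ->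
  forall e : R, 0 < e -> exists E0 : {fset I}, forall E,
    [disjoint E & E0]%fset -> \sum_(i <- E) a i < e.
Proof.
move=> a0 aM e e0.
pose A := [set s | exists E : {fset I}, s = \sum_(i <- E) a i].
have supA : has_sup A.
  split; first by exists 0, fset0; rewrite big_seq_fset0.
  by exists M => _ [E ->].
have [_ [E0 ->] E0P] := sup_adherent e0 supA.
exists E0 => E dis.
have : \sum_(i <- (E0 `|` E)%fset) a i <= sup A.
  by apply: ub_le_sup; [case: supA|exists (E0 `|` E)%fset].
rewrite (fsum_sub a (fsubsetUl E0 E)).
have -> : ((E0 `|` E) `\` E0 = E)%fset.
  apply/fsetP => i; rewrite !inE; case iE: (i \in E); last by case: (i \in E0).
  by rewrite orbT andbT (fdisjointP dis).
by move: E0P; lra.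
Qed.

(** Finite sets [D n] with tails below [1 / (n + 1)] turn absolute summability into a Cauchy
    sequence of partial sums, whose limit is also the limit of the whole net. *)
Lemma ssum_exists F (M : R) : (forall E, \sum_(i <- E) nc (F i) <= M) ->
  exists z, ssum F z.
Proof.
move=> FM.
have T (n : nat) : exists E0 : {fset I}, forall E,
    [disjoint E & E0]%fset -> \sum_(i <- E) nc (F i) < n.+1%:R^-1.
  by apply: (tail_sum (M := M)) => // i; exact: nc_ge0.
have [D DP] := choice T.
pose u n := \sum_(i <- D n) F i.
have key n E : (D n `<=` E)%fset -> nc (u n - \sum_(i <- E) F i) < n.+1%:R^-1.
  move=> sub; rewrite (fsum_sub F sub) opprD addrA subrr add0r ncN.
  apply: (le_lt_trans (nc_sum _ _ _)); apply: DP.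
  by apply/fdisjointP => i; rewrite inE => /andP[].
have [|z uz] := @complex_cauchy_cvg R u.
  move=> e e0; have e20 : 0 < e / 2 by rewrite divr_gt0.
  have [N NP] := small_invS e20; exists N => m n /NP hm /NP hn.
  have := key m (D m `|` D n)%fset (fsubsetUl _ _).
  have := key n (D m `|` D n)%fset (fsubsetUr _ _).
  set s := \sum_(i <- _) _; have := nc_dist s (u m) (u n).
  rewrite (nc_distC s (u n)) => h1 h2 h3; apply: (le_lt_trans h1).
  rewrite (splitr e); apply: ltrD; [exact: lt_trans h3 hm|exact: lt_trans h2 hn].
exists z => e e0; have e20 : 0 < e / 2 by rewrite divr_gt0.
have [N NP] := small_invS e20; have /cvg_complexP/(_ _ e20) [N' N'P] := uz.
exists (D (maxn N N')) => E /key h.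
have := NP _ (leq_maxl N N'); have := N'P _ (leq_maxr N N').
have := nc_dist (u (maxn N N')) z (\sum_(i <- E) F i) => h1 h2 h3.
apply: (le_lt_trans h1); rewrite (splitr e); apply: ltrD => //.
exact: lt_trans h h3.
Qed.

(** Norm of a restriction to a finite set. Vectors of l^2 enter only through bounds uniform in [E],
    as in [l2b], which keeps all norm estimates finite. *)
Definition l2 E x : R := Num.sqrt (\sum_(i <- E) nc (x i) ^+ 2).

Lemma l2_ge0 E x : 0 <= l2 E x. Proof. exact: sqrtr_ge0. Qed.

Lemma l2_sqr E x : l2 E x ^+ 2 = \sum_(i <- E) nc (x i) ^+ 2.
Proof. by rewrite sqr_sqrtr // sumr_ge0 // => i _; exact: sqr_ge0. Qed.

Lemma cauchy_schwarz (r : seq I) (a b : I -> R) :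
  `|\sum_(i <- r) a i * b i| <=
  Num.sqrt (\sum_(i <- r) a i ^+ 2) * Num.sqrt (\sum_(i <- r) b i ^+ 2).
Proof.
elim: r => [|i r IH]; first by rewrite !big_nil sqrtr0 mul0r normr0.
rewrite !big_cons.
have A0 : 0 <= \sum_(i <- r) a i ^+ 2 by apply: sumr_ge0 => j _; exact: sqr_ge0.
have B0 : 0 <= \sum_(i <- r) b i ^+ 2 by apply: sumr_ge0 => j _; exact: sqr_ge0.
move: IH; set p := Num.sqrt _; set q := Num.sqrt _ => IH.
rewrite -sqrtrM ?addr_ge0 ?sqr_ge0 //.
rewrite -(sqr_sqrtr A0) -(sqr_sqrtr B0) -/p -/q.
have p0 : 0 <= p by exact: sqrtr_ge0.
have q0 : 0 <= q by exact: sqrtr_ge0.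
have h : `|a i * b i + \sum_(j <- r) a j * b j| <= p * q + `|a i * b i|.
  by apply: (le_trans (ler_normD _ _)); rewrite addrC lerD2r.
apply: (le_trans h); rewrite -[leLHS]ger0_norm ?addr_ge0 ?mulr_ge0 ?normr_ge0 //.
rewrite -sqrtr_sqr ler_wsqrtr //.
rewrite normrM; set u := `|a i|; set v := `|b i|.
have -> : a i ^+ 2 = u ^+ 2 by rewrite real_normK ?num_real.
have -> : b i ^+ 2 = v ^+ 2 by rewrite real_normK ?num_real.
(* The induction step is the inequality in the plane: [2 p q u v] is at most [p^2 v^2 + q^2 u^2]. *)
by have := sqr_ge0 (p * v - q * u); nra.
Qed.

Lemma cs_nc E x y : \sum_(i <- E) nc (x i * y i) <= l2 E x * l2 E y.
Proof.
under eq_bigr do rewrite ncM.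
by apply: le_trans (cauchy_schwarz _ _ _); exact: ler_norm.
Qed.

Lemma cs_sum E x y : nc (\sum_(i <- E) x i * y i) <= l2 E x * l2 E y.
Proof. exact: le_trans (nc_sum _ _ _) (cs_nc _ _ _). Qed.

Lemma l2_conj E x : \sum_(i <- E) (x i)^*%C * x i = (l2 E x ^+ 2)%:C.
Proof.
rewrite l2_sqr raddf_sum /=; apply: eq_bigr => i _.
by rewrite mulrC nc_sqr.
Qed.

Lemma l2_conjl E x : l2 E (fun i => (x i)^*%C) = l2 E x.
Proof. by rewrite /l2; under eq_bigr do rewrite nc_conj. Qed.

(** The norm is attained by testing against the conjugate of [x]. *)
Lemma l2_dual E x (B : R) : 0 <= B ->
  (forall y, nc (\sum_(i <- E) y i * x i) <= B * l2 E y) -> l2 E x <= B.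
Proof.
move=> B0 /(_ (fun i => (x i)^*%C)); rewrite l2_conj l2_conjl nc_real.
rewrite ger0_norm ?sqr_ge0 // expr2 => h.
have := l2_ge0 E x; rewrite le_eqVlt => /orP[/eqP <- //|x0].
by move: h; rewrite ler_pM2r.
Qed.

Lemma eq_l2 E x y : (forall i, i \in E -> x i = y i) -> l2 E x = l2 E y.
Proof.
by move=> h; congr Num.sqrt; apply: eq_big_seq => i iE; rewrite h.
Qed.

Lemma l2_sub E E' x : (E `<=` E')%fset -> l2 E x <= l2 E' x.
Proof.
move=> sub; apply: ler_wsqrtr; rewrite (fsum_sub _ sub) lerDl.
by apply: sumr_ge0 => i _; exact: sqr_ge0.
Qed.

Definition mask E x i : C := if i \in E then x i else 0.

Lemma l2_mask E E' x : (E `<=` E')%fset -> l2 E' (mask E x) = l2 E x.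
Proof.
move=> sub; congr Num.sqrt; rewrite (sum_mask sub); last first.
  by move=> i /negPf iE; rewrite /mask iE nc0 expr0n.
by apply: eq_big_seq => i iE; rewrite /mask iE.
Qed.

Definition l2b x (B : R) := forall E, l2 E x <= B.

Lemma l2b_ge0 x B : l2b x B -> 0 <= B.
Proof. by move=> /(_ fset0); apply: le_trans; exact: l2_ge0. Qed.

Lemma l2b_ssum x y A B : l2b x A -> l2b y B ->
  ssum (fun i => x i * y i) (csum [set: I] (fun i => x i * y i)).
Proof.
move=> xA yB; have [|z Hz] := @ssum_exists (fun i => x i * y i) (A * B).
  move=> E; apply: (le_trans (cs_nc _ _ _)).
  by apply: ler_pM => //; exact: l2_ge0.
by rewrite (csum_eq Hz).
Qed.

Lemma l2_tail x B : l2b x B -> forall e : R, 0 < e -> exists E0 : {fset I},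
  forall E, (E0 `<=` E)%fset -> l2b (fun i => x i - mask E x i) e.
Proof.
move=> xB e e0.
have [|||E0 E0P] := @tail_sum (fun i => nc (x i) ^+ 2) (B ^+ 2) _ _ (e ^+ 2).
- by move=> i; exact: sqr_ge0.
- by move=> E; rewrite -l2_sqr lerXn2r ?nnegrE ?l2_ge0 ?(l2b_ge0 xB).
- exact: exprn_gt0.
exists E0 => E sub K.
rewrite -(@ler_pXn2r _ 2) ?nnegrE ?l2_ge0 ?(ltW e0) // l2_sqr.
have -> : \sum_(i <- K) nc (x i - mask E x i) ^+ 2 =
    \sum_(i <- (K `\` E)%fset) nc (x i) ^+ 2.
  rewrite (fsum_sub _ (fsubsetDl K E)) [X in _ + X]big1_seq ?addr0.
    apply: eq_big_seq => i; rewrite inE => /andP[/negPf iE _].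
    by rewrite /mask iE subr0.
  move=> i /andP[_]; rewrite !inE => /andP[+ iK]; rewrite iK andbT negbK => iE.
  by rewrite /mask iE subrr nc0 expr0n.
apply/ltW/E0P; apply/fdisjointP => i; rewrite inE => /andP[iE _].
by apply: contra iE; exact: (fsubsetP sub).
Qed.

End summation.

(** * Bounded matrices *)

Section bounded_matrices.
Context (R : realType) (I : choiceType).
Local Notation C := R[i].
Local Notation nc := (@ComplexField.Normc.normc R).
Implicit Types (E F : {fset I}) (x y : I -> C) (M N P : I -> I -> C) (A B : R).

Definition form E M x y := \sum_(i <- E) \sum_(j <- E) x i * M i j * y j.

(* [M] acts on l^2(I) with operator norm at most [A]. *)
Definition opb M A := 0 <= A /\
  forall E x y, nc (form E M x y) <= A * l2 E x * l2 E y.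

Definition transpose M i j := M j i.

Definition mulm M N i j := csum [set: I] (fun k => M i k * N k j).

Lemma opb_ge0 M A : opb M A -> 0 <= A. Proof. by case. Qed.

(** Padding both vectors by zero on the union of [E] and [F] turns the rectangular block into a
    square one. *)
Lemma opb_form M A : opb M A -> forall E F x y,
  nc (\sum_(i <- E) \sum_(j <- F) x i * M i j * y j) <= A * l2 E x * l2 F y.
Proof.
move=> [_ MA] E F x y.
have := MA (E `|` F)%fset (mask E x) (mask F y).
rewrite (l2_mask _ (fsubsetUl E F)) (l2_mask _ (fsubsetUr E F)).
suff -> : form (E `|` F)%fset M (mask E x) (mask F y) =
    \sum_(i <- E) \sum_(j <- F) x i * M i j * y j by [].
rewrite /form (sum_mask (fsubsetUl E F)); last first.
  by move=> i /negPf iE; apply: big1 => j _; rewrite /mask iE !mul0r.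
apply: eq_big_seq => i iE; rewrite (sum_mask (fsubsetUr E F)); last first.
  by move=> j /negPf jF; rewrite /mask jF mulr0.
by apply: eq_big_seq => j jF; rewrite /mask iE jF.
Qed.

Lemma opb_transpose M A : opb M A -> opb (transpose M) A.
Proof.
move=> [A0 MA]; split=> // E x y; rewrite mulrAC.
have -> : form E (transpose M) x y = form E M y x; last exact: MA.
rewrite /form exchange_big /=; apply: eq_bigr => i _; apply: eq_bigr => j _.
by rewrite /transpose; ring.
Qed.

Lemma opb_apply M A : opb M A -> forall E F y,
  l2 E (fun i => \sum_(j <- F) M i j * y j) <= A * l2 F y.
Proof.
move=> MA E F y; apply: l2_dual.
  by apply: mulr_ge0; [exact: opb_ge0 MA|exact: l2_ge0].
move=> x; have := opb_form MA E F x y; rewrite mulrAC; apply: le_trans.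
rewrite le_eqVlt; apply/orP; left; apply/eqP; congr (nc _).
apply: eq_bigr => i _; rewrite mulr_sumr; apply: eq_bigr => j _.
by rewrite mulrA.
Qed.

Lemma opb_row_form M A : 0 <= A ->
  (forall E y, l2 E (fun i => \sum_(j <- E) M i j * y j) <= A * l2 E y) ->
  opb M A.
Proof.
move=> A0 H; split=> // E x y; rewrite mulrAC mulrC.
have -> : form E M x y = \sum_(i <- E) x i * (\sum_(j <- E) M i j * y j).
  by apply: eq_bigr => i _; rewrite mulr_sumr; apply: eq_bigr => j _; ring.
apply: (le_trans (cs_sum _ _ _)).
by apply: ler_wpM2l; [exact: l2_ge0|exact: H].
Qed.

(** A column is the image of a basis vector. Square summability of rows and columns is what makes
    the sums defining matrix products converge. *)
Lemma opb_col M A j : opb M A -> l2b (fun i => M i j) A.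
Proof.
move=> MA E; have := opb_apply MA E [fset j]%fset (fun=> 1).
rewrite {2}/l2 big_seq_fset1 nc1 expr1n sqrtr1 mulr1.
by congr (_ <= _); apply: eq_l2 => i _; rewrite big_seq_fset1 mulr1.
Qed.

Lemma opb_row M A i : opb M A -> l2b (M i) A.
Proof. by move=> /opb_transpose/(opb_col i). Qed.

Lemma opb_entry M A i j : opb M A -> nc (M i j) <= A.
Proof.
move=> /(opb_col j) /(_ [fset i]%fset).
by rewrite /l2 big_seq_fset1 sqrtr_sqr ger0_norm ?nc_ge0.
Qed.

Lemma opb_le M A B : A <= B -> opb M A -> opb M B.
Proof.
move=> AB [A0 MA]; split; first exact: le_trans AB.
move=> E x y; apply: (le_trans (MA E x y)).
by rewrite -!mulrA; apply: ler_wpM2r => //; apply: mulr_ge0; exact: l2_ge0.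
Qed.

Lemma opb_add M N A B : opb M A -> opb N B -> opb (fun i j => M i j + N i j) (A + B).
Proof.
move=> [A0 MA] [B0 NB]; split=> [|E x y]; first exact: addr_ge0.
have -> : form E (fun i j => M i j + N i j) x y = form E M x y + form E N x y.
  rewrite /form -big_split; apply: eq_bigr => i _ /=.
  by rewrite -big_split; apply: eq_bigr => j _ /=; ring.
apply: (le_trans (ncD _ _)); rewrite !mulrDl.
by apply: lerD; [exact: MA|exact: NB].
Qed.

Lemma opb_scale c M A : opb M A -> opb (fun i j => c * M i j) (nc c * A).
Proof.
move=> [A0 MA]; split=> [|E x y]; first by apply: mulr_ge0 => //; exact: nc_ge0.
have -> : form E (fun i j => c * M i j) x y = c * form E M x y.
  rewrite /form mulr_sumr; apply: eq_bigr => i _ /=.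
  by rewrite mulr_sumr; apply: eq_bigr => j _ /=; ring.
by rewrite ncM -!mulrA; apply: ler_wpM2l; [exact: nc_ge0|rewrite mulrA; exact: MA].
Qed.

Lemma opb_conj M A : opb M A -> opb (fun i j => (M i j)^*%C) A.
Proof.
move=> [A0 MA]; split=> // E x y.
have := MA E (fun i => (x i)^*%C) (fun i => (y i)^*%C); rewrite !l2_conjl.
congr (_ <= _); rewrite -nc_conj; congr (nc _).
rewrite /form rmorph_sum; apply: eq_bigr => i _.
by rewrite rmorph_sum; apply: eq_bigr => j _; rewrite !rmorphM /= !conjcK.
Qed.

(** A finite form involves finitely many entries, so the bound survives entrywise limits without any
    convergence in norm. This is what controls pointwise limits of Cauchy sequences in [Cred]. *)
Lemma opb_closure M A : 0 <= A ->
  (forall E (e : R), 0 < e -> exists2 N, opb N A &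
     forall i j, i \in E -> j \in E -> nc (M i j - N i j) <= e) ->
  opb M A.
Proof.
move=> A0 H; split=> // E x y; apply/ler_addgt0Pl => e e0.
pose S := \sum_(i <- E) \sum_(j <- E) nc (x i) * nc (y j).
have S0 : 0 <= S.
  by apply: sumr_ge0 => i _; apply: sumr_ge0 => j _; rewrite mulr_ge0 ?nc_ge0.
have S1 : 0 < S + 1 by rewrite ltr_wpDl.
have [N [_ NA] MN] := H E (e / (S + 1)) (divr_gt0 e0 S1).
have -> : form E M x y = form E (fun i j => M i j - N i j) x y + form E N x y.
  rewrite /form -big_split; apply: eq_bigr => i _ /=.
  by rewrite -big_split; apply: eq_bigr => j _ /=; ring.
apply: (le_trans (ncD _ _)); apply: lerD; last exact: NA.
apply: (@le_trans _ _ (S * (e / (S + 1)))); last first.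
  by rewrite mulrA ler_pdivrMr // mulrC ler_wpM2l ?(ltW e0) // lerDl.
apply: (le_trans (nc_sum _ _ _)); rewrite /S mulr_suml.
rewrite big_seq_cond [leRHS]big_seq_cond; apply: ler_sum => i /andP[iE _].
apply: (le_trans (nc_sum _ _ _)); rewrite mulr_suml.
rewrite big_seq_cond [leRHS]big_seq_cond; apply: ler_sum => j /andP[jE _].
rewrite !ncM mulrAC; apply: ler_wpM2l; first by rewrite mulr_ge0 ?nc_ge0.
exact: MN.
Qed.

(** Schur test: factor the modulus of [M i j] into two square roots, apply Cauchy-Schwarz along each
    row, and sum what remains along the columns. *)
Lemma opb_schur M A : 0 <= A ->
  (forall E i, \sum_(j <- E) nc (M i j) <= A) ->
  (forall E j, \sum_(i <- E) nc (M i j) <= A) -> opb M A.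
Proof.
move=> A0 rowA colA; apply: opb_row_form => // E y.
apply: (@le_trans _ _ (Num.sqrt (A ^+ 2 * l2 E y ^+ 2))); last first.
  by rewrite -exprMn sqrtr_sqr ger0_norm // mulr_ge0 ?l2_ge0.
apply: ler_wsqrtr.
have step i : nc (\sum_(j <- E) M i j * y j) ^+ 2 <=
    A * \sum_(j <- E) nc (M i j) * nc (y j) ^+ 2.
  pose a j := Num.sqrt (nc (M i j)).
  have a2 j : a j ^+ 2 = nc (M i j) by rewrite sqr_sqrtr ?nc_ge0.
  have h1 : nc (\sum_(j <- E) M i j * y j) <= \sum_(j <- E) a j * (a j * nc (y j)).
    apply: (le_trans (nc_sum _ _ _)); apply: ler_sum => j _.
    by rewrite ncM mulrA -expr2 a2.
  have h2 := le_trans h1 (le_trans (ler_norm _) (cauchy_schwarz E a (fun j => a j * nc (y j)))).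
  have h3 : nc (\sum_(j <- E) M i j * y j) ^+ 2 <=
      (Num.sqrt (\sum_(j <- E) a j ^+ 2) *
       Num.sqrt (\sum_(j <- E) (a j * nc (y j)) ^+ 2)) ^+ 2.
    by rewrite lerXn2r ?nnegrE ?nc_ge0 ?mulr_ge0 ?sqrtr_ge0.
  apply: (le_trans h3); rewrite exprMn !sqr_sqrtr; last 2 first.
  - by apply: sumr_ge0 => j _; exact: sqr_ge0.
  - by apply: sumr_ge0 => j _; exact: sqr_ge0.
  under eq_bigr do rewrite a2.
  under [X in _ * X <= _]eq_bigr do rewrite exprMn a2.
  apply: ler_wpM2r; last exact: rowA.
  by apply: sumr_ge0 => j _; rewrite mulr_ge0 ?nc_ge0 ?sqr_ge0.
apply: (@le_trans _ _ (\sum_(i <- E) A * \sum_(j <- E) nc (M i j) * nc (y j) ^+ 2)).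
  by apply: ler_sum => i _; exact: step.
rewrite -mulr_sumr exchange_big /= expr2 -mulrA; apply: ler_wpM2l => //.
rewrite l2_sqr mulr_sumr; apply: ler_sum => j _.
by rewrite -mulr_suml; apply: ler_wpM2r; [exact: sqr_ge0|exact: colA].
Qed.

Definition matvec M y i := csum [set: I] (fun j => M i j * y j).

Lemma matvec_ssum M A y B i : opb M A -> l2b y B ->
  ssum (fun j => M i j * y j) (matvec M y i).
Proof. by move=> /(opb_row i) MA yB; exact: l2b_ssum MA yB. Qed.

Lemma l2b_matvec M A y B : opb M A -> l2b y B -> l2b (matvec M y) (A * B).
Proof.
move=> MA yB E.
have B0 := l2b_ge0 yB; have A0 := opb_ge0 MA.
apply: l2_dual => [|x]; first exact: mulr_ge0.
have H : ssum (fun j => \sum_(i <- E) x i * (M i j * y j))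
    (\sum_(i <- E) x i * matvec M y i).
  by apply: ssum_sum => i; apply: ssumZ; exact: matvec_ssum MA yB.
apply: (ssum_le H); exists fset0 => K _.
have -> : \sum_(j <- K) \sum_(i <- E) x i * (M i j * y j) =
    \sum_(i <- E) \sum_(j <- K) x i * M i j * y j.
  rewrite exchange_big; apply: eq_bigr => i _; apply: eq_bigr => j _ /=.
  by rewrite mulrA.
apply: (le_trans (opb_form MA _ _ _ _)).
rewrite mulrAC; apply: ler_wpM2r; first exact: l2_ge0.
exact: ler_wpM2l.
Qed.

Lemma mulm_ssum M N A B i j : opb M A -> opb N B ->
  ssum (fun k => M i k * N k j) (mulm M N i j).
Proof. by move=> MA /(opb_col j) NB; exact: matvec_ssum MA NB. Qed.

(** After exchanging sums, each finite part of the sum over [k] pairs the images of [x] and [y]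
    under the transpose of [M] and under [N], to which Cauchy-Schwarz applies. *)
Lemma opb_mul M N A B : opb M A -> opb N B -> opb (mulm M N) (A * B).
Proof.
move=> MA NB; split=> [|E x y].
  by apply: mulr_ge0; [exact: opb_ge0 MA|exact: opb_ge0 NB].
have H : ssum (fun k => \sum_(i <- E) \sum_(j <- E) (x i * y j) * (M i k * N k j))
    (\sum_(i <- E) \sum_(j <- E) (x i * y j) * mulm M N i j).
  apply: ssum_sum => i; apply: ssum_sum => j; apply: ssumZ.
  exact: mulm_ssum MA NB.
have -> : form E (mulm M N) x y =
    \sum_(i <- E) \sum_(j <- E) (x i * y j) * mulm M N i j.
  by apply: eq_bigr => i _; apply: eq_bigr => j _; ring.
apply: (ssum_le H); exists fset0 => K _.
have -> : \sum_(k <- K) \sum_(i <- E) \sum_(j <- E) (x i * y j) * (M i k * N k j) =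
    \sum_(k <- K) (\sum_(i <- E) M i k * x i) * (\sum_(j <- E) N k j * y j).
  apply: eq_bigr => k _; rewrite mulr_suml; apply: eq_bigr => i _.
  by rewrite mulr_sumr; apply: eq_bigr => j _; ring.
apply: (le_trans (cs_sum _ _ _)).
have -> : A * B * l2 E x * l2 E y = (A * l2 E x) * (B * l2 E y) by ring.
apply: ler_pM; try exact: l2_ge0.
  exact: (opb_apply (opb_transpose MA)).
exact: (opb_apply NB).
Qed.

(** The iterated sum of [x i * M i j * y j] is the limit of its square finite truncations. The
    truncations do not depend on the order of summation, which is the point of the lemma. *)
Lemma matvec_net M A x B y D : opb M A -> l2b x B -> l2b y D ->
  forall e : R, 0 < e -> exists E0 : {fset I}, forall E, (E0 `<=` E)%fset ->
    nc (csum [set: I] (fun i => x i * matvec M y i) - form E M x y) < e.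
Proof.
move=> MA xB yD e e0.
have A0 := opb_ge0 MA; have B0 := l2b_ge0 xB.
have e20 : 0 < e / 2 by rewrite divr_gt0.
have c0 : 0 < A * B + 1 by rewrite ltr_wpDl ?mulr_ge0.
have [E1 E1P] := l2b_ssum xB (l2b_matvec MA yD) e20.
have [E2 E2P] := l2_tail yD (divr_gt0 e20 c0).
exists (E1 `|` E2)%fset => E /[dup] /(fsubset_trans (fsubsetUl _ _)) s1
  /(fsubset_trans (fsubsetUr _ _)) s2.
apply: (le_lt_trans (nc_dist (\sum_(i <- E) x i * matvec M y i) _ _)).
rewrite (splitr e); apply: ltr_leD; first exact: E1P.
have -> : \sum_(i <- E) x i * matvec M y i - form E M x y =
    \sum_(i <- E) x i * matvec M (fun j => y j - mask E y j) i.
  rewrite /form -sumrB; apply: eq_bigr => i _.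
  under eq_bigr do rewrite -mulrA.
  rewrite -mulr_sumr -mulrBr; congr (_ * _); apply/esym/csum_eq.
  have -> : \sum_(j <- E) M i j * y j = \sum_(j <- E) M i j * mask E y j.
    by apply: eq_big_seq => j jE; rewrite /mask jE.
  rewrite -[X in _ - X]mul1r -mulNr.
  rewrite [X in ssum X _](_ : _ = fun j => M i j * y j + -1 * (M i j * mask E y j)).
    apply: ssumD; first exact: matvec_ssum MA yD.
    by apply: ssumZ; apply: ssum_fin => j /negPf jE; rewrite /mask jE mulr0.
  by apply/funext => j; ring.
apply: (le_trans (cs_sum _ _ _)).
have h := l2b_matvec MA (E2P _ s2) E.
apply: (@le_trans _ _ (B * (A * (e / 2 / (A * B + 1))))).
  by apply: ler_pM => //; exact: l2_ge0.
rewrite mulrA mulrA ler_pdivrMr // [leRHS]mulrC; apply: ler_wpM2r; first exact: ltW.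
by rewrite mulrC lerDl.
Qed.

(** Both bracketings are limits of the same finite forms, by [matvec_net] applied to [N] and to its
    transpose. *)
Lemma mulmA M N P A B D : opb M A -> opb N B -> opb P D ->
  mulm M (mulm N P) = mulm (mulm M N) P.
Proof.
move=> MA NB PD; apply/funext => i; apply/funext => j.
have Mi := opb_row i MA; have Pj := opb_col j PD.
have lhs := matvec_net NB Mi Pj.
have rhs := matvec_net (opb_transpose NB) Pj Mi.
have -> : mulm (mulm M N) P i j =
    csum [set: I] (fun k => P k j * matvec (transpose N) (M i) k).
  congr (csum _ _); apply/funext => k; rewrite mulrC; congr (_ * csum _ _).
  by apply/funext => l; rewrite mulrC.
have formE E : form E (transpose N) (fun k => P k j) (M i) = form E N (M i) (fun k => P k j).
  rewrite /form exchange_big /=; apply: eq_bigr => k _; apply: eq_bigr => l _.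
  by rewrite /transpose; ring.
apply/eqP; rewrite -subr_eq0; apply/eqP; apply: nc_lt_eq0 => e e0.
have e20 : 0 < e / 2 by rewrite divr_gt0.
have [E1 E1P] := lhs _ e20; have [E2 E2P] := rhs _ e20.
have h1 := E1P (E1 `|` E2)%fset (fsubsetUl _ _).
have h2 := E2P (E1 `|` E2)%fset (fsubsetUr _ _).
rewrite formE in h2; rewrite nc_distC in h2.
apply: (le_trans (nc_dist _ _ _)); rewrite [leRHS]splitr.
exact: ltW (ltrD h1 h2).
Qed.

End bounded_matrices.

(** * Convolution and matrices *)

Section groupoid_theory.
Context (X G : Type) (g : groupoid X G).
Local Notation r := (grng g).
Local Notation d := (gdom g).
Local Notation "a ** b" := (gmul g a b) (at level 40, left associativity).
Local Notation inv := (ginv g).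

Lemma gmulKl a b : r a = r b -> a ** (inv a ** b) = b.
Proof.
move=> ab; rewrite gmul_assoc ?gdom_inv ?grng_inv //.
by rewrite gmul_inv_r ab gmul_unt_l.
Qed.

Lemma gmulVKl a b : d a = r b -> inv a ** (a ** b) = b.
Proof.
move=> ab; rewrite gmul_assoc ?gdom_inv ?grng_inv //.
by rewrite gmul_inv_l ab gmul_unt_l.
Qed.

Lemma gmulKr a b : d b = r a -> (b ** a) ** inv a = b.
Proof.
move=> ab; rewrite -gmul_assoc ?gdom_inv ?grng_inv //.
by rewrite gmul_inv_r -ab gmul_unt_r.
Qed.

Lemma gmulVKr a b : d b = d a -> (b ** inv a) ** a = b.
Proof.
move=> ab; rewrite -gmul_assoc ?gdom_inv ?grng_inv //.
by rewrite gmul_inv_l -ab gmul_unt_r.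
Qed.

Lemma ginv_unique a b : d a = r b -> a ** b = gunt g (r a) -> b = inv a.
Proof.
move=> ab h; rewrite -[b](gmulVKl ab) h -(gdom_inv g a).
by rewrite gmul_unt_r.
Qed.

Lemma ginvK a : inv (inv a) = a.
Proof.
by apply/esym/ginv_unique; rewrite ?gdom_inv // gmul_inv_l grng_inv.
Qed.

Lemma ginv_mul a b : d a = r b -> inv (a ** b) = inv b ** inv a.
Proof.
move=> ab; apply/esym/ginv_unique.
  by rewrite gdom_mul // grng_mul ?grng_inv // gdom_inv.
rewrite gmul_assoc ?gdom_mul ?grng_inv ?gdom_inv //.
by rewrite gmulKr // gmul_inv_r grng_mul.
Qed.

Lemma ginv_unt x : inv (gunt g x) = gunt g x.
Proof.
apply/esym/ginv_unique; first by rewrite gdom_unt grng_unt.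
by rewrite -{1}(grng_unt g x) gmul_unt_l grng_unt.
Qed.

(** Division inside a source fibre. These arrows index the matrix entries, and [mul_quo] is the
    multiplication rule of matrix units. *)
Definition quo a b := a ** inv b.

Lemma rng_quo a b : d a = d b -> r (quo a b) = r a.
Proof. by move=> ab; rewrite grng_mul ?grng_inv. Qed.

Lemma dom_quo a b : d a = d b -> d (quo a b) = r b.
Proof. by move=> ab; rewrite gdom_mul ?grng_inv // gdom_inv. Qed.

Lemma inv_quo a b : d a = d b -> inv (quo a b) = quo b a.
Proof. by move=> ab; rewrite /quo ginv_mul ?grng_inv // ginvK. Qed.

Lemma mul_quo a b c : d a = d b -> d b = d c -> quo a b ** quo b c = quo a c.
Proof.
move=> ab bc; rewrite /quo gmul_assoc ?gdom_mul ?grng_inv ?gdom_inv //.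
by rewrite gmulVKr.
Qed.

Lemma quoK a b : d a = d b -> quo a b ** b = a.
Proof. exact: gmulVKr. Qed.

Lemma quo_unt a : quo a (gunt g (d a)) = a.
Proof. by rewrite /quo ginv_unt gmul_unt_r. Qed.

Lemma quo_self a : quo a a = gunt g (r a).
Proof. by rewrite /quo gmul_inv_r. Qed.

Lemma mul_inv_quo a b c : d a = d b -> d b = d c ->
  inv (quo a b) ** quo a c = quo b c.
Proof. by move=> ab bc; rewrite inv_quo // mul_quo // ab. Qed.

End groupoid_theory.

(** * The circle action and the matrix of an equivariant function *)

Section twist_theory.
Context (R : realType) (X G Sigma : topologicalType).
Variable T : twisted_boolean_groupoid R X G Sigma.
Local Notation C := R[i].
Local Notation nc := (@ComplexField.Normc.normc R).
Local Notation gG := (tgrp T).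
Local Notation gS := (text T).
Local Notation p := (tproj T).
Local Notation r := (grng gS).
Local Notation d := (gdom gS).
Local Notation lift := (tlift T).
Local Notation "a ** b" := (gmul gS a b) (at level 40, left associativity).
Local Notation act := (tact T).
Implicit Types (s t u : Sigma) (a b : circle R) (f k : Sigma -> C).

Lemma tliftK h : p (lift h) = h.
Proof. exact: projT2 (cid (tproj_surj T h)). Qed.

Lemma dom_lift h : d (lift h) = gdom gG h.
Proof. by rewrite -(tproj_dom T) tliftK. Qed.

Lemma proj_tcirc x a : p (tcirc T (x, a)) = gunt gG x.
Proof. by apply/tcirc_ker; exists a. Qed.

Lemma rng_tcirc x a : r (tcirc T (x, a)) = x.
Proof. by rewrite -(tproj_rng T) proj_tcirc grng_unt. Qed.

Lemma dom_tcirc x a : d (tcirc T (x, a)) = x.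
Proof. by rewrite -(tproj_dom T) proj_tcirc gdom_unt. Qed.

Lemma rng_act a s : r (act a s) = r s.
Proof. by rewrite /tact grng_mul ?rng_tcirc ?dom_tcirc. Qed.

Lemma dom_act a s : d (act a s) = d s.
Proof. by rewrite /tact gdom_mul ?rng_tcirc ?dom_tcirc. Qed.

Lemma proj_act a s : p (act a s) = p s.
Proof.
rewrite /tact tproj_mul ?dom_tcirc // proj_tcirc -(tproj_rng T).
by rewrite gmul_unt_l.
Qed.

Lemma act_one s : act (circle_one R) s = s.
Proof. by rewrite /tact tcirc_unt gmul_unt_l. Qed.

Lemma act_act a b s : act a (act b s) = act (circle_mul a b) s.
Proof.
rewrite {1}/tact rng_act /tact gmul_assoc ?rng_tcirc ?dom_tcirc //.
by rewrite tcirc_mul.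
Qed.

Lemma act_mull a s t : d s = r t -> act a s ** t = act a (s ** t).
Proof.
move=> st; rewrite /tact -gmul_assoc ?dom_tcirc // grng_mul //.
Qed.

Lemma act_mulr a s t : d s = r t -> s ** act a t = act a (s ** t).
Proof.
move=> st; rewrite /tact gmul_assoc ?dom_tcirc ?rng_tcirc //.
rewrite -st -tcirc_central -gmul_assoc ?dom_tcirc //.
by rewrite grng_mul.
Qed.

Lemma val_circle_inv a : set_val (circle_inv a) = (set_val a)^*%C.
Proof. by []. Qed.

Lemma circle_mulV a : circle_mul a (circle_inv a) = circle_one R.
Proof. by apply: circle_inj; exact: circle_conj. Qed.

Lemma circle_mulC a b : circle_mul a b = circle_mul b a.
Proof. by apply: circle_inj; exact: mulrC. Qed.

Lemma circle_mulVl a : circle_mul (circle_inv a) a = circle_one R.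
Proof. by rewrite circle_mulC circle_mulV. Qed.

Lemma circle_mulA a b c : circle_mul a (circle_mul b c) = circle_mul (circle_mul a b) c.
Proof. by apply: circle_inj; exact: mulrA. Qed.

Lemma circle_mul1 a : circle_mul a (circle_one R) = a.
Proof. by apply: circle_inj; exact: mulr1. Qed.

Lemma actK a s : act (circle_inv a) (act a s) = s.
Proof. by rewrite act_act circle_mulVl act_one. Qed.

Lemma inv_act a s : ginv gS (act a s) = act (circle_inv a) (ginv gS s).
Proof.
apply/esym/ginv_unique; first by rewrite dom_act rng_act grng_inv.
rewrite act_mull ?rng_act ?grng_inv // act_mulr ?grng_inv //.
by rewrite act_act circle_mulV act_one gmul_inv_r.
Qed.

Lemma tcirc_inj x y a b : tcirc T (x, a) = tcirc T (y, b) -> x = y /\ a = b.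
Proof.
have [[_ inj _] _ _] := tcirc_homeo T.
by move=> /(inj _ _ (mem_set I) (mem_set I)) [-> ->].
Qed.

Lemma act_unt x a : act a (gunt gS x) = tcirc T (x, a).
Proof.
rewrite /tact grng_unt.
by have := gmul_unt_r gS (tcirc T (x, a)); rewrite dom_tcirc.
Qed.

Lemma act_free a b s : act a s = act b s -> a = b.
Proof.
move=> /(congr1 (fun t => quo gS t s)); rewrite /quo !act_mull ?grng_inv //.
by rewrite gmul_inv_r !act_unt => /tcirc_inj[].
Qed.

Lemma proj_inv s : p (ginv gS s) = ginv gG (p s).
Proof.
apply: ginv_unique; first by rewrite (tproj_dom T) (tproj_rng T) grng_inv.
by rewrite -tproj_mul ?grng_inv // gmul_inv_r tproj_unt (tproj_rng T).
Qed.

Lemma proj_quo s t : d s = d t -> p (quo gS s t) = quo gG (p s) (p t).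
Proof. by move=> st; rewrite /quo tproj_mul ?grng_inv // proj_inv. Qed.

Lemma proj_dom s t : p s = p t -> d s = d t.
Proof. by move=> st; rewrite -!(tproj_dom T) st. Qed.

(** The quotient of [s] by [t] lies over a unit, hence in the circle bundle by exactness of the
    extension. *)
Lemma proj_eq s t : p s = p t -> exists a, s = act a t.
Proof.
move=> st; have dst := proj_dom st.
have /tcirc_ker [a ha] : p (quo gS s t) = gunt gG (r t).
  by rewrite proj_quo // st quo_self (tproj_rng T).
by exists a; rewrite /tact -ha quoK.
Qed.

Lemma quo_actl a s t : d s = d t -> quo gS (act a s) t = act a (quo gS s t).
Proof. by move=> st; rewrite /quo act_mull ?grng_inv. Qed.

Lemma quo_actr a s t : d s = d t -> quo gS s (act a t) = act (circle_inv a) (quo gS s t).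
Proof. by move=> st; rewrite /quo inv_act act_mulr ?grng_inv. Qed.

Definition equivariant f := forall a s, f (act a s) = (set_val a)^*%C * f s.

(* The block diagonal matrix of all the representations [pi_x(f)]. *)
Definition mat f (h k : G) : C :=
  if gdom gG h == gdom gG k then f (quo gS (lift h) (lift k)) else 0.

(** The bijection matches the sets of possible sums, not just the sums, so the default value of
    [csum] is preserved when nothing is summable. *)
Lemma csum_reindex (I J : choiceType) (D : set I) (E : set J)
    (phi : J -> I) (psi : I -> J) (F : I -> C) :
  (forall j, E j -> D (phi j)) -> (forall i, D i -> E (psi i)) ->
  (forall j, E j -> psi (phi j) = j) -> (forall i, D i -> phi (psi i) = i) ->
  csum D F = csum E (F \o phi).
Proof.
move=> phiD psiE psiK phiK.
have half (I' J' : choiceType) (D' : set I') (E' : set J')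
    (phi' : J' -> I') (psi' : I' -> J') (F' : I' -> C) (F'' : J' -> C) z :
    (forall j, E' j -> F'' j = F' (phi' j)) ->
    (forall j, E' j -> D' (phi' j)) -> (forall i, D' i -> E' (psi' i)) ->
    (forall j, E' j -> psi' (phi' j) = j) -> (forall i, D' i -> phi' (psi' i) = i) ->
    is_csum D' F' z -> is_csum E' F'' z.
  move=> F'E phiD' psiE' psiK' phiK' H e /H [E0 [fE0 E0D] E0P].
  exists (psi' @` E0).
    by split; [exact: finite_image|move=> _ [i /E0D/psiE' ? <-]].
  move=> K [fK KE] sub.
  have -> : \sum_(j \in K) F'' j = \sum_(i \in phi' @` K) F' i.
    rewrite fsbig_image; first by apply: eq_fsbigr => j; rewrite inE => /KE/F'E.
    move=> j j'; rewrite !inE => /KE Ej /KE Ej' /(congr1 psi').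
    by rewrite !psiK'.
  apply: E0P.
    by split; [exact: finite_image|move=> _ [j /KE/phiD' ? <-]].
  move=> i E0i; exists (psi' i); last by rewrite phiK' //; exact: E0D.
  by apply: sub; exists i.
congr xget; apply/seteqP; split=> z.
  exact: (half _ _ _ _ phi psi).
by apply: (half _ _ _ _ psi phi) => // i Di; rewrite /= phiK.
Qed.

(** Multiplication by [c] and by its inverse shows that both families are summable or neither is; in
    the latter case both sides are the default 0. *)
Lemma csumZ (I : choiceType) (c : C) (F : I -> C) : c != 0 ->
  csum [set: I] (fun i => c * F i) = c * csum [set: I] F.
Proof.
move=> c0; case: (pselect (exists z, ssum F z)) => [[z Fz]|nF].
  by rewrite (csum_eq Fz); apply: csum_eq; exact: ssumZ.
rewrite /csum; case: xgetP => [w _ /is_csumT Fw|_].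
  case: nF; exists (c^-1 * w); have := ssumZ c^-1 Fw.
  by under eq_fun do rewrite mulrA mulVf // mul1r.
case: xgetP => [w _ /is_csumT Fw|_]; last by rewrite mulr0.
by case: nF; exists w.
Qed.

(** Reindexing by [h = p s l^-1] turns convolution into matrix multiplication. The chosen lift of
    [h] differs from the quotient of [s] by the lift of [l] by a phase, and the two phases produced
    by equivariance cancel. *)
Lemma convol_quo f k s t : equivariant f -> equivariant k -> d s = d t ->
  convol T f k (quo gS s t) = csum [set: G] (fun l =>
    if gdom gG l == d t then f (quo gS s (lift l)) * k (quo gS (lift l) t) else 0).
Proof.
move=> ef ek st; rewrite /convol rng_quo //.
rewrite (@csum_reindex _ _ _ [set l : G | gdom gG l = d t]
  (fun l => quo gG (p s) l) (fun h => gmul gG (ginv gG h) (p s))).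
- rewrite csum_setT; congr csum; apply/funext => l /=.
  have -> : (l \in [set l | gdom gG l = d t]) = (gdom gG l == d t).
    by apply/idP/eqP => [/set_mem|/mem_set].
  case: eqP => // dl.
  have dsl : d s = d (lift l) by rewrite dom_lift dl.
  have [a ha] : exists a, lift (quo gG (p s) l) = act a (quo gS s (lift l)).
    by apply: proj_eq; rewrite tliftK proj_quo // tliftK.
  rewrite ha ef inv_act act_mull; last first.
    by rewrite gdom_inv !rng_quo.
  rewrite ek val_circle_inv mul_inv_quo -?dsl // conjcK.
  by rewrite mulrACA [_^*%C * _]mulrC circle_conj mul1r.
- by move=> l /= dl; rewrite rng_quo ?(tproj_rng T) // (tproj_dom T) dl.
- by move=> h /= rh; rewrite gdom_mul ?gdom_inv ?(tproj_rng T) // (tproj_dom T).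
- move=> l /= dl; have e : gdom gG (p s) = gdom gG l by rewrite (tproj_dom T) dl.
  by rewrite inv_quo // quoK.
- move=> h /= rh.
  have e : gdom gG (ginv gG h) = grng gG (p s) by rewrite gdom_inv (tproj_rng T).
  rewrite /quo ginv_mul // ginvK gmul_assoc ?grng_inv ?gdom_inv //.
    by rewrite gmul_inv_r (tproj_rng T) -rh gmul_unt_l.
  by rewrite (tproj_rng T) rh.
Qed.

(** Every point of the twist is, up to a phase, the quotient of two chosen lifts, the second lying
    over a unit. Hence an equivariant function is determined by its matrix, and bounded by the norm
    of that matrix. *)
Lemma mat_val s : exists c h l, nc c = 1 /\
  forall f, equivariant f -> f s = c * mat f h l.
Proof.
have [a ha] : exists a, lift (p s) = act a s by apply: proj_eq; rewrite tliftK.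
have [b hb] : exists b, lift (gunt gG (d s)) = act b (gunt gS (d s)).
  by apply: proj_eq; rewrite tliftK tproj_unt.
pose c := circle_mul a (circle_inv b).
exists (set_val c), (p s), (gunt gG (d s)); split; first exact: nc_circle.
move=> f ef; rewrite /mat gdom_unt (tproj_dom T) eqxx ha hb.
have e1 : d s = d (gunt gS (d s)) by rewrite gdom_unt.
rewrite quo_actl ?dom_act // quo_actr // quo_unt act_act ef mulrA.
by rewrite circle_conj mul1r.
Qed.

Lemma mat_inj f k : equivariant f -> equivariant k -> mat f = mat k -> f = k.
Proof.
move=> ef ek fk; apply/funext => s.
by have [c [h [l [_ H]]]] := mat_val s; rewrite !H // fk.
Qed.

Lemma convol_equivariant f k : equivariant f -> equivariant k ->
  equivariant (convol T f k).
Proof.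
move=> ef ek a s.
have e1 : d s = d (gunt gS (d s)) by rewrite gdom_unt.
rewrite -{1 2}(quo_unt gS s) -quo_actl // !convol_quo ?dom_act //.
rewrite -csumZ; last by rewrite conjc_eq0; apply/eqP => a0;
  have := nc_circle a; rewrite a0 nc0 => /eqP; rewrite eq_sym oner_eq0.
congr csum; apply/funext => l; case: eqP => [dl|_]; last by rewrite mulr0.
by rewrite quo_actl ?ef ?mulrA // dom_lift dl gdom_unt.
Qed.

Lemma csum0 (I : choiceType) : csum [set: I] (fun=> 0 : C) = 0.
Proof. by apply: csum_eq; exact: ssum0. Qed.

Lemma mat_convol f k : equivariant f -> equivariant k ->
  mat (convol T f k) = mulm (mat f) (mat k).
Proof.
move=> ef ek; apply/funext => h; apply/funext => l; rewrite /mat /mulm.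
case: eqP => hl.
  rewrite convol_quo ?dom_lift //; congr csum; apply/funext => m.
  rewrite hl [_ == gdom gG m]eq_sym.
  by case: eqP; rewrite ?mul0r.
rewrite -[LHS](csum0 G); congr csum; apply/funext => m.
case: eqP => [hm|_]; last by rewrite mul0r.
by case: eqP => [ml|_]; [case: hl; rewrite hm|rewrite mulr0].
Qed.

Lemma fstar_equivariant f : equivariant f -> equivariant (fstar T f).
Proof. by move=> ef a s; rewrite /fstar inv_act ef rmorphM val_circle_inv /= conjcK. Qed.

Lemma mat_fstar f h l : mat (fstar T f) h l = (mat f l h)^*%C.
Proof.
rewrite /mat eq_sym; case: eqP => hl; last by rewrite conjc0.
by rewrite /fstar inv_quo // !dom_lift.
Qed.

Lemma fstarK f : fstar T (fstar T f) = f.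
Proof. by apply/funext => s; rewrite /fstar ginvK conjcK. Qed.

(** Equivariance together with the bound [A] on the norm in the sum of all representations [pi_x].
    As a relation it avoids suprema in the extended reals; [red_norm_le] and [opb_red_norm] connect
    it to [red_norm]. *)
Definition bnd f (A : R) := equivariant f /\ opb (mat f) A.

Lemma bnd_ge0 f A : bnd f A -> 0 <= A.
Proof. by move=> [_ []]. Qed.

Lemma bnd_val f A s : bnd f A -> nc (f s) <= A.
Proof.
move=> [ef fA]; have [c [h [l [c1 H]]]] := mat_val s.
by rewrite (H f ef) ncM c1 mul1r; exact: opb_entry fA.
Qed.

Lemma bnd_le f A B : A <= B -> bnd f A -> bnd f B.
Proof. by move=> AB [ef fA]; split=> //; exact: opb_le fA. Qed.

Lemma bnd_add f k A B : bnd f A -> bnd k B -> bnd (fun s => f s + k s) (A + B).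
Proof.
move=> [ef fA] [ek kB]; split=> [a s|]; first by rewrite ef ek mulrDr.
rewrite (_ : mat _ = fun i j => mat f i j + mat k i j); first exact: opb_add.
by apply/funext => i; apply/funext => j; rewrite /mat; case: eqP; rewrite ?addr0.
Qed.

Lemma bnd_scale c f A : bnd f A -> bnd (fun s => c * f s) (nc c * A).
Proof.
move=> [ef fA]; split=> [a s|]; first by rewrite ef mulrCA.
rewrite (_ : mat _ = fun i j => c * mat f i j); first exact: opb_scale.
by apply/funext => i; apply/funext => j; rewrite /mat; case: eqP; rewrite ?mulr0.
Qed.

Lemma bnd_sub f k A B : bnd f A -> bnd k B -> bnd (fun s => f s - k s) (A + B).
Proof.
move=> fA /(bnd_scale (-1)); rewrite ncN nc1 mul1r => kB.
by rewrite (_ : (fun s => _) = fun s => f s + -1 * k s);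
  [exact: bnd_add|apply/funext => s; rewrite mulN1r].
Qed.

Lemma bnd_star f A : bnd f A -> bnd (fstar T f) A.
Proof.
move=> [ef fA]; split; first exact: fstar_equivariant.
rewrite (_ : mat _ = fun i j => (transpose (mat f) i j)^*%C).
  exact/opb_conj/opb_transpose.
by apply/funext => i; apply/funext => j; rewrite mat_fstar.
Qed.

Lemma bnd_convol f k A B : bnd f A -> bnd k B -> bnd (convol T f k) (A * B).
Proof.
move=> [ef fA] [ek kB]; split; first exact: convol_equivariant.
by rewrite mat_convol //; exact: opb_mul.
Qed.

Lemma convolA f k l A B D : bnd f A -> bnd k B -> bnd l D ->
  convol T f (convol T k l) = convol T (convol T f k) l.
Proof.
move=> [ef fA] [ek kB] [el lD].
have ekl := convol_equivariant ek el; have efk := convol_equivariant ef ek.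
apply: mat_inj; try exact: convol_equivariant.
by rewrite !mat_convol //; exact: mulmA fA kB lD.
Qed.

Lemma convol_val f k s : equivariant f -> equivariant k ->
  convol T f k s = csum [set: G] (fun l =>
    if gdom gG l == d s then f (quo gS s (lift l)) * k (lift l) else 0).
Proof.
move=> ef ek; have e1 : d s = d (gunt gS (d s)) by rewrite gdom_unt.
rewrite -{1}(quo_unt gS s) convol_quo //; congr csum; apply/funext => m.
rewrite gdom_unt; case: eqP => // dm.
by rewrite -dm -dom_lift quo_unt.
Qed.

(** Up to phases these are the terms of a product of bounded matrices, hence summable; linearity of
    the convolution then follows from uniqueness of sums. *)
Lemma convol_val_ssum f k A B s : bnd f A -> bnd k B ->
  ssum (fun l => if gdom gG l == d s then f (quo gS s (lift l)) * k (lift l) else 0)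
    (convol T f k s).
Proof.
move=> [ef fA] [ek kB]; rewrite convol_val //.
have [a ha] : exists a, lift (p s) = act a s by apply: proj_eq; rewrite tliftK.
have [b hb] : exists b, lift (gunt gG (d s)) = act b (gunt gS (d s)).
  by apply: proj_eq; rewrite tliftK tproj_unt.
have := ssumZ (set_val a * (set_val b)^*%C)
  (mulm_ssum (p s) (gunt gG (d s)) fA kB).
rewrite [X in ssum X _](_ : _ = fun m =>
  if gdom gG m == d s then f (quo gS s (lift m)) * k (lift m) else 0).
  by move=> K; rewrite (csum_eq K).
apply/funext => m; rewrite /mat gdom_unt (tproj_dom T) eq_sym.
case: eqP => [dm|_]; last by rewrite mul0r mulr0.
have e2 : d s = d (lift m) by rewrite dom_lift.
have e3 : d (lift m) = d (gunt gS (d s)) by rewrite gdom_unt.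
rewrite ha hb quo_actl // quo_actr // ef ek val_circle_inv e2 quo_unt conjcK.
have := circle_conj a; have := circle_conj b; set x := set_val a; set y := set_val b.
move=> hy hx.
transitivity ((x * x^*%C) * (y * y^*%C) * (f (quo gS s (lift m)) * k (lift m))); first by ring.
by rewrite hx hy !mul1r.
Qed.

Lemma convolDl f k l A B D : bnd f A -> bnd k B -> bnd l D ->
  convol T (fun s => f s + k s) l = fun s => convol T f l s + convol T k l s.
Proof.
move=> fA kB lD; apply/funext => s.
apply: ssum_unique (convol_val_ssum s (bnd_add fA kB) lD) _.
rewrite [X in ssum X _](_ : _ = fun m =>
  (if gdom gG m == d s then f (quo gS s (lift m)) * l (lift m) else 0) +
  (if gdom gG m == d s then k (quo gS s (lift m)) * l (lift m) else 0)).
  exact: ssumD (convol_val_ssum s fA lD) (convol_val_ssum s kB lD).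
by apply/funext => m; case: eqP; rewrite ?addr0 // mulrDl.
Qed.

Lemma convolDr f k l A B D : bnd f A -> bnd k B -> bnd l D ->
  convol T l (fun s => f s + k s) = fun s => convol T l f s + convol T l k s.
Proof.
move=> fA kB lD; apply/funext => s.
apply: ssum_unique (convol_val_ssum s lD (bnd_add fA kB)) _.
rewrite [X in ssum X _](_ : _ = fun m =>
  (if gdom gG m == d s then l (quo gS s (lift m)) * f (lift m) else 0) +
  (if gdom gG m == d s then l (quo gS s (lift m)) * k (lift m) else 0)).
  exact: ssumD (convol_val_ssum s lD fA) (convol_val_ssum s lD kB).
by apply/funext => m; case: eqP; rewrite ?addr0 // mulrDr.
Qed.

Lemma convolZl c f l A D : bnd f A -> bnd l D ->
  convol T (fun s => c * f s) l = fun s => c * convol T f l s.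
Proof.
move=> fA lD; apply/funext => s.
apply: ssum_unique (convol_val_ssum s (bnd_scale c fA) lD) _.
have := ssumZ c (convol_val_ssum s fA lD).
rewrite [X in ssum X _ -> _](_ : _ = fun m =>
  (if gdom gG m == d s then c * f (quo gS s (lift m)) * l (lift m) else 0)) //.
by apply/funext => m; case: eqP; rewrite ?mulr0 // mulrA.
Qed.

Lemma convolZr c f l A D : bnd f A -> bnd l D ->
  convol T l (fun s => c * f s) = fun s => c * convol T l f s.
Proof.
move=> fA lD; apply/funext => s.
apply: ssum_unique (convol_val_ssum s lD (bnd_scale c fA)) _.
have := ssumZ c (convol_val_ssum s lD fA).
rewrite [X in ssum X _ -> _](_ : _ = fun m =>
  (if gdom gG m == d s then l (quo gS s (lift m)) * (c * f (lift m)) else 0)) //.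
by apply/funext => m; case: eqP; rewrite ?mulr0 // mulrCA.
Qed.

Lemma convolBl f k l A B D : bnd f A -> bnd k B -> bnd l D ->
  convol T (fun s => f s - k s) l = fun s => convol T f l s - convol T k l s.
Proof.
move=> fA kB lD; under eq_fun do rewrite -mulN1r.
rewrite (convolDl fA (bnd_scale _ kB) lD) (convolZl _ kB lD).
by apply/funext => s; rewrite mulN1r.
Qed.

Lemma convolBr f k l A B D : bnd f A -> bnd k B -> bnd l D ->
  convol T l (fun s => f s - k s) = fun s => convol T l f s - convol T l k s.
Proof.
move=> fA kB lD; under eq_fun do rewrite -mulN1r.
rewrite (convolDr fA (bnd_scale _ kB) lD) (convolZr _ kB lD).
by apply/funext => s; rewrite mulN1r.
Qed.

Lemma fstar_convol f k A B : bnd f A -> bnd k B ->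
  fstar T (convol T f k) = convol T (fstar T k) (fstar T f).
Proof.
move=> [ef fA] [ek kB].
have sf := fstar_equivariant ef; have sk := fstar_equivariant ek.
apply: mat_inj; [|exact: convol_equivariant|].
  exact/fstar_equivariant/convol_equivariant.
rewrite mat_convol //; apply/funext => i; apply/funext => j.
rewrite mat_fstar mat_convol //; apply/esym/csum_eq.
have := ssum_conj (mulm_ssum j i fA kB).
rewrite [X in ssum X _ -> _](_ : _ =
  fun m => mat (fstar T k) i m * mat (fstar T f) m j) //.
by apply/funext => m; rewrite rmorphM /= !mat_fstar mulrC.
Qed.

End twist_theory.

(** * Local sections of the twist *)

Section twist_topology.
Context (R : realType) (X G Sigma : topologicalType).
Variable T : twisted_boolean_groupoid R X G Sigma.
Local Notation C := R[i].
Local Notation nc := (@ComplexField.Normc.normc R).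
Local Notation gG := (tgrp T).
Local Notation gS := (text T).
Local Notation p := (tproj T).
Local Notation r := (grng gS).
Local Notation d := (gdom gS).
Local Notation "a ** b" := (gmul gS a b) (at level 40, left associativity).
Local Notation act := (tact T).
Implicit Types (s t u : Sigma) (a b : circle R).

Lemma local_homeo_open (Y Z : topologicalType) (f : Y -> Z) (U : set Y) :
  local_homeo f -> open U -> open (f @` U).
Proof.
move=> lf oU; rewrite openE => _ [t Ut <-]; rewrite /interior.
have [V [oV Vt [ofV [_ _ [g /within_continuousP cg gK]]]]] := lf t.
have := cg (f t) (imageP _ Vt) (U `&` V); rewrite gK // => /(_ _) h.
have {}h := h (open_nbhs_nbhs (conj (openI oU oV) (conj Ut Vt))).
have h2 : nbhs (f t) (f @` V) by apply: open_nbhs_nbhs; split => //; exists t.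
apply: filterS2 h h2 => z /= h [v Vv vz].
have fz : (f @` V) z by exists v.
by exists v => //; have [] := h fz; rewrite -vz gK.
Qed.

Lemma X_lc : locally_compact_space X. Proof. by case: (tgrp_boolean T). Qed.
Lemma X_hausdorff : hausdorff_space X. Proof. by case: (tgrp_boolean T). Qed.
Lemma X_td : totally_disconnected [set: X]. Proof. by case: (tgrp_boolean T). Qed.

Lemma X_nbhs (U : set X) x : nbhs x U ->
  exists L, [/\ compact L, open L, L x & L `<=` U].
Proof. exact: compact_open_nbhs X_hausdorff X_td U x X_lc. Qed.

Lemma compact_X_closed (K : set X) : compact K -> closed K.
Proof. exact: compact_closed X_hausdorff. Qed.

Lemma G_dom_continuous : continuous (gdom gG).
Proof. by case: (tgrp_boolean T) => -[[]]. Qed.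
Lemma G_unt_continuous : continuous (gunt gG).
Proof. by case: (tgrp_boolean T) => -[[]]. Qed.
Lemma G_rng_homeo : local_homeo (grng gG).
Proof. by case: (tgrp_boolean T) => -[]. Qed.
Lemma G_dom_homeo : local_homeo (gdom gG).
Proof. by case: (tgrp_boolean T) => -[]. Qed.
Lemma rng_continuous : continuous r. Proof. by case: (text_topological T). Qed.
Lemma dom_continuous : continuous d. Proof. by case: (text_topological T). Qed.
Lemma unt_continuous : continuous (gunt gS). Proof. by case: (text_topological T). Qed.
Lemma inv_continuous : continuous (ginv gS). Proof. by case: (text_topological T). Qed.

(** Near a unit, an arrow [h] and the unit at its source both lie in a set on which the source map
    is injective, so they coincide. *)
Lemma units_open : open (range (gunt gG)).
Proof.
rewrite openE => _ [x _ <-]; rewrite /interior.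
have [V [oV Vx [_ [[_ injV _] _ _]]]] := G_dom_homeo (gunt gG x).
have nV : nbhs (gunt gG x) V by exact: open_nbhs_nbhs.
have h : nbhs (gunt gG x) [set h | V (gunt gG (gdom gG h))].
  have c : continuous (fun h => gunt gG (gdom gG h)).
    by move=> h; apply: continuous_comp; [exact: G_dom_continuous|exact: G_unt_continuous].
  by apply: (c (gunt gG x)); rewrite gdom_unt.
apply: filterS2 nV h => h Vh /= Vuh; exists (gdom gG h) => //.
by apply: injV; rewrite ?inE // gdom_unt.
Qed.

Lemma range_tcircP s : range (tcirc T) s <-> range (gunt gG) (p s).
Proof.
split=> [[[x a] _ <-]|[x _ /esym/tcirc_ker [a ->]]]; last by exists (x, a).
by rewrite proj_tcirc; exists x.
Qed.

Lemma range_tcirc_open : open (range (tcirc T)).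
Proof.
rewrite (_ : range (tcirc T) = p @^-1` range (gunt gG)); last first.
  by apply/seteqP; split=> s /range_tcircP.
by apply: open_comp => [s _|]; [exact: tproj_continuous|exact: units_open].
Qed.

Lemma tcirc_continuous : continuous (tcirc T).
Proof.
have [_ /within_continuousP c _] := tcirc_homeo T.
by move=> x N nN; apply: filterS (c x I N nN) => y; apply.
Qed.

(** The image of [tcirc] is open, being the preimage of the units of [G], and [tcirc] is a
    homeomorphism onto it; hence the circle coordinate is continuous there. *)
Lemma tcirc_nbhs x a (e : R) : 0 < e -> nbhs (tcirc T (x, a))
  [set s | exists y b, s = tcirc T (y, b) /\ nc (set_val a - set_val b) < e].
Proof.
move=> e0; have [_ _ [g /within_continuousP cg gK]] := tcirc_homeo T.
have rx : range (tcirc T) (tcirc T (x, a)) by exists (x, a).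
have := cg _ rx [set yb | nc (set_val a - set_val yb.2) < e].
rewrite gK // => /(_ _) h.
have {}h : nbhs (tcirc T (x, a)) [set s | range (tcirc T) s ->
    nc (set_val a - set_val (g s).2) < e].
  apply: h; exists (setT, [set b : circle R | nc (set_val a - set_val b) < e]).
    by split; [exact: filterT|apply/nbhs_circleP; exists e].
  by move=> yb [].
have h2 := open_nbhs_nbhs (conj range_tcirc_open rx).
apply: filterS2 h h2 => s /= h [[y b] _ ys]; exists y, b; split=> //.
by have := h (ex_intro2 _ _ (y, b) I ys); rewrite -ys gK.
Qed.

Lemma mul_nbhs s t (N : set Sigma) : d s = r t -> nbhs (s ** t) N ->
  exists U V, [/\ nbhs s U, nbhs t V &
    forall s' t', U s' -> V t' -> d s' = r t' -> N (s' ** t')].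
Proof.
move=> st nN; have [_ _ _ _ /within_continuousP cm] := text_topological T.
have [[U V] [/= Us Vt] UV] := cm (s, t) st N nN.
by exists U, V; split=> // s' t' Us' Vt'; apply: (UV (s', t')).
Qed.

Lemma quo_nbhs s t (N : set Sigma) : d s = d t -> nbhs (quo gS s t) N ->
  exists U V, [/\ nbhs s U, nbhs t V &
    forall s' t', U s' -> V t' -> d s' = d t' -> N (quo gS s' t')].
Proof.
move=> st nN; have [|U [V [Us Vt UV]]] := mul_nbhs _ nN.
  by rewrite grng_inv.
exists U, (ginv gS @^-1` V); split=> //; first exact: inv_continuous.
by move=> s' t' Us' Vt' st'; apply: UV; rewrite ?grng_inv.
Qed.

(** The phase relating two points of one orbit is the circle coordinate of their quotient, hence
    depends continuously on both. *)
Lemma cocycle_nbhs s t a (e : R) : s = act a t -> 0 < e ->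
  exists U V, [/\ nbhs s U, nbhs t V &
    forall s' t' b, U s' -> V t' -> s' = act b t' -> nc (set_val a - set_val b) < e].
Proof.
move=> sat e0; have st : d s = d t by rewrite sat dom_act.
have qE : quo gS s t = tcirc T (r t, a).
  by rewrite sat quo_actl // quo_self act_unt.
have [|U [V [Us Vt UV]]] := @quo_nbhs s t
  [set s | exists y b, s = tcirc T (y, b) /\ nc (set_val a - set_val b) < e] st.
  by rewrite qE; exact: tcirc_nbhs.
exists U, V; split=> // s' t' b Us' Vt' s'b.
have [|y [b' [+ lt]]] := UV s' t' Us' Vt'; first by rewrite s'b dom_act.
by rewrite s'b quo_actl // quo_self act_unt => /tcirc_inj[_ ->].
Qed.

Lemma act_nbhs a s (N : set Sigma) : nbhs (act a s) N ->
  exists e : R, exists V, [/\ 0 < e, nbhs s V &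
    forall b t, nc (set_val a - set_val b) < e -> V t -> N (act b t)].
Proof.
move=> nN; have [|U [V [Us Vt UV]]] := mul_nbhs _ nN; first by rewrite dom_tcirc.
have [[A B] [/= Ax Ba] AB] := @tcirc_continuous (r s, a) U Us.
have /nbhs_circleP [e e0 eB] := Ba.
exists e, (V `&` (r @^-1` A)); split=> //.
  by apply: filterI => //; exact: rng_continuous.
move=> b t /eB Bb [Vt' At']; apply: UV => //; last by rewrite dom_tcirc.
exact: (AB (r t, b)).
Qed.

Definition section (K : set X) (g : X -> G) :=
  {within K, continuous g} /\ forall y, K y -> gdom gG (g y) = y.

(** By local injectivity of the source map, an arrow close to [g y] equals the value of [g] at its
    own source. *)
Lemma open_section K g : open K -> section K g -> open (g @` K).
Proof.
move=> oK [/within_continuousP cg dg]; rewrite openE => _ [y Ky <-].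
rewrite /interior.
have [V [oV Vy [_ [[_ injV _] _ _]]]] := G_dom_homeo (g y).
have nV : nbhs (g y) V by exact: open_nbhs_nbhs.
have h1 : nbhs y [set z | K z /\ V (g z)].
  have := cg y Ky V nV; have := open_nbhs_nbhs (conj oK Ky).
  by apply: filterS2 => z Kz /= /(_ Kz).
have h2 : nbhs (g y) [set h | K (gdom gG h) /\ V (g (gdom gG h))].
  have h1' : nbhs (gdom gG (g y)) [set z | K z /\ V (g z)] by rewrite dg.
  exact: G_dom_continuous h1'.
apply: filterS2 nV h2 => h Vh /= [Kdh Vgh]; exists (gdom gG h) => //.
by apply: injV; rewrite ?inE // dg.
Qed.

(** A local inverse of the source map, restricted to a compact open set whose image stays where the
    range map is injective, so that the image is a bisection of [G]. *)
Lemma section_through (h : G) (W : set G) : nbhs h W ->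
  exists K g, [/\ compact K, open K, K (gdom gG h), section K g &
   [/\ g (gdom gG h) = h, forall y, K y -> W (g y) &
      forall y y', K y -> K y' -> grng gG (g y) = grng gG (g y') -> y = y']].
Proof.
move=> nW.
have [V1 [oV1 V1h [oV1d [_ _ [g /within_continuousP cg gK]]]]] := G_dom_homeo h.
have [V2 [oV2 V2h [_ [[_ inj2 _] _ _]]]] := G_rng_homeo h.
have dV : (gdom gG @` V1) (gdom gG h) by exists h.
have nW' : nbhs (g (gdom gG h)) (W `&` V2).
  by rewrite gK //; apply: filterI => //; exact: open_nbhs_nbhs.
have := cg _ dV _ nW'; have := open_nbhs_nbhs (conj oV1d dV).
move=> h1 h2; have [K [cK oK Kh KS]] := X_nbhs (@filterI _ _ _ _ _ h1 h2).
have dg y : K y -> gdom gG (g y) = y.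
  by move=> /KS [[v Vv <-] _]; rewrite gK.
exists K, g; split=> //.
  split=> //; apply/within_continuousP => y /KS [Vy _] N gN.
  have := cg y Vy N gN; apply: filterS => z /= + Kz; apply.
  by have [] := KS z Kz.
split; first by rewrite gK.
  by move=> y /KS [h4 /(_ h4)[]].
move=> y y' Ky Ky' rr.
have [h4 /(_ h4)[_ Vy]] := KS y Ky; have [h5 /(_ h5)[_ Vy']] := KS y' Ky'.
by rewrite -(dg y) // -(dg y') //; congr gdom; apply: inj2; rewrite ?inE.
Qed.

(** * Lifting continuous sections through the circle bundle *)

Section lifting.
Variables (K : set X) (g : X -> G).
Hypotheses (cK : compact K) (oK : open K) (gP : section K g).

Let good (W : set Sigma) := open W /\ forall y, K y -> exists2 s, W s & p s = g y.

Let small (W : set Sigma) (e : R) := forall s t a, W s -> W t -> s = act a t ->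
  nc (set_val a - 1) < e.

Let section_nbhs y (U : set G) : K y -> nbhs (g y) U ->
  nbhs y [set z | K z /\ U (g z)].
Proof.
move=> Ky nU; have [/within_continuousP cg _] := gP.
have := cg y Ky U nU; have := open_nbhs_nbhs (conj oK Ky).
by apply: filterS2 => z Kz /= /(_ Kz).
Qed.

(** Continuity of the phase yields small open sets locally, and [clopen_ind] glues them: the
    condition on [d s] keeps points over disjoint pieces in different orbits, so no new pair has to
    be compared. *)
Let shrink (W : set Sigma) (e : R) : good W -> 0 < e ->
  exists W', [/\ good W', W' `<=` W & small W' e].
Proof.
move=> [oW WK] e0; have [_ dg] := gP.
pose P (L : set X) := exists W' : set Sigma, [/\ open W', W' `<=` W,
  forall s, W' s -> L (d s), forall y, L y -> K y -> exists2 s, W' s & p s = g y &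
  small W' e].
suff [W' [oW' W'W _ W'K sW']] : P K.
  by exists W'; split=> //; split=> // y Ky; exact: W'K.
apply: (clopen_ind X_hausdorff cK oK).
- by exists set0; split=> //; exact: open0.
- move=> A B _ _ _ _ AB0 [W1 [oW1 W1W W1d W1K s1]] [W2 [oW2 W2W W2d W2K s2]].
  have dis s t a : W1 s -> W2 t -> d s <> d t.
    move=> /W1d Ads /W2d Bdt E.
    by have : (A `&` B) (d s) by [split=> //; rewrite E]; rewrite AB0.
  exists (W1 `|` W2); split.
  + exact: openU.
  + by move=> s [/W1W|/W2W].
  + by move=> s [/W1d|/W2d]; [left|right].
  + by move=> y [/W1K h|/W2K h] /h [s Ws ps]; exists s => //; [left|right].
  + move=> s t a [Ws|Ws] [Wt|Wt] E; [exact: (s1 s t)| | |exact: (s2 s t)].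
      by case: (dis _ _ a Ws Wt); rewrite E dom_act.
    by case: (dis _ _ a Wt Ws); rewrite E dom_act.
- move=> y Ky; have [s Ws ps] := WK y Ky.
  have [U [V [Us Vs UV]]] := cocycle_nbhs (esym (act_one T s)) e0.
  have nO : nbhs s (U `&` V `&` W).
    by apply: filterI; [exact: filterI|exact: open_nbhs_nbhs].
  pose O := (U `&` V `&` W)°.
  have Os : O s by [].
  have oO : open O by exact: open_interior.
  have OS : O `<=` U `&` V `&` W by exact: interior_subset.
  have npO : nbhs (g y) (p @` O).
    apply: open_nbhs_nbhs; split; first exact: tproj_open.
    by exists s.
  have [L [cL oL Ly LS]] := X_nbhs (section_nbhs Ky npO).
  exists L; split=> // A cA oA AL; exists (O `&` d @^-1` A); split.
  + apply: openI => //; apply: open_comp => // z _; exact: dom_continuous.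
  + by move=> z [/OS[]].
  + by move=> z [].
  + move=> z Az Kz; have [_ [t Ot pt]] := LS z (AL z Az).
    by exists t => //; split=> //=; rewrite -(tproj_dom T) pt dg.
  + move=> t t' a [/OS[[Ut _] _] _] [/OS[[_ Vt'] _] _] E.
    by rewrite nc_distC; apply: (UV t t').
Qed.

(* [s y] is the limit of the fibres over [g y] of a decreasing sequence of open
   sets whose fibres shrink. It need not lie in these open sets; being close to
   their points is enough for continuity. *)
Lemma lift_section : exists s : X -> Sigma,
  {within K, continuous s} /\ forall y, K y -> p (s y) = g y.
Proof.
have inv0 (n : nat) : 0 < n.+1%:R^-1 :> R by rewrite invr_gt0.
have /choice [F FP] : forall Wn : set Sigma * nat, exists W', good Wn.1 ->
    [/\ good W', W' `<=` Wn.1 & small W' Wn.2.+1%:R^-1].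
  move=> [W n] /=.
  case: (pselect (good W)) => gW; last by exists set0.
  by have [W' W'P] := shrink gW (inv0 n); exists W'.
pose W := fix W n := if n is m.+1 then F (W m, m.+1) else F ([set: Sigma], 0%N).
have good0 : good [set: Sigma].
  split; first exact: openT.
  by move=> y _; have [s ps] := tproj_surj T (g y); exists s.
have goodW n : good (W n).
  by elim: n => [|n IH] /=; [have [] := FP (setT, 0%N) good0|have [] := FP (W n, n.+1) IH].
have smallW n : small (W n) n.+1%:R^-1.
  case: n => [|n] /=; first by have [] := FP (setT, 0%N) good0.
  by have [] := FP (W n, n.+1) (goodW n).
have decrW n m : (n <= m)%N -> W m `<=` W n.
  elim: m => [|m IH]; first by rewrite leqn0 => /eqP ->.
  rewrite leq_eqVlt => /orP[/eqP -> //|]; rewrite ltnS => /IH.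
  have [_ + _] := FP (W m, m.+1) (goodW m).
  exact: subset_trans.
have lim y : exists s, K y -> p s = g y /\ forall n t b, W n t -> s = act b t ->
    nc (set_val b - 1) <= n.+1%:R^-1.
  case: (pselect (K y)) => Ky; last by have [s] := tproj_surj T (g y); exists s.
  have /choice [tau tauP] : forall n, exists t, W n t /\ p t = g y.
    by move=> n; have [_ /(_ y Ky)[t]] := goodW n; exists t.
  have /choice [a aP] : forall n, exists a, tau n = act a (tau 0%N).
    by move=> n; apply: proj_eq; have [_ ->] := tauP n; have [_ ->] := tauP 0%N.
  have ratio (b c : circle R) :
      nc (set_val b * (set_val c)^*%C - 1) = nc (set_val b - set_val c).
    rewrite -[RHS]mulr1 -{1}(nc_circle c) -(nc_conj (set_val c)) -ncM mulrBl.
    by rewrite circle_conj.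
  (* Points of [W n] in one orbit have nearly equal phases, and [tau m] lies in [W n] for [m >= n];
     hence the phases relative to [tau 0] form a Cauchy sequence. *)
  have key n m t b : (n <= m)%N -> W n t -> t = act b (tau 0%N) ->
      nc (set_val (a m) - set_val b) < n.+1%:R^-1.
    move=> nm Wt tb; rewrite -ratio.
    apply: (smallW n (tau m) t (circle_mul (a m) (circle_inv b))) => //.
      by apply: decrW nm _ _; have [] := tauP m.
    rewrite tb act_act aP; congr act.
    by rewrite -circle_mulA circle_mulVl circle_mul1.
  have [|z zP] := @complex_cauchy_cvg R (fun n => set_val (a n)).
    move=> e e0; have [N /(_ N (leqnn N)) NP] := small_invS (divr_gt0 e0 (ltr0Sn _ 1)).
    exists N => m n Nm Nn.
    have h1 := key N m (tau N) (a N) Nm (proj1 (tauP N)) (aP N).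
    have h2 := key N n (tau N) (a N) Nn (proj1 (tauP N)) (aP N).
    apply: (le_lt_trans (nc_dist (set_val (a N)) _ _)).
    rewrite (nc_distC (set_val (a N))) (splitr e).
    by apply: ltrD; [exact: lt_trans h1 NP|exact: lt_trans h2 NP].
  have /cvg_complexP zlim := zP.
  have z1 : nc z = 1.
    apply/eqP; rewrite -subr_eq0 -normr_le0; apply/ler_addgt0Pl => e e0.
    rewrite addr0; have [N NP] := zlim e e0.
    have := NP N (leqnn N); rewrite ler_norml.
    have := nc_circle (a N); have := nc_dist (set_val (a N)) z 0.
    have := nc_dist z (set_val (a N)) 0; rewrite !subr0 (nc_distC (set_val (a N))).
    by move=> h1 h2 h3 h4; apply/andP; split; lra.
  exists (act (mk_circle z1) (tau 0%N)) => _; split.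
    by rewrite proj_act; have [] := tauP 0%N.
  move=> n t b Wt sb.
  have tE : t = act (circle_mul (circle_inv b) (mk_circle z1)) (tau 0%N).
    by rewrite -act_act sb actK.
  set c := circle_mul _ _ in tE.
  have -> : nc (set_val b - 1) = nc (z - set_val c).
    rewrite -[LHS]mulr1 -{1}(nc_circle c) -ncM mulrBl mul1r; congr (nc (_ - _)).
    by rewrite /c /= mulrA circle_conj mul1r.
  apply/ler_addgt0Pl => e e0; have [N NP] := zlim e e0.
  have h1 := NP (maxn N n) (leq_maxl _ _).
  have h2 := key n (maxn N n) t c (leq_maxr _ _) Wt tE.
  by apply: (le_trans (nc_dist _ _ _)); apply: ltW (ltrD h1 h2).
have [s sP] := choice lim.
exists s; split; last by move=> y /sP[].
apply/within_continuousP => y Ky N nN.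
have [psy sy] := sP y Ky.
have nN1 : nbhs (act (circle_one R) (s y)) N by rewrite act_one.
have [e [V [e0 nV VN]]] := act_nbhs nN1.
have nV1 : nbhs (act (circle_one R) (s y)) V° by rewrite act_one; exact: nbhs_interior.
have [e' [V' [e'0 nV' V'V]]] := act_nbhs nV1.
have [n nP] : exists n : nat, n.+1%:R^-1 < Num.min e e'.
  have m0 : 0 < Num.min e e' by rewrite lt_min e0 e'0.
  by have [n /(_ n (leqnn n)) nP] := small_invS m0; exists n.
move: nP; rewrite lt_min => /andP[ne ne'].
have [oWn /(_ y Ky) [t Wt pt]] := goodW n.
have [b sb] : exists b, s y = act b t by apply: proj_eq; rewrite psy pt.
have tb : t = act (circle_inv b) (s y) by rewrite sb actK.
(* The point [t] of [W n] differs from [s y] by a phase within [1 / (n + 1)] of 1, so it still lies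
   in the neighbourhood; near [t] the open map [p] then supplies points over all [g z] with [z]
   close to [y]. *)
have Vt : V° t.
  rewrite tb; apply: V'V; last exact: nbhs_singleton.
  have -> : set_val (circle_one R) - set_val (circle_inv b) = (1 - set_val b)^*%C.
    by rewrite rmorphB rmorph1.
  rewrite nc_conj nc_distC.
  exact: le_lt_trans (sy n t b Wt sb) ne'.
have npO : nbhs (g y) (p @` (V° `&` W n)).
  apply: open_nbhs_nbhs; split; last by exists t.
  by apply: tproj_open; apply: openI => //; exact: open_interior.
apply: filterS (section_nbhs Ky npO) => z /= [Kz [t' [Vt' Wt'] pt']] _.
have [psz sz] := sP z Kz.
have [b' sb'] : exists b', s z = act b' t' by apply: proj_eq; rewrite psz pt'.
rewrite sb'; apply: VN; last exact: interior_subset.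
rewrite nc_distC; exact: le_lt_trans (sz n t' b' Wt' sb') ne.
Qed.

End lifting.

End twist_topology.

(** * Bisections *)

Section bisections.
Context (R : realType) (X G Sigma : topologicalType).
Variable T : twisted_boolean_groupoid R X G Sigma.
Local Notation C := R[i].
Local Notation nc := (@ComplexField.Normc.normc R).
Local Notation gG := (tgrp T).
Local Notation gS := (text T).
Local Notation p := (tproj T).
Local Notation r := (grng gS).
Local Notation d := (gdom gS).
Local Notation lift := (tlift T).
Local Notation "a ** b" := (gmul gS a b) (at level 40, left associativity).
Local Notation act := (tact T).
Implicit Types (u v : Sigma) (a : circle R) (K L : set X) (s t : X -> Sigma).
Implicit Types (f k : Sigma -> C).

(** A compact bisection parametrized by its source set, the last clause being injectivity of the
    range map. [BisP] identifies it with [Bis]; constructions on bisections then become formulas for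
    [s]. *)
Definition sect K s := [/\ compact K, open K, {within K, continuous s},
  forall y, K y -> d (s y) = y &
  forall y y', K y -> K y' -> r (s y) = r (s y') -> y = y'].

Lemma open_filter_sub (K U : set X) y : open K -> K y ->
  nbhs y [set z | K z -> U z] -> nbhs y [set z | K z /\ U z].
Proof.
move=> oK Ky; have := open_nbhs_nbhs (conj oK Ky).
by apply: filterS2 => z Kz /(_ Kz).
Qed.

Lemma sect_nbhs K s y (N : set Sigma) : sect K s -> K y -> nbhs (s y) N ->
  nbhs y [set z | K z /\ N (s z)].
Proof.
move=> [_ oK /within_continuousP cs _ _] Ky nN.
exact: open_filter_sub oK Ky (cs y Ky N nN).
Qed.

Lemma sect_section K s : sect K s -> section T K (p \o s).
Proof.
move=> [_ _ /within_continuousP cs ds _]; split.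
  by apply/within_continuousP => y Ky N nN; exact: (cs y Ky _ (tproj_continuous nN)).
by move=> y Ky /=; rewrite (tproj_dom T) ds.
Qed.

Lemma sect_sub K s L : sect K s -> compact L -> open L -> L `<=` K -> sect L s.
Proof.
move=> [_ _ cs ds rs] cL oL LK; split=> //.
- exact: continuous_subspaceW LK cs.
- by move=> y /LK/ds.
- by move=> y y' /LK Ky /LK Ky'; exact: rs.
Qed.

Lemma sect_proj_open K s U : sect K s -> open U -> U `<=` K -> open (p @` (s @` U)).
Proof.
move=> hs oU UK; rewrite image_comp; apply: (@open_section _ _ _ _ T) => //.
have [c ds] := sect_section hs; split; first exact: continuous_subspaceW UK c.
by move=> y /UK/ds.
Qed.

Lemma sect_rng_open K s U : sect K s -> open U -> U `<=` K -> open ((r \o s) @` U).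
Proof.
move=> hs oU UK.
have -> : (r \o s) @` U = grng gG @` (p @` (s @` U)).
  rewrite !image_comp; apply: eq_imagel => y _ /=.
  by rewrite (tproj_rng T).
apply: local_homeo_open (sect_proj_open hs oU UK); exact: G_rng_homeo.
Qed.

(** Inverse of the partial homeomorphism of [X] induced by a bisection; its continuity is the
    openness of [r \o s], which comes from the local homeomorphisms of [G]. *)
Lemma sect_rng_inv K s : sect K s -> exists beta : X -> X,
  (forall y, K y -> beta (r (s y)) = y) /\ {within (r \o s) @` K, continuous beta}.
Proof.
move=> hs; have [cK oK cs ds rs] := hs.
have /choice [beta betaP] : forall z, exists y,
    forall y', K y' -> z = r (s y') -> y' = y.
  move=> z; case: (pselect (exists2 y, K y & z = r (s y))) => [[y Ky zy]|n].
    by exists y => y' Ky' zy'; apply: rs => //; rewrite -zy -zy'.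
  by exists z => y' Ky' zy'; case: n; exists y'.
have bK y : K y -> beta (r (s y)) = y by move=> Ky; rewrite -(betaP _ y).
exists beta; split=> //.
apply/within_continuousP => _ [y Ky <-] N; rewrite /= bK // => nN.
have : nbhs (r (s y)) ((r \o s) @` (K `&` N°)).
  apply: open_nbhs_nbhs; split.
    apply: (sect_rng_open hs); last by move=> z [].
    by apply: openI => //; exact: open_interior.
  by exists y => //; split=> //; exact: nN.
apply: filterS => _ [y' [Ky' Ny'] <-] _; rewrite /= bK //.
exact: interior_subset.
Qed.

Lemma BisP (S : set Sigma) : Bis T S <-> exists K s, sect K s /\ S = s @` K.
Proof.
split=> [[cS [orS [[_ injr _] _ _]] [odS [_ _ [g cg gK]]]]|[K [s [hs ->]]]].
  exists (d @` S), g; split.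
    split=> //.
    - apply: continuous_compact => //; apply: continuous_subspaceT.
      exact: dom_continuous.
    - by move=> _ [t St <-]; rewrite gK.
    - move=> _ _ [t St <-] [t' St' <-]; rewrite !gK // => E; congr d.
      by apply: injr; rewrite ?inE.
  rewrite image_comp; apply/seteqP; split=> [t St|_ [t St <-]].
    by exists t => //=; rewrite gK.
  by rewrite /= gK.
have [cK oK cs ds rs] := hs.
have [beta [bK cb]] := sect_rng_inv hs.
split; first exact: continuous_compact.
  have rK : r @` (s @` K) = (r \o s) @` K by rewrite image_comp.
  split; first by rewrite rK; exact: (sect_rng_open hs).
  split.
  - split=> //.
    move=> t t'; rewrite !inE => -[y Ky <-] [y' Ky' <-] E.
    by rewrite (rs y y').
  - by apply: continuous_subspaceT; exact: rng_continuous.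
  - exists (s \o beta).
      apply/within_continuousP => z; rewrite rK => zK N nN.
      have [y Ky yz] := zK.
      have by' : K (beta z) by rewrite -yz /= bK.
      have := sect_nbhs hs by' nN => h.
      have /within_continuousP cb' := cb; have := cb' z zK _ h.
      by apply: filterS => w /= + Kw => /(_ Kw)[].
    by move=> _ [y Ky <-] /=; rewrite bK.
have dK : d @` (s @` K) = K.
  rewrite image_comp; apply/seteqP; split=> [_ [y Ky <-] /=|y Ky].
    by rewrite ds.
  by exists y => //=; rewrite ds.
split; first by rewrite dK.
split.
- split=> //.
  move=> t t'; rewrite !inE => -[y Ky <-] [y' Ky' <-].
  by rewrite !ds // => ->.
- by apply: continuous_subspaceT; exact: dom_continuous.
- by exists s; [rewrite dK|move=> _ [y Ky <-]; rewrite ds].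
Qed.

(** Existence of enough compact bisections: a bisection of [G] through [h] is lifted to the twist.
    Its value over [h] is some lift, determined only up to a phase. *)
Lemma sect_through (h : G) (W : set G) : nbhs h W -> exists K s,
  [/\ sect K s, K (gdom gG h), p (s (gdom gG h)) = h & forall y, K y -> W (p (s y))].
Proof.
move=> nW.
have [K [g [cK oK Kh gP [gh gW gr]]]] := @section_through _ _ _ _ T h W nW.
have [s [cs ps]] := lift_section cK oK gP.
exists K, s; split=> //; last 2 first.
- by rewrite ps.
- by move=> y Ky; rewrite ps //; exact: gW.
split=> //.
  by move=> y Ky; rewrite -(tproj_dom T) ps //; case: gP => _; apply.
by move=> y y' Ky Ky'; rewrite -!(tproj_rng T) !ps //; exact: gr.
Qed.

Lemma sect_act K s (th : X -> circle R) : sect K s -> {within K, continuous th} ->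
  sect K (fun y => act (th y) (s y)).
Proof.
move=> hs /within_continuousP cth; have [cK oK cs ds rs] := hs; split=> //.
- apply/within_continuousP => y Ky N nN.
  have [e [V [e0 nV VN]]] := act_nbhs nN.
  have h1 := sect_nbhs hs Ky nV.
  have h2 := cth y Ky [set b | nc (set_val (th y) - set_val b) < e].
  have {}h2 := h2 (iffRL (nbhs_circleP _ _) (ex_intro2 _ _ e e0 (fun b h => h))).
  apply: filterS2 h1 h2 => z /= [Kz Vz] /(_ Kz) lt _.
  exact: VN.
- by move=> y Ky; rewrite dom_act ds.
- by move=> y y' Ky Ky'; rewrite !rng_act; exact: rs.
Qed.

Lemma sect_unt K : compact K -> open K -> sect K (gunt gS).
Proof.
move=> cK oK; split=> //.
- by apply: continuous_subspaceT; exact: unt_continuous.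
- by move=> y _; rewrite gdom_unt.
- by move=> y y' _ _; rewrite !grng_unt.
Qed.

Lemma sect_inv K s : sect K s -> exists L t, [/\ sect L t,
  forall y, K y -> L (r (s y)) /\ t (r (s y)) = ginv gS (s y) &
  forall z, L z -> exists2 y, K y & z = r (s y)].
Proof.
move=> hs; have [cK oK cs ds rs] := hs.
have [beta [bK cb]] := sect_rng_inv hs.
exists ((r \o s) @` K), (fun z => ginv gS (s (beta z))); split; last 2 first.
- by move=> y Ky; split; [exists y|rewrite bK].
- by move=> _ [y Ky <-]; exists y.
split.
- apply: continuous_compact => //.
  apply/within_continuousP => y Ky N nN.
  have := sect_nbhs hs Ky (rng_continuous nN).
  by apply: filterS => z [_ h] _.
- exact: (sect_rng_open hs).
- apply/within_continuousP => z zK N nN.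
  have [y Ky yz] := zK.
  have by' : K (beta z) by rewrite -yz /= bK.
  have h := sect_nbhs hs by' (inv_continuous nN).
  have /within_continuousP cb' := cb; have := cb' z zK _ h.
  by apply: filterS => w /= + Kw => /(_ Kw)[].
- by move=> _ [y Ky <-] /=; rewrite bK // gdom_inv.
- move=> _ _ [y Ky <-] [y' Ky' <-] /=; rewrite !bK // !grng_inv !ds //.
  by move=> ->.
Qed.

(** Product of two bisections. Its domain is compact because its complement in [L] is open as well,
    [K] being closed. *)
Lemma sect_mul K s L t : sect K s -> sect L t ->
  sect [set y | L y /\ K (r (t y))] (fun y => s (r (t y)) ** t y).
Proof.
move=> hs ht; have [cK oK cs ds rs] := hs; have [cL oL ct dt rt] := ht.
have oM : open [set y | L y /\ K (r (t y))].
  rewrite openE => y [Ly Ky]; rewrite /interior.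
  apply: (sect_nbhs (N := r @^-1` K) ht Ly).
  by apply: rng_continuous; exact: open_nbhs_nbhs.
split=> //.
- have oN : open [set y | L y /\ ~ K (r (t y))].
    rewrite openE => y [Ly nKy]; rewrite /interior.
    apply: (sect_nbhs (N := r @^-1` ~` K) ht Ly).
    apply: rng_continuous; apply: open_nbhs_nbhs; split=> //.
    exact: closed_openC (compact_X_closed T cK).
  rewrite (_ : [set y | _] = L `&` ~` [set y | L y /\ ~ K (r (t y))]).
    apply: (subclosed_compact _ cL); last by move=> y [].
    apply: closedI; [apply: (compact_X_closed T) => //|exact: open_closedC].
  apply/seteqP; split=> y [Ly h]; split=> //; first by move=> [].
  by apply: contrapT => nK; exact: h.
- apply/within_continuousP => y [Ly Ky] N nN.
  have [|U [V [nU nV UV]]] := mul_nbhs _ nN; first exact: ds.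
  have h1 := sect_nbhs ht Ly nV.
  have h2 := sect_nbhs ht Ly (rng_continuous (sect_nbhs hs Ky nU)).
  apply: filterS2 h1 h2 => z [_ Vz] [_ [Kz Uz]] _; apply: UV => //.
  exact: ds.
- by move=> y [Ly Ky]; rewrite gdom_mul ?ds ?dt.
- move=> y y' [Ly Ky] [Ly' Ky']; rewrite !grng_mul ?ds // => /(rs _ _ Ky Ky').
  exact: rt.
Qed.

(** Eliminates the choice made in [Delta]; in the second case the point lies over no arrow of the
    projected bisection. *)
Lemma DeltaP K s u : sect K s ->
  (exists y a, [/\ K y, u = act a (s y) & Delta T (s @` K) u = (set_val a)^*%C]) \/
  ((forall y, K y -> p u <> p (s y)) /\ Delta T (s @` K) u = 0).
Proof.
move=> hs; rewrite /Delta; case: pselect => [h|n].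
  left; case: cid => a aP /=; have [_ [y Ky <-] ua] := aP.
  by exists y, a.
right; split=> // y Ky /proj_eq [a ua]; apply: n.
by exists a, (s y) => //; exists y.
Qed.

Lemma Delta_act K s y a : sect K s -> K y ->
  Delta T (s @` K) (act a (s y)) = (set_val a)^*%C.
Proof.
move=> hs Ky; have [cK oK cs ds rs] := hs.
have [[y' [b [Ky' E ->]]]|[n _]] := DeltaP (act a (s y)) hs.
  have yy : y = y'.
    by rewrite -(ds y) // -(ds y') // -(dom_act T a) E dom_act.
  by move: E; rewrite -yy => /act_free ->.
by case: (n y Ky); rewrite proj_act.
Qed.

Lemma Delta_sect K s y : sect K s -> K y -> Delta T (s @` K) (s y) = 1.
Proof.
move=> hs Ky; rewrite -(act_one T (s y)) Delta_act //.
by rewrite rmorph1.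
Qed.

Lemma Delta_supp K s u : sect K s -> Delta T (s @` K) u <> 0 ->
  K (d u) /\ p u = p (s (d u)).
Proof.
move=> hs; have [cK oK cs ds rs] := hs.
have [[y [a [Ky -> _]]] _|[_ ->]//] := DeltaP u hs.
by rewrite dom_act ds // proj_act.
Qed.

Lemma Delta_equivariant K s : sect K s -> equivariant T (Delta T (s @` K)).
Proof.
move=> hs a u; have [[y [b [Ky -> ->]]]|[n ->]] := DeltaP u hs.
  by rewrite act_act Delta_act //= rmorphM.
rewrite mulr0; have [[y [b [Ky E _]]]|[_ ->]//] := DeltaP (act a u) hs.
by case: (n y Ky); rewrite -(proj_act T a) E proj_act.
Qed.

(** The support has at most one orbit over each source and each range: the matrix has at most one
    nonzero entry in each row and column, so by the Schur test a bound on values bounds the norm. *)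
Definition monomial f :=
  (forall u v, f u <> 0 -> f v <> 0 -> d u = d v -> p u = p v) /\
  (forall u v, f u <> 0 -> f v <> 0 -> r u = r v -> p u = p v).

Lemma le_sum_single (I : choiceType) (F : I -> C) (A : R) (E : {fset I}) :
  (forall i, nc (F i) <= A) -> 0 <= A ->
  (forall i j, F i <> 0 -> F j <> 0 -> i = j) -> \sum_(i <- E) nc (F i) <= A.
Proof.
move=> FA A0 Fu; case: (pselect (exists2 i, i \in E & F i <> 0)) => [[i iE Fi]|n].
  rewrite (@sum_mask I _ [fset i]%fset E (fun i => nc (F i))).
  - by rewrite big_seq_fset1.
  - by rewrite fsub1set.
  - move=> j; rewrite inE => ji; case: (pselect (F j = 0)) => [->|Fj].
      exact: nc0.
    by move: ji; rewrite (Fu j i Fj Fi) eqxx.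
rewrite big_seq big1 // => i iE; case: (pselect (F i = 0)) => [->|Fi].
  exact: nc0.
by case: n; exists i.
Qed.

Lemma mat_nz f h l : mat T f h l <> 0 ->
  gdom gG h = gdom gG l /\ f (quo gS (lift h) (lift l)) <> 0.
Proof. by rewrite /mat; case: eqP. Qed.

Lemma bnd_monomial f (A : R) : equivariant T f -> monomial f ->
  (forall u, nc (f u) <= A) -> 0 <= A -> bnd T f A.
Proof.
move=> ef [fd fr] fA A0.
have matA h l : nc (mat T f h l) <= A by rewrite /mat; case: eqP; rewrite ?nc0.
split=> //; apply: opb_schur => // E h; apply: le_sum_single => // l l'.
  move=> /mat_nz [hl nz] /mat_nz [hl' nz'].
  have hl1 : d (lift h) = d (lift l) by rewrite !dom_lift.
  have hl1' : d (lift h) = d (lift l') by rewrite !dom_lift.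
  have := fr _ _ nz nz'; rewrite !rng_quo // => /(_ erefl).
  rewrite !proj_quo // !tliftK => /(congr1 (fun m => gmul gG (ginv gG m) h)).
  by rewrite !inv_quo // !quoK.
move=> /mat_nz [hl nz] /mat_nz [hl' nz'].
have hl1 : d (lift l) = d (lift h) by rewrite !dom_lift.
have hl1' : d (lift l') = d (lift h) by rewrite !dom_lift.
have := fd _ _ nz nz'; rewrite !dom_quo // => /(_ erefl).
rewrite !proj_quo // !tliftK => /(congr1 (fun m => gmul gG m h)).
by rewrite !quoK.
Qed.

Lemma monomialM f k : monomial f -> monomial (fun u => f u * k u).
Proof.
move=> [fd fr]; split=> u v fu fv.
  by apply: fd => E; [apply: fu|apply: fv]; rewrite E mul0r.
by apply: fr => E; [apply: fu|apply: fv]; rewrite E mul0r.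
Qed.

Lemma Delta_monomial K s : sect K s -> monomial (Delta T (s @` K)).
Proof.
move=> hs; have [cK oK cs ds rs] := hs; split=> u v.
  by move=> /(Delta_supp hs)[_ ->] /(Delta_supp hs)[_ ->] ->.
move=> /(Delta_supp hs)[Ku pu] /(Delta_supp hs)[Kv pv] uv.
rewrite pu pv; congr (p (s _)); apply: rs => //.
by rewrite -!(tproj_rng T) -pu -pv !(tproj_rng T).
Qed.

Lemma nc_Delta K s u : sect K s -> nc (Delta T (s @` K) u) <= 1.
Proof.
move=> hs; have [[y [a [_ _ ->]]]|[_ ->]] := DeltaP u hs.
  by rewrite nc_conj nc_circle.
by rewrite nc0 ler01.
Qed.

(** Only the term of [p v] survives, and its chosen lift may be replaced by [v] because the phases
    of the two factors cancel. *)
Lemma convol_single f k u v : equivariant T f -> equivariant T k -> d v = d u ->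
  (forall w, d w = d u -> p w <> p v -> f (quo gS u w) * k w = 0) ->
  convol T f k u = f (quo gS u v) * k v.
Proof.
move=> ef ek vu single; rewrite convol_val //; apply: csum_eq.
have [a ha] : exists a, lift (p v) = act a v by apply: proj_eq; rewrite tliftK.
have -> : f (quo gS u v) * k v = \sum_(l <- [fset p v]%fset)
    if gdom gG l == d u then f (quo gS u (lift l)) * k (lift l) else 0.
  rewrite big_seq_fset1 (tproj_dom T) vu eqxx ha quo_actr ?dom_act // ef ek.
  rewrite val_circle_inv conjcK mulrACA circle_conj mul1r //.
apply: ssum_fin => l; rewrite inE => /eqP lv; case: eqP => // dl.
by apply: single; rewrite ?dom_lift ?tliftK.
Qed.

(* If [k] is supported, above [d u], on the orbit of [v], then the sum
   defining [(f * k)(u)] has a single term. *)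
Lemma convol_singler f k u v : equivariant T f -> equivariant T k -> d v = d u ->
  (forall w, d w = d u -> p w <> p v -> k w = 0) ->
  convol T f k u = f (quo gS u v) * k v.
Proof.
move=> ef ek vu single; apply: convol_single => // w wu wv.
by rewrite single ?mulr0.
Qed.

Lemma convol_singlel f k u v : equivariant T f -> equivariant T k -> r v = r u ->
  (forall w, r w = r u -> p w <> p v -> f w = 0) ->
  convol T f k u = f v * k (ginv gS v ** u).
Proof.
move=> ef ek vu single.
have dvu : d (ginv gS v) = r u by rewrite gdom_inv.
have qv : quo gS u (ginv gS v ** u) = v.
  rewrite /quo ginv_mul // ginvK gmul_assoc ?grng_inv ?gdom_inv //.
  by rewrite gmul_inv_r -vu gmul_unt_l.
rewrite (@convol_single f k u (ginv gS v ** u)) ?qv // ?gdom_mul // => w wu wv.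
rewrite single ?mul0r // ?rng_quo // => E; apply: wv.
rewrite tproj_mul // proj_inv -E proj_quo // inv_quo ?(tproj_dom T) //.
by rewrite quoK // !(tproj_dom T).
Qed.

End bisections.

(** * The algebra [C_c(G, Sigma)] *)

Section Cc_algebra.
Context (R : realType) (X G Sigma : topologicalType).
Variable T : twisted_boolean_groupoid R X G Sigma.
Local Notation C := R[i].
Local Notation nc := (@ComplexField.Normc.normc R).
Local Notation gG := (tgrp T).
Local Notation gS := (text T).
Local Notation p := (tproj T).
Local Notation r := (grng gS).
Local Notation d := (gdom gS).
Local Notation "a ** b" := (gmul gS a b) (at level 40, left associativity).
Local Notation act := (tact T).
Implicit Types (u v : Sigma) (a : circle R) (K L : set X) (s t : X -> Sigma).
Implicit Types (f k : Sigma -> C) (b c : X -> C).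

Definition elem K s b u : C := Delta T (s @` K) u * b (d u).

Lemma Cc_twist0 : Cc_twist T (fun=> 0).
Proof.
exists 0%N, (fun=> set0), (fun=> fun=> 0); split; [by case|by case|].
by move=> s; rewrite big_ord0.
Qed.

Lemma Cc_twist_cons K s b f : sect T K s -> Cc_space b -> Cc_twist T f ->
  Cc_twist T (fun u => elem K s b u + f u).
Proof.
move=> hs hb [n [S [c [HS Hc Hf]]]].
exists n.+1, (fun i => if unlift ord0 i is Some j then S j else s @` K),
  (fun i => if unlift ord0 i is Some j then c j else b); split.
- by move=> i; case: unlift => //; apply: (iffRL (BisP T _)); exists K, s.
- by move=> i; case: unlift.
- move=> u; rewrite big_ord_recl unlift_none Hf; congr (_ + _).
  by apply: eq_bigr => j _; rewrite liftK.
Qed.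

Lemma Cc_ind (P : (Sigma -> C) -> Prop) : P (fun=> 0) ->
  (forall K s b f, sect T K s -> Cc_space b -> Cc_twist T f -> P f ->
     P (fun u => elem K s b u + f u)) ->
  forall f, Cc_twist T f -> P f.
Proof.
move=> P0 Pcons f [n]; elim: n f => [|n IH] f [S [b [HS Hb Hf]]].
  rewrite (_ : f = fun=> 0) //; apply/funext => u.
  by rewrite Hf big_ord0.
have [K [s [hs SE]]] := (iffLR (BisP T _) (HS ord0)).
pose f' u := \sum_(i < n) Delta T (S (lift ord0 i)) u * b (lift ord0 i) (d u).
have f'P : exists (S : 'I_n -> set Sigma) (b : 'I_n -> X -> C),
    [/\ forall i, Bis T (S i), forall i, Cc_space (b i) &
        forall u, f' u = \sum_(i < n) Delta T (S i) u * b i (d u)].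
  by exists (fun i => S (lift ord0 i)), (fun i => b (lift ord0 i)).
rewrite (_ : f = fun u => elem K s (b ord0) u + f' u).
  by apply: Pcons => //; [exists n|exact: IH].
by apply/funext => u; rewrite Hf big_ord_recl /elem -SE.
Qed.

Lemma Cc_twist_elem K s b : sect T K s -> Cc_space b -> Cc_twist T (elem K s b).
Proof.
move=> hs hb; have := Cc_twist_cons hs hb Cc_twist0.
by rewrite (_ : (fun u => _) = elem K s b) //; apply/funext => u; rewrite addr0.
Qed.

Lemma Cc_twist_add f k : Cc_twist T f -> Cc_twist T k ->
  Cc_twist T (fun u => f u + k u).
Proof.
move=> hf hk; move: f hf; apply: Cc_ind => [|K s b f hs hb _ IH].
  by rewrite (_ : (fun u => _) = k) //; apply/funext => u; rewrite add0r.
by under eq_fun do rewrite -addrA; exact: Cc_twist_cons.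
Qed.

Lemma elem_equivariant K s b : sect T K s -> equivariant T (elem K s b).
Proof.
by move=> hs a u; rewrite /elem (Delta_equivariant hs) dom_act mulrA.
Qed.

Lemma elem_sect K s b y : sect T K s -> K y -> elem K s b (s y) = b y.
Proof.
move=> hs Ky; rewrite /elem Delta_sect // mul1r.
by have [_ _ _ -> ] := hs.
Qed.

Lemma elem_supp K s b u : sect T K s -> elem K s b u <> 0 ->
  K (d u) /\ p u = p (s (d u)).
Proof.
by move=> hs nz; apply: Delta_supp => // E; apply: nz; rewrite /elem E mul0r.
Qed.

(** [K] is closed as well as open, so extension by zero creates no discontinuity. *)
Lemma Cc_space_ext K b : compact K -> open K -> {within K, continuous b} ->
  Cc_space (fun y => if y \in K then b y else 0).
Proof.
move=> cK oK /within_continuousP cb; have clK := compact_X_closed T cK.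
split.
  move=> y N; case: ifPn => [|/negP] yK nN.
    have Ky : K y by move: yK; rewrite inE.
    have h1 := cb y Ky N nN; have h2 := open_nbhs_nbhs (conj oK Ky).
    by apply: filterS2 h1 h2 => z /= h Kz; rewrite mem_set //; exact: h.
  have nKy : (~` K) y by move=> Ky; apply: yK; exact: mem_set.
  have h := open_nbhs_nbhs (conj (closed_openC clK) nKy).
  apply: filterS h => z /= nKz; rewrite memNset //.
  exact: nbhs_singleton.
apply: (subclosed_compact _ cK); first exact: closed_closure.
rewrite [X in _ `<=` X](iffLR (closure_id K) clK).
apply: closure_subset => y /=; case: ifPn; rewrite ?inE //.
by rewrite eqxx.
Qed.

(* Intrinsic description of the generators of [Cc_twist]. *)
Lemma Cc_twist_intro K s f : sect T K s -> equivariant T f ->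
  {within K, continuous (f \o s)} ->
  (forall u, f u <> 0 -> K (d u) /\ p u = p (s (d u))) -> Cc_twist T f.
Proof.
move=> hs ef cf fsupp; have [cK oK cs ds rs] := hs.
pose b y := if y \in K then f (s y) else 0.
have hb : Cc_space b := Cc_space_ext cK oK cf.
rewrite (_ : f = elem K s b); first exact: Cc_twist_elem.
apply/funext => u; have [[y [a [Ky uE DE]]]|[n DE]] := DeltaP u hs.
  by rewrite /elem DE /b uE dom_act ds // mem_set // ef.
rewrite /elem DE mul0r; case: (pselect (f u = 0)) => // /fsupp [Kd pu].
by case: (n (d u)).
Qed.

Lemma continuous_const (z : C) : continuous (fun _ : X => z).
Proof.
apply/continuous_complexP => x e e0.
rewrite (_ : [set y | _] = setT); first exact: filterT.
by apply/seteqP; split=> // y _ /=; rewrite subrr nc0.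
Qed.

Lemma Cc_space_within b K : Cc_space b -> {within K, continuous b}.
Proof. by move=> [cb _]; exact: continuous_subspaceT. Qed.

Lemma Cc_space_bounded b : Cc_space b -> exists2 M : R, 0 < M & forall y, nc (b y) <= M.
Proof.
move=> [cb cc]; have [M M0 MP] := continuous_bounded cb cc.
exists M => // y; case: (pselect (b y = 0)) => [->|by0].
  by rewrite nc0 ltW.
by apply: MP; apply: subset_closure; exact/eqP.
Qed.

Lemma bnd_elem K s b (M : R) : sect T K s -> 0 <= M ->
  (forall y, nc (b y) <= M) -> bnd T (elem K s b) M.
Proof.
move=> hs M0 bM; apply: bnd_monomial => //.
- exact: elem_equivariant.
- by apply: monomialM; exact: Delta_monomial.
- move=> u; rewrite /elem ncM -[leRHS]mul1r; apply: ler_pM => //; try exact: nc_ge0.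
  exact: nc_Delta.
Qed.

Lemma bnd0 : bnd T (fun=> 0) 0.
Proof.
apply: bnd_monomial => //; first by move=> a u; rewrite mulr0.
by move=> u; rewrite nc0.
Qed.

Lemma Cc_bnd f : Cc_twist T f -> exists A, bnd T f A.
Proof.
apply: (Cc_ind (P := fun f => exists A, bnd T f A)); first by exists 0; exact: bnd0.
move=> K s b {}f hs /Cc_space_bounded [M M0 bM] _ [A fA].
by exists (M + A); apply: bnd_add => //; apply: bnd_elem => //; exact: ltW.
Qed.

Lemma Cc_twist_scale (z : C) f : Cc_twist T f -> Cc_twist T (fun u => z * f u).
Proof.
move: f; apply: Cc_ind => [|K s b f hs hb _ IH].
  by under eq_fun do rewrite mulr0; exact: Cc_twist0.
under eq_fun do rewrite mulrDr; apply: Cc_twist_add => //.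
apply: (Cc_twist_intro hs).
- by move=> a u; rewrite (elem_equivariant b hs) mulrCA.
- have [_ _ _ ds _] := hs.
  have : Cc_space (fun y => z * b y).
    case: hb => cb cc; split.
      exact: (@continuous_complexM R X _ _ (@continuous_const z) cb).
    apply: (subclosed_compact _ cc); first exact: closed_closure.
    apply: closure_subset => y /=; apply: contra => /eqP ->.
    by rewrite mulr0.
  move=> /(Cc_space_within (K := K)) /within_continuousP h.
  apply/within_continuousP => y Ky N; rewrite /= elem_sect // => nN.
  apply: filterS (h y Ky N nN) => y' /= h' Ky'; rewrite elem_sect //.
  exact: h'.
- move=> u nz; apply: (elem_supp (b := b)) => // E.
  by apply: nz; rewrite E mulr0.
Qed.

(** The adjoint lives on the inverse bisection, with coefficient the conjugate of [b] transported by
    the inverse of [r \o s]. *)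
Lemma Cc_twist_star_elem K s b : sect T K s -> Cc_space b ->
  Cc_twist T (fstar T (elem K s b)).
Proof.
move=> hs hb; have [L [t [ht tK LK]]] := sect_inv hs.
have [cK oK cs ds rs] := hs.
have ef := elem_equivariant b hs.
have [beta [bK cb]] := sect_rng_inv hs.
apply: (Cc_twist_intro ht); first exact: fstar_equivariant.
- have [/continuous_complex_conj cbc _] := hb.
  have [_ _ _ dt _] := ht.
  have val z : L z -> fstar T (elem K s b) (t z) = (b (beta z))^*%C.
    move=> /LK [y Ky ->]; have [_ ->] := tK y Ky.
    by rewrite /fstar ginvK elem_sect // bK.
  apply/within_continuousP => z Lz N; rewrite /= val // => nN.
  have zK : ((r \o s) @` K) z by have [y Ky ->] := LK z Lz; exists y.
  have /within_continuousP cb' := cb.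
  apply: filterS (cb' z zK _ (cbc _ _ nN)) => w /= h Lw; rewrite val //.
  by apply: h; have [y Ky ->] := LK w Lw; exists y.
- move=> u nz.
  have [Kd pu] : K (d (ginv gS u)) /\ p (ginv gS u) = p (s (d (ginv gS u))).
    by apply: (elem_supp (b := b)) => // E; apply: nz; rewrite /fstar E conjc0.
  move: Kd pu; rewrite gdom_inv => Kr pu.
  have du : d u = r (s (r u)).
    by rewrite -(tproj_rng T) -pu (tproj_rng T) grng_inv.
  have [Ld td] := tK _ Kr; rewrite du; split=> //.
  by rewrite td proj_inv -pu proj_inv ginvK.
Qed.

Lemma fstar_add f k : fstar T (fun u => f u + k u) =
  fun u => fstar T f u + fstar T k u.
Proof. by apply/funext => u; rewrite /fstar rmorphD. Qed.

Lemma Cc_twist_star f : Cc_twist T f -> Cc_twist T (fstar T f).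
Proof.
move: f; apply: Cc_ind => [|K s b f hs hb _ IH].
  rewrite (_ : fstar T _ = fun=> 0); first exact: Cc_twist0.
  by apply/funext => u; rewrite /fstar conjc0.
by rewrite fstar_add; apply: Cc_twist_add => //; exact: Cc_twist_star_elem.
Qed.

Lemma convol_elem f K s b u : equivariant T f -> sect T K s -> K (d u) ->
  convol T f (elem K s b) u = f (quo gS u (s (d u))) * b (d u).
Proof.
move=> ef hs Kd; have [cK oK cs ds rs] := hs.
rewrite (@convol_singler _ _ _ _ T f (elem K s b) u (s (d u))) //.
- by rewrite elem_sect.
- exact: elem_equivariant.
- by rewrite ds.
- move=> w wu wv; case: (pselect (elem K s b w = 0)) => // /(elem_supp hs)[_].
  by rewrite wu.
Qed.

Lemma convol_elem0 f K s b u : equivariant T f -> sect T K s -> ~ K (d u) ->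
  convol T f (elem K s b) u = 0.
Proof.
move=> ef hs nK.
have z w : d w = d u -> elem K s b w = 0.
  by move=> wu; case: (pselect (elem K s b w = 0)) => // /(elem_supp hs)[];
    rewrite wu.
rewrite (@convol_singler _ _ _ _ T f (elem K s b) u u) //.
- by rewrite z // mulr0.
- exact: elem_equivariant.
- by move=> w wu _; exact: z.
Qed.

(** The product lives on the product bisection, where its coefficient at [y] is
    [b (r (t y)) * c y]. *)
Lemma Cc_twist_convol_elem K s b L t c : sect T K s -> Cc_space b ->
  sect T L t -> Cc_space c -> Cc_twist T (convol T (elem K s b) (elem L t c)).
Proof.
move=> hs hb ht hc; have hst := sect_mul hs ht.
have [cK oK cs ds rs] := hs; have [cL oL ct dt rt] := ht.
have es := elem_equivariant b hs; have et := elem_equivariant c ht.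
apply: (Cc_twist_intro hst); first exact: convol_equivariant.
- have val y : L y /\ K (r (t y)) ->
      convol T (elem K s b) (elem L t c) (s (r (t y)) ** t y) = b (r (t y)) * c y.
    move=> [Ly Ky]; have dy : d (s (r (t y)) ** t y) = y.
      by rewrite gdom_mul ?ds ?dt.
    rewrite convol_elem // ?dy //; congr (_ * _).
    by rewrite /quo gmulKr ?ds // elem_sect.
  apply/within_continuousP => y Py N; rewrite /= val // => nN.
  have [Ly Ky] := Py.
  have [e e0 eN] := iffLR (nbhs_complexP _ _) nN.
  have [M M0 MP] := Cc_space_bounded hb; have [M' M'0 M'P] := Cc_space_bounded hc.
  have [/continuous_complexP cb _] := hb; have [/continuous_complexP cc _] := hc.
  have s0 : 0 < M + M' by exact: addr_gt0.
  have h1 := sect_nbhs ht Ly (rng_continuous (cb (r (t y)) _ (divr_gt0 e0 s0))).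
  have h2 := cc y _ (divr_gt0 e0 s0).
  apply: filterS2 h1 h2 => z [_ /= h1] h2 Pz; rewrite val //; apply: eN.
  have -> : b (r (t y)) * c y - b (r (t z)) * c z =
    b (r (t y)) * (c y - c z) + (b (r (t y)) - b (r (t z))) * c z by ring.
  apply: (le_lt_trans (ncD _ _)); rewrite !ncM.
  apply: (@le_lt_trans _ _ (M * nc (c y - c z) + nc (b (r (t y)) - b (r (t z))) * M')).
    by apply: lerD; [apply: ler_wpM2r|apply: ler_wpM2l]; rewrite ?nc_ge0.
  have -> : e = M * (e / (M + M')) + (e / (M + M')) * M'.
    by rewrite mulrC -mulrDr divfK // gt_eqF.
  by apply: ltrD; [rewrite ltr_pM2l|rewrite ltr_pM2r].
- move=> u nz; case: (pselect (L (d u))) => Ld; last first.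
    by case: nz; rewrite convol_elem0.
  have : elem K s b (quo gS u (t (d u))) <> 0.
    by move=> E; apply: nz; rewrite convol_elem // E mul0r.
  have du : d u = d (t (d u)) by rewrite dt.
  move=> /(elem_supp hs); rewrite dom_quo // => -[Kr pq].
  split=> //; rewrite tproj_mul ?ds // -pq -tproj_mul ?dom_quo //.
  by rewrite quoK.
Qed.

Lemma Cc_twist_convol f k : Cc_twist T f -> Cc_twist T k ->
  Cc_twist T (convol T f k).
Proof.
move=> hf hk; move: f hf; apply: Cc_ind => [|K s b f hs hb hf IH].
  have [A kA] := Cc_bnd hk; have := convolZl 0 bnd0 kA.
  under eq_fun do rewrite mul0r.
  by move=> ->; under eq_fun do rewrite mul0r; exact: Cc_twist0.
have [A kA] := Cc_bnd hk; have [B fB] := Cc_bnd hf.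
have [D eD] := Cc_bnd (Cc_twist_elem hs hb).
rewrite (convolDl eD fB kA); apply: Cc_twist_add => //.
move: k hk {A kA IH}; apply: Cc_ind => [|L t c k ht hc hk IH].
  have := convolZr 0 bnd0 eD; under eq_fun do rewrite mul0r.
  by move=> ->; under eq_fun do rewrite mul0r; exact: Cc_twist0.
have [A kA] := Cc_bnd hk; have [F eF] := Cc_bnd (Cc_twist_elem ht hc).
rewrite (convolDr eF kA eD); apply: Cc_twist_add => //.
exact: Cc_twist_convol_elem.
Qed.

End Cc_algebra.

(** * The reduced norm *)

Section reduced_norm.
Context (R : realType) (X G Sigma : topologicalType).
Variable T : twisted_boolean_groupoid R X G Sigma.
Local Notation C := R[i].
Local Notation nc := (@ComplexField.Normc.normc R).
Local Notation gG := (tgrp T).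
Local Notation gS := (text T).
Local Notation p := (tproj T).
Local Notation r := (grng gS).
Local Notation d := (gdom gS).
Local Notation lift := (tlift T).
Local Notation act := (tact T).
Implicit Types (u v : Sigma) (a : circle R) (f k xi : Sigma -> C) (E F : {fset G}).

Lemma poweR_half_le (x : \bar R) (A : R) : (0 <= x)%E -> 0 <= A ->
  (x `^ 2^-1 <= A%:E)%E = (x <= (A ^+ 2)%:E)%E.
Proof.
case: x => [x| |] //.
  rewrite poweR_EFin !lee_fin => x0 A0; rewrite powR12_sqrt //.
  by rewrite -{1}(ger0_norm A0) -sqrtr_sqr ler_sqrt // sqr_ge0.
by move=> _ A0; rewrite poweRyr ?invr_eq0 ?pnatr_eq0 // !leye_eq.
Qed.

(** Trades the extended-real norm for a uniform bound on finite subsets of the fibre over [x]. *)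
Lemma hilb_normP (x : X) xi (A : R) : 0 <= A ->
  (hilb_norm T x xi <= A%:E)%E <->
  forall E, (forall h, h \in E -> gdom gG h = x) -> l2 E (xi \o lift) <= A.
Proof.
move=> A0; rewrite /hilb_norm poweR_half_le //; last first.
  by apply: esum_ge0 => h _; rewrite lee_fin; exact: sqr_ge0.
split=> [H E EP|H].
  rewrite -(@ler_pXn2r _ 2) ?nnegrE ?l2_ge0 // l2_sqr.
  rewrite -lee_fin; apply: le_trans H; apply: ereal_sup_ubound.
  exists [set` E]; first by split; [exact: finite_fset|move=> h /EP].
  rewrite fsbig_finite /=; last exact: finite_fset.
  by rewrite set_fsetK -sumEFin.
apply: ge_ereal_sup => _ [D [fD DP] <-].
rewrite fsbig_finite //= sumEFin lee_fin.
have hD h : h \in fset_set D -> gdom gG h = x by rewrite in_fset_set // inE => /DP.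
have := H (fset_set D) hD.
by move=> h; rewrite -l2_sqr; rewrite lerXn2r ?nnegrE ?l2_ge0.
Qed.

Lemma l2_scale (I : choiceType) (E : {fset I}) (c : C) (x : I -> C) :
  l2 E (fun i => c * x i) = nc c * l2 E x.
Proof.
rewrite /l2; under eq_bigr do rewrite ncM exprMn.
rewrite -mulr_sumr sqrtrM ?sqr_ge0 // sqrtr_sqr ger0_norm ?nc_ge0 //.
Qed.

Lemma red_norm_hilb f (A : R) : (red_norm T f <= A%:E)%E ->
  forall x xi, hilb T x xi -> (hilb_norm T x xi <= 1)%E ->
  (hilb_norm T x (convol T f xi) <= A%:E)%E.
Proof.
move=> H x xi h1 h2; apply: le_trans H.
apply: (@le_trans _ _ (pi_norm T x f)).
  by apply: ereal_sup_ubound; exists xi.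
by apply: ereal_sup_ubound; exists x.
Qed.

(** Finitely supported test vectors: the values [y] are prescribed on the chosen lifts and extended
    by equivariance. *)
Lemma hilb_vector (x : X) (E : {fset G}) (y : G -> C) :
  (forall h, h \in E -> gdom gG h = x) -> l2 E y <= 1 ->
  exists xi, [/\ hilb T x xi, (hilb_norm T x xi <= 1)%E, equivariant T xi &
    forall h, xi (lift h) = mask E y h].
Proof.
move=> Ex y1.
have /choice [c cP] : forall u, exists a, u = act a (lift (p u)).
  by move=> u; apply: proj_eq; rewrite tliftK.
pose xi u := (set_val (c u))^*%C * mask E y (p u).
have exi : equivariant T xi.
  move=> a u; rewrite /xi proj_act.
  have -> : c (act a u) = circle_mul a (c u).
    apply: (@act_free _ _ _ _ T _ _ (lift (p u))).
    by rewrite -act_act -cP -(proj_act T a u) -cP.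
  by rewrite rmorphM /= mulrA.
have xil h : xi (lift h) = mask E y h.
  rewrite /xi tliftK; have -> : c (lift h) = circle_one R.
    apply: (@act_free _ _ _ _ T _ _ (lift h)).
    by rewrite act_one [RHS](cP (lift h)) tliftK.
  by rewrite rmorph1 mul1r.
have n1 : (hilb_norm T x xi <= 1)%E.
  apply/hilb_normP => // F _.
  have -> : l2 F (xi \o lift) = l2 F (mask E y) by apply: eq_l2 => h _ /=.
  apply: le_trans y1; rewrite -(l2_mask y (fsubsetUr F E)).
  by apply: l2_sub; exact: fsubsetUl.
exists xi; split=> //; split.
- move=> u ux; rewrite /xi /mask; case: ifPn; rewrite ?mulr0 // => /Ex.
  by rewrite (tproj_dom T) => /ux.
- by move=> a u _; exact: exi.
- by apply: le_lt_trans n1 _; rewrite ltry.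
Qed.

(** Once normalized, [y] is a vector of norm one in the fibre over [x], to which the defining
    supremum applies; a vanishing norm is treated apart because of the division. *)
Lemma red_norm_block f (A : R) (x : X) (E : {fset G}) (y : G -> C) :
  equivariant T f -> 0 <= A -> (red_norm T f <= A%:E)%E ->
  (forall h, h \in E -> gdom gG h = x) ->
  l2 E (fun h => \sum_(l <- E) mat T f h l * y l) <= A * l2 E y.
Proof.
move=> ef A0 fA Ex; have [y0|yn0] := eqVneq (l2 E y) 0.
  have y0' l : l \in E -> y l = 0.
    move=> lE; apply: nc_eq0; apply/eqP; rewrite -sqrf_eq0.
    have := l2_sqr E y; rewrite y0 expr0n /= => /esym /eqP.
    rewrite psumr_eq0; last by move=> i _; exact: sqr_ge0.
    by move=> /allP /(_ l lE).
  rewrite y0 mulr0 /l2 big_seq big1 ?sqrtr0 // => h _.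
  by rewrite big_seq big1 ?nc0 ?expr0n // => l /y0' ->; rewrite mulr0.
set n := l2 E y in yn0 *.
have n0 : 0 < n by rewrite lt_def yn0 l2_ge0.
have ncn : nc (n^-1)%:C = n^-1 by rewrite nc_real ger0_norm // invr_ge0 ltW.
have [|xi [hxi xi1 exi xil]] := @hilb_vector x E (fun l => (n^-1)%:C * y l) Ex.
  by rewrite l2_scale ncn mulVf.
have /(hilb_normP x (convol T f xi) A0) /(_ E Ex) := red_norm_hilb fA hxi xi1.
have -> : l2 E (convol T f xi \o lift) =
    l2 E (fun h => (n^-1)%:C * \sum_(l <- E) mat T f h l * y l).
  apply: eq_l2 => h hE /=; rewrite convol_val //; apply: csum_eq.
  have -> : (n^-1)%:C * (\sum_(l <- E) mat T f h l * y l) = \sum_(l <- E)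
      if gdom gG l == d (lift h) then f (quo gS (lift h) (lift l)) * xi (lift l) else 0.
    rewrite mulr_sumr; apply: eq_big_seq => l lE.
    rewrite /mat dom_lift !Ex // eqxx xil /mask lE; ring.
  apply: ssum_fin => l /negPf lE; rewrite xil /mask lE mulr0.
  by case: ifP.
by rewrite l2_scale ncn mulrC ler_pdivrMr.
Qed.

(** The matrix is block diagonal along the source fibres: splitting [E] by sources, the squared
    norms of the blocks add up. *)
Lemma opb_red_norm f (A : R) : equivariant T f -> 0 <= A ->
  (red_norm T f <= A%:E)%E -> opb (mat T f) A.
Proof.
move=> ef A0 fA; apply: opb_row_form => // E y.
rewrite -(@ler_pXn2r _ 2) ?nnegrE ?l2_ge0 ?mulr_ge0 ?l2_ge0 // exprMn !l2_sqr.
rewrite (partition_big_imfset _ (gdom gG)) [X in _ <= _ * X](partition_big_imfset _ (gdom gG)) /=.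
rewrite mulr_sumr; apply: ler_sum => x _.
pose Ex := [fset h in E | gdom gG h == x]%fset.
have big_Ex (V : nmodType) (F : G -> V) :
    \sum_(h <- E | gdom gG h == x) F h = \sum_(h <- Ex) F h.
  by rewrite big_fset_condE /=; congr (\sum_(h <- enum_fset _) _); apply/fsetP => h; rewrite !inE.
have ExP h : h \in Ex -> gdom gG h = x by rewrite !inE => /andP[_ /eqP].
have ExE : (Ex `<=` E)%fset by apply/fsubsetP => h; rewrite !inE => /andP[].
rewrite !big_Ex -!l2_sqr.
rewrite -exprMn ler_pXn2r ?nnegrE ?l2_ge0 ?mulr_ge0 ?l2_ge0 //.
apply: le_trans (@red_norm_block f A x Ex y ef A0 fA ExP).
rewrite le_eqVlt; apply/orP; left; apply/eqP.
apply: eq_l2 => h hE; rewrite (fsum_sub _ ExE) [X in _ + X]big1_seq ?addr0 // => l.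
move=> /andP[_]; rewrite !inE => /andP[+ lE]; rewrite lE /= => lx.
by rewrite /mat (ExP h hE) eq_sym (negPf lx) mul0r.
Qed.

(** Each [pi_x] is the compression of the matrix to one source fibre; a vector of that fibre,
    extended by zero, is a bounded vector for the whole matrix. *)
Lemma red_norm_le f (A : R) : bnd T f A -> (red_norm T f <= A%:E)%E.
Proof.
move=> [ef fA]; have A0 := opb_ge0 fA.
apply: ge_ereal_sup => _ [x _ <-]; apply: ge_ereal_sup => _ [xi [[xi0 exi _] xi1] <-].
apply/hilb_normP => // E Ex.
have {}exi : equivariant T xi.
  move=> a u; case: (pselect (d u = x)) => [|ux]; first exact: exi.
  by rewrite !xi0 ?mulr0 // dom_act.
pose y h := if gdom gG h == x then xi (lift h) else 0.
have y1 : l2b y 1.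
  move=> F; pose Fx := [fset h in F | gdom gG h == x]%fset.
  have FxF : (Fx `<=` F)%fset by apply/fsubsetP => h; rewrite !inE => /andP[].
  have FxP h : h \in Fx -> gdom gG h = x by rewrite !inE => /andP[_ /eqP].
  have -> : l2 F y = l2 Fx (xi \o lift).
    congr Num.sqrt; rewrite (fsum_sub _ FxF) [X in _ + X]big1_seq ?addr0; last first.
      move=> h /andP[_]; rewrite !inE => /andP[+ hF]; rewrite hF /= /y => /negPf ->.
      by rewrite nc0 expr0n.
    by apply: eq_big_seq => h /FxP hx; rewrite /y hx eqxx.
  exact: (iffLR (hilb_normP _ _ ler01) xi1).
have -> : l2 E (convol T f xi \o lift) = l2 E (matvec (mat T f) y).
  apply: eq_l2 => h /Ex hx /=; rewrite convol_val //; congr csum; apply/funext => l.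
  rewrite dom_lift /mat /y hx eq_sym; case: eqP => //; by rewrite mul0r.
by have := l2b_matvec fA y1 E; rewrite mulr1.
Qed.

(** On a finite block the entries of the limit are close to those of some late [g m], so
    [opb_closure] transfers the bound. *)
Lemma bnd_limit (g : nat -> Sigma -> C) f (N : nat) (e : R) :
  (forall n, equivariant T (g n)) -> (forall u, (fun n => g n u) @ \oo --> f u) ->
  (forall m, (N <= m)%N -> bnd T (fun u => g m u - g N u) e) ->
  bnd T (fun u => f u - g N u) e.
Proof.
move=> eg glim H; have e0 := bnd_ge0 (H N (leqnn N)).
have ef : equivariant T f.
  move=> a u; apply/eqP; rewrite -subr_eq0; apply/eqP; apply: nc_lt_eq0 => e1 e10.
  have e20 : 0 < e1 / 2 by rewrite divr_gt0.
  have [M MP] := iffLR (cvg_complexP _ _) (glim (act a u)) _ e20.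
  have [M' M'P] := iffLR (cvg_complexP _ _) (glim u) _ e20.
  have h1 := MP (maxn M M') (leq_maxl _ _).
  have h2 := M'P (maxn M M') (leq_maxr _ _).
  apply: (le_trans (nc_dist (g (maxn M M') (act a u)) _ _)).
  rewrite [leRHS]splitr; apply: ltW; apply: ltrD => //.
  by rewrite eg -mulrBr ncM nc_conj nc_circle mul1r nc_distC.
split; first by move=> a u; rewrite ef eg mulrBr.
apply: opb_closure => // E e' e'0.
have fin (L : seq Sigma) : exists M : nat, forall m, (M <= m)%N ->
    forall u, u \in L -> nc (f u - g m u) <= e'.
  elim: L => [|u L [M MP]]; first by exists 0%N.
  have [M' M'P] := iffLR (cvg_complexP _ _) (glim u) _ e'0.
  exists (maxn M M') => m; rewrite geq_max => /andP[Mm M'm] v.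
  by rewrite inE => /orP[/eqP ->|/MP]; [exact/ltW/M'P|apply].
have [M MP] := fin [seq quo gS (lift h) (lift l) | h <- E, l <- E].
exists (mat T (fun u => g (maxn M N) u - g N u)).
  by have [] := H _ (leq_maxr M N).
move=> h l hE lE; rewrite /mat; case: eqP => _; last by rewrite subrr nc0 ltW.
set u := quo _ _ _.
have -> : f u - g N u - (g (maxn M N) u - g N u) = f u - g (maxn M N) u by ring.
by apply: MP; [exact: leq_maxl|apply: allpairs_f].
Qed.

(** Norm approximation replaces Cauchy sequences. Conversely, approximants at distance [1 / (n + 1)]
    form a Cauchy sequence, and they converge pointwise because values are dominated by the norm. *)
Lemma CredP f : Cred T f <-> equivariant T f /\
  forall e : R, 0 < e -> exists2 g, Cc_twist T g & bnd T (fun u => f u - g u) e.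
Proof.
split=> [[g [gC gcauchy glim]]|[ef H]].
  have eg n : equivariant T (g n) by have [A []] := Cc_bnd (gC n).
  have H (e : R) : 0 < e -> exists N, bnd T (fun u => f u - g N u) e.
    move=> e0; have [N NP] := gcauchy e e0; exists N; apply: bnd_limit => // m Nm.
    have em : equivariant T (fun u => g m u - g N u) by move=> a u; rewrite !eg mulrBr.
    by split=> //; apply: opb_red_norm => //; [exact: ltW|exact/ltW/NP].
  split=> [a u|e e0]; last by have [N fN] := H e e0; exists (g N).
  have [N [efN _]] := H 1 ltr01.
  by have := efN a u; rewrite eg mulrBr => /addIr.
have inv0 (n : nat) : 0 < n.+1%:R^-1 :> R by rewrite invr_gt0.
have /choice [g gP] : forall n : nat, exists g, Cc_twist T g /\
    bnd T (fun u => f u - g u) n.+1%:R^-1.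
  by move=> n; have [g gC gb] := H _ (inv0 n); exists g.
exists g; split.
- by move=> n; have [] := gP n.
- move=> e e0; have [N NP] := small_invS (divr_gt0 e0 (ltr0Sn _ 1)).
  exists N => m n Nm Nn.
  have [_ bm] := gP m; have [_ bn] := gP n.
  have := red_norm_le (bnd_sub bn bm).
  rewrite (_ : (fun u => _) = fun u => g m u - g n u); last first.
    by apply/funext => u; ring.
  move=> h; apply: le_lt_trans h _; rewrite lte_fin (splitr e).
  by apply: ltrD; exact: NP.
- move=> u; apply/cvg_complexP => e e0; have [N NP] := small_invS e0.
  exists N => n /NP; apply: le_lt_trans; have [_ bn] := gP n.
  exact: (bnd_val u bn).
Qed.

Lemma red_norm_bnd f k (e : R) : equivariant T f -> equivariant T k -> 0 < e ->
  (red_norm T (fun u => (f u - k u)%R) < e%:E)%E -> bnd T (fun u => f u - k u) e.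
Proof.
move=> ef ek e0 h; have efk : equivariant T (fun u => f u - k u).
  by move=> a u; rewrite ef ek mulrBr.
by split=> //; apply: opb_red_norm => //; exact: ltW.
Qed.

End reduced_norm.

(** * The reduced algebra and its diagonal *)

Section reduced_algebra.
Context (R : realType) (X G Sigma : topologicalType).
Variable T : twisted_boolean_groupoid R X G Sigma.
Local Notation C := R[i].
Local Notation nc := (@ComplexField.Normc.normc R).
Local Notation gG := (tgrp T).
Local Notation gS := (text T).
Local Notation p := (tproj T).
Local Notation r := (grng gS).
Local Notation d := (gdom gS).
Local Notation act := (tact T).
Local Notation unt := (gunt gS).
Local Notation "f <*> k" := (convol T f k) (at level 40, left associativity).
Implicit Types (u v : Sigma) (a : circle R) (f k g : Sigma -> C) (b c : X -> C).
Implicit Types (K L : set X).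

Lemma Cred_equivariant f : Cred T f -> equivariant T f.
Proof. by move=> /CredP[]. Qed.

Lemma Cred_Cc f : Cc_twist T f -> Cred T f.
Proof.
move=> hf; have [A [ef fA]] := Cc_bnd hf; apply/CredP; split=> // e e0.
exists f => //; rewrite (_ : (fun u => _) = fun=> 0).
  by apply: bnd_le (bnd0 T); exact: ltW.
by apply/funext => u; rewrite subrr.
Qed.

Lemma Cred_bnd f : Cred T f -> exists A, bnd T f A.
Proof.
move=> /CredP [ef /(_ 1 ltr01) [g /Cc_bnd [A gA] fg]].
exists (1 + A); rewrite (_ : f = fun u => (f u - g u) + g u).
  exact: bnd_add.
by apply/funext => u; rewrite subrK.
Qed.

Lemma Cred_closed f : equivariant T f ->
  (forall e : R, 0 < e -> exists2 g, Cred T g & bnd T (fun u => f u - g u) e) ->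
  Cred T f.
Proof.
move=> ef H; apply/CredP; split=> // e e0.
have e20 : 0 < e / 2 by rewrite divr_gt0.
have [g /CredP[_ /(_ _ e20) [h hC gh]] fg] := H _ e20.
exists h => //; rewrite (splitr e).
rewrite (_ : (fun u => _) = fun u => (f u - g u) + (g u - h u)).
  exact: bnd_add.
by apply/funext => u; rewrite addrA subrK.
Qed.

Lemma Cred_add f k : Cred T f -> Cred T k -> Cred T (fun u => f u + k u).
Proof.
move=> hf hk; have ef := Cred_equivariant hf; have ek := Cred_equivariant hk.
apply/CredP; split=> [a u|e e0]; first by rewrite ef ek mulrDr.
have e20 : 0 < e / 2 by rewrite divr_gt0.
have [_ /(_ _ e20) [g gC fg]] := iffLR (CredP _ _) hf.
have [_ /(_ _ e20) [h hC kh]] := iffLR (CredP _ _) hk.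
exists (fun u => g u + h u); first exact: Cc_twist_add.
rewrite (splitr e) (_ : (fun u => _) = fun u => (f u - g u) + (k u - h u)).
  exact: bnd_add.
by apply/funext => u; ring.
Qed.

Lemma Cred_scale (z : C) f : Cred T f -> Cred T (fun u => z * f u).
Proof.
move=> hf; have ef := Cred_equivariant hf.
apply/CredP; split=> [a u|e e0]; first by rewrite ef mulrCA.
have z0 : 0 < nc z + 1 by rewrite ltr_wpDl ?nc_ge0.
have [_ /(_ _ (divr_gt0 e0 z0)) [g gC fg]] := iffLR (CredP _ _) hf.
exists (fun u => z * g u); first exact: Cc_twist_scale.
rewrite (_ : (fun u => _) = fun u => z * (f u - g u)).
  apply: bnd_le (bnd_scale z fg); rewrite mulrA ler_pdivrMr // mulrC.
  by apply: ler_wpM2l; [exact: ltW|rewrite lerDl].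
by apply/funext => u; ring.
Qed.

Lemma fstar_sub f k : fstar T (fun u => f u - k u) =
  fun u => fstar T f u - fstar T k u.
Proof. by apply/funext => u; rewrite /fstar rmorphB. Qed.

Lemma fstar_scale (z : C) f : fstar T (fun u => z * f u) =
  fun u => z^*%C * fstar T f u.
Proof. by apply/funext => u; rewrite /fstar rmorphM. Qed.

Lemma Cred_star f : Cred T f -> Cred T (fstar T f).
Proof.
move=> hf; have ef := Cred_equivariant hf.
apply/CredP; split=> [|e e0]; first exact: fstar_equivariant.
have [_ /(_ _ e0) [g gC fg]] := iffLR (CredP _ _) hf.
exists (fstar T g); first exact: Cc_twist_star.
by rewrite -fstar_sub; exact: bnd_star.
Qed.

Lemma Cred_convol f k : Cred T f -> Cred T k -> Cred T (f <*> k).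
Proof.
move=> hf hk; have ef := Cred_equivariant hf; have ek := Cred_equivariant hk.
apply/CredP; split=> [|e e0]; first exact: convol_equivariant.
have [A fA] := Cred_bnd hf; have [B kB] := Cred_bnd hk.
have A0 := bnd_ge0 fA; have B0 := bnd_ge0 kB.
(* As [D <= 1], the approximant [g] has norm at most [A + 1]; the error in
   [f k - g h = (f - g) k + g (k - h)] is then at most [D (A + B + 1)], hence at most [e]. *)
pose D := Num.min 1 (e / (A + B + 1)).
have s0 : 0 < A + B + 1 by rewrite ltr_wpDl ?addr_ge0.
have D0 : 0 < D by rewrite lt_min ltr01 divr_gt0.
have D1 : D <= 1 by rewrite ge_min lexx.
have De : D * (A + B + 1) <= e by rewrite -ler_pdivlMr // ge_min lexx orbT.
have [_ /(_ _ D0) [g gC fg]] := iffLR (CredP _ _) hf.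
have [_ /(_ _ D0) [h hC kh]] := iffLR (CredP _ _) hk.
exists (g <*> h); first exact: Cc_twist_convol.
have [A' gA'] := Cc_bnd gC; have [B' hB'] := Cc_bnd hC.
have gA : bnd T g (A + D).
  rewrite (_ : g = fun u => f u - (f u - g u)); first exact: bnd_sub.
  by apply/funext => u; rewrite opprB addrCA subrr addr0.
rewrite (_ : (fun u => _) = fun u => ((fun v => f v - g v) <*> k) u +
   (g <*> (fun v => k v - h v)) u); last first.
  rewrite (convolBl fA gA kB) (convolBr kB hB' gA); apply/funext => u /=.
  by rewrite addrA subrK.
apply: bnd_le (bnd_add (bnd_convol fg kB) (bnd_convol gA kh)).
by apply: le_trans De; nra.
Qed.

Lemma tildeP b u : (exists x a, u = act a (unt x) /\ tilde T b u = (set_val a)^*%C * b x)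
  \/ (~ range (tcirc T) u /\ tilde T b u = 0).
Proof.
rewrite /tilde; case: pselect => [h|n].
  left; case: cid => -[x a] /= ->; exists x, a; split=> //.
  by rewrite act_unt.
by right; split=> // -[xa _ E]; apply: n; exists xa.
Qed.

Lemma range_act x a : range (tcirc T) (act a (unt x)).
Proof. by exists (x, a) => //; rewrite act_unt. Qed.

Lemma tilde_act b a x : tilde T b (act a (unt x)) = (set_val a)^*%C * b x.
Proof.
have [[y [c [+ ->]]]|[n _]] := tildeP b (act a (unt x)).
  by rewrite !act_unt => /tcirc_inj[-> ->].
by case: n; exact: range_act.
Qed.

Lemma tilde_unt b x : tilde T b (unt x) = b x.
Proof. by rewrite -(act_one T (unt x)) tilde_act rmorph1 mul1r. Qed.

Lemma rangeP u : range (tcirc T) u <-> exists a, u = act a (unt (d u)).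
Proof.
split=> [[[x a] _ <-]|[a ->]]; last exact: range_act.
by exists a; rewrite dom_tcirc act_unt.
Qed.

Lemma range_rng_dom u : range (tcirc T) u -> r u = d u.
Proof. by move=> [[x a] _ <-]; rewrite rng_tcirc dom_tcirc. Qed.

Lemma range_proj u : range (tcirc T) u <-> p u = p (unt (d u)).
Proof.
split=> [/rangeP [a {1}->]|]; first by rewrite proj_act.
by move=> /proj_eq [a ua]; apply/rangeP; exists a.
Qed.

Lemma tilde_supp b u : tilde T b u <> 0 -> range (tcirc T) u.
Proof.
by have [[x [a [-> _]]] _|[_ ->]//] := tildeP b u; exact: range_act.
Qed.

Lemma tilde_equivariant b : equivariant T (tilde T b).
Proof.
move=> a u; have [[x [c [-> ->]]]|[n ->]] := tildeP b u.
  by rewrite act_act tilde_act rmorphM mulrA.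
rewrite mulr0; have [[x [c [E _]]]|[_ ->]//] := tildeP b (act a u).
case: n; rewrite -(actK T a u) E act_act; exact: range_act.
Qed.

Lemma QmapE f x : Qmap T f x = f (unt x).
Proof. by rewrite /Qmap tcirc_unt. Qed.

Lemma Qmap_tilde b : Qmap T (tilde T b) = b.
Proof. by apply/funext => x; rewrite QmapE tilde_unt. Qed.

Lemma tilde_Qmap f : equivariant T f -> (forall u, f u <> 0 -> range (tcirc T) u) ->
  tilde T (Qmap T f) = f.
Proof.
move=> ef fs; apply/funext => u.
have [[x [a [-> ->]]]|[n ->]] := tildeP (Qmap T f) u; first by rewrite QmapE ef.
by apply/esym; apply: contrapT => /fs.
Qed.

Lemma BdiagP f : Bdiag T f <-> [/\ equivariant T f,
  forall u, f u <> 0 -> range (tcirc T) u & C0_space (Qmap T f)].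
Proof.
split=> [[b hb <-]|[ef fs hf]].
  by split; [exact: tilde_equivariant|exact: tilde_supp|rewrite Qmap_tilde].
by exists (Qmap T f) => //; exact: tilde_Qmap.
Qed.

Lemma tilde_monomial b : monomial T (tilde T b).
Proof.
split=> u v /tilde_supp hu /tilde_supp hv uv.
  by rewrite (iffLR (range_proj _) hu) (iffLR (range_proj _) hv) uv.
rewrite (iffLR (range_proj _) hu) (iffLR (range_proj _) hv).
by rewrite -!range_rng_dom // uv.
Qed.

Lemma bnd_tilde b (M : R) : 0 <= M -> (forall x, nc (b x) <= M) -> bnd T (tilde T b) M.
Proof.
move=> M0 bM; apply: bnd_monomial => //.
- exact: tilde_equivariant.
- exact: tilde_monomial.
- move=> u; have [[x [a [_ ->]]]|[_ ->]] := tildeP b u; last by rewrite nc0.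
  by rewrite ncM nc_conj nc_circle mul1r.
Qed.

Lemma C0_bounded b : C0_space b -> exists2 M : R, 0 < M & forall y, nc (b y) <= M.
Proof.
move=> [cb vb]; have [K cK Kb] := vb 1 ltr01.
have [M M0 MP] := continuous_bounded cb cK.
exists (M + 1); first exact: addr_gt0.
move=> y; case: (pselect (K y)) => [/MP h|/Kb/ltW h]; apply: (le_trans h).
  by rewrite lerDl.
by rewrite lerDr ltW.
Qed.

Lemma convol_tildel b f : equivariant T f ->
  tilde T b <*> f = fun u => b (r u) * f u.
Proof.
move=> ef; apply/funext => u.
rewrite (@convol_singlel _ _ _ _ T _ _ u (unt (r u))) //.
- by rewrite tilde_unt ginv_unt gmul_unt_l.
- exact: tilde_equivariant.
- by rewrite grng_unt.
- move=> w wu wv; apply: contrapT => /tilde_supp hw; apply: wv.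
  by rewrite (iffLR (range_proj _) hw) -range_rng_dom // wu.
Qed.

Lemma convol_tilder b f : equivariant T f ->
  f <*> tilde T b = fun u => f u * b (d u).
Proof.
move=> ef; apply/funext => u.
rewrite (@convol_singler _ _ _ _ T _ _ u (unt (d u))) //.
- by rewrite tilde_unt quo_unt.
- exact: tilde_equivariant.
- by rewrite gdom_unt.
- move=> w wu wv; apply: contrapT => /tilde_supp hw; apply: wv.
  by rewrite (iffLR (range_proj _) hw) wu.
Qed.

Lemma fstar_tilde b : fstar T (tilde T b) = tilde T (fun x => (b x)^*%C).
Proof.
have e1 := fstar_equivariant (tilde_equivariant b).
rewrite -[LHS]tilde_Qmap //; last first.
  move=> u; rewrite /fstar => nz.
  have /tilde_supp/rangeP [a ua] : tilde T b (ginv gS u) <> 0.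
    by move=> E; apply: nz; rewrite E conjc0.
  by rewrite -(ginvK gS u) ua inv_act ginv_unt; exact: range_act.
congr tilde; apply/funext => x.
by rewrite QmapE /fstar ginv_unt tilde_unt.
Qed.

Lemma tildeD b c : tilde T (fun x => b x + c x) = fun u => tilde T b u + tilde T c u.
Proof.
apply/funext => u; have [[x [a [-> _]]]|[n ->]] := tildeP (fun x => b x + c x) u.
  by rewrite !tilde_act mulrDr.
have [[x [a [E _]]]|[_ ->]] := tildeP b u; first by case: n; rewrite E; exact: range_act.
have [[x [a [E _]]]|[_ ->]] := tildeP c u; first by case: n; rewrite E; exact: range_act.
by rewrite addr0.
Qed.

Lemma tildeZ (z : C) b : tilde T (fun x => z * b x) = fun u => z * tilde T b u.
Proof.
apply/funext => u; have [[x [a [-> _]]]|[n ->]] := tildeP (fun x => z * b x) u.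
  by rewrite !tilde_act mulrCA.
have [[x [a [E _]]]|[_ ->]] := tildeP b u; first by case: n; rewrite E; exact: range_act.
by rewrite mulr0.
Qed.

Lemma tildeM b c : tilde T b <*> tilde T c = tilde T (fun x => b x * c x).
Proof.
rewrite convol_tilder; last exact: tilde_equivariant.
apply/funext => u; have [[x [a [-> _]]]|[n ->]] := tildeP (fun x => b x * c x) u.
  by rewrite !tilde_act dom_act gdom_unt mulrA.
have [[x [a [E _]]]|[_ ->]] := tildeP b u; first by case: n; rewrite E; exact: range_act.
by rewrite mul0r.
Qed.

Lemma compact_cover_open (K : set X) : compact K ->
  exists L, [/\ compact L, open L & K `<=` L].
Proof.
move=> cK; apply: (compact_ideal (I := fun A => exists L, [/\ compact L, open L & A `<=` L]) cK).
- by exists set0; split; [exact: compact0|exact: open0|].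
- move=> A B [L [cL oL AL]] [M [cM oM BM]]; exists (L `|` M); split.
  + exact: compactU.
  + exact: openU.
  + exact: setUSS.
- by move=> A B AB [L [cL oL BL]]; exists L; split=> //; exact: subset_trans AB BL.
- move=> x _; have [L [cL oL Lx _]] := X_nbhs T (@filterT _ (nbhs x) _).
  by exists L; [exact: open_nbhs_nbhs|exists L; split].
Qed.

Lemma C0_intro b K : compact K -> open K -> {within K, continuous b} ->
  (forall y, ~ K y -> b y = 0) -> C0_space b.
Proof.
move=> cK oK cb b0; have [cb' _] := Cc_space_ext T cK oK cb.
rewrite (_ : b = fun y => if y \in K then b y else 0); last first.
  by apply/funext => y; case: ifPn => // /negP yK; apply: b0 => Ky; apply: yK; exact: mem_set.
split=> // e e0; exists K => // y Ky; rewrite memNset // nc0 //.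
Qed.

Definition ind K (y : X) : C := if y \in K then 1 else 0.

Lemma ind1 K y : K y -> ind K y = 1.
Proof. by move=> Ky; rewrite /ind mem_set. Qed.

Lemma ind0 K y : ~ K y -> ind K y = 0.
Proof. by move=> Ky; rewrite /ind memNset. Qed.

Lemma tilde_ind_projection K :
  tilde T (ind K) <*> tilde T (ind K) = tilde T (ind K) /\
  fstar T (tilde T (ind K)) = tilde T (ind K).
Proof.
split; [rewrite tildeM|rewrite fstar_tilde]; congr tilde; apply/funext => y;
  by rewrite /ind; case: ifP; rewrite ?mul1r ?mul0r ?conjc1 ?conjc0.
Qed.

Lemma tilde_idempotent b : tilde T b <*> tilde T b = tilde T b ->
  forall y, b y = 0 \/ b y = 1.
Proof.
move=> bb y; have := congr1 (fun f => f (unt y)) bb; rewrite tildeM !tilde_unt.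
move=> /eqP; rewrite -subr_eq0 -{3}[b y]mulr1 -mulrBr mulf_eq0 subr_eq0.
by move=> /orP[/eqP ->|/eqP ->]; [left|right].
Qed.

Lemma C0_ind K : compact K -> open K -> C0_space (ind K).
Proof.
move=> cK oK; have [cb _] := Cc_space_ext T cK oK
  (@continuous_subspaceT _ _ K _ (@continuous_const _ _ (1 : C))).
by split=> // e e0; exists K => // y Ky; rewrite ind0 // nc0.
Qed.

Lemma C0_add b c : C0_space b -> C0_space c -> C0_space (fun x => b x + c x).
Proof.
move=> [cb vb] [cc vc]; split; first exact: (@continuous_complexD R X _ _ cb cc).
move=> e e0; have e20 : 0 < e / 2 by rewrite divr_gt0.
have [K cK KP] := vb _ e20; have [L cL LP] := vc _ e20.
exists (K `|` L); first exact: compactU.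
move=> x nKL; apply: (le_lt_trans (ncD _ _)); rewrite (splitr e); apply: ltrD.
  by apply: KP => Kx; apply: nKL; left.
by apply: LP => Lx; apply: nKL; right.
Qed.

Lemma C0_mull b c (M : R) : continuous b -> (forall x, nc (b x) <= M) ->
  C0_space c -> C0_space (fun x => b x * c x).
Proof.
move=> cb bM [cc vc]; split; first exact: (@continuous_complexM R X _ _ cb cc).
move=> e e0; have M0 : 0 < `|M| + 1 by rewrite ltr_wpDl.
have [K cK KP] := vc _ (divr_gt0 e0 M0); exists K => // x /KP.
rewrite ltr_pdivlMr // => h; rewrite ncM mulrC; apply: le_lt_trans h.
apply: ler_wpM2l; first exact: nc_ge0.
apply: (le_trans (bM x)); apply: (le_trans (ler_norm _)).
by rewrite lerDl.
Qed.

Lemma C0_mul b c : C0_space b -> C0_space c -> C0_space (fun x => b x * c x).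
Proof.
move=> hb hc; have [M _ MP] := C0_bounded hb; have [cb _] := hb.
exact: (C0_mull cb MP hc).
Qed.

Lemma C0_scale (z : C) b : C0_space b -> C0_space (fun x => z * b x).
Proof.
exact: (@C0_mull (fun=> z) b (nc z) (@continuous_const _ _ z) (fun=> lexx _)).
Qed.

Lemma C0_conj b : C0_space b -> C0_space (fun x => (b x)^*%C).
Proof.
move=> [cb vb]; split; first exact: (@continuous_complex_conj R X _ cb).
by move=> e /vb [K cK KP]; exists K => // x /KP; rewrite nc_conj.
Qed.

Lemma C0_zero : C0_space (fun _ : X => 0 : C).
Proof.
split; first exact: continuous_const.
by move=> e e0; exists set0; [exact: compact0|move=> x _; rewrite nc0].
Qed.

Lemma C0_limit b : (forall e : R, 0 < e ->
    exists2 c, C0_space c & forall x, nc (b x - c x) <= e) -> C0_space b.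
Proof.
move=> H; split.
  apply/continuous_complexP => x e e0.
  have e40 : 0 < e / 4 by rewrite divr_gt0.
  have [c [/continuous_complexP cc _] bc] := H _ e40.
  apply: filterS (cc x _ e40) => y /= xy.
  apply: (le_lt_trans (nc_dist (c x) _ _)).
  have h1 := bc x; have h2 := nc_dist (c y) (c x) (b y); have h3 := bc y.
  rewrite nc_distC in h3; lra.
move=> e e0; have e20 : 0 < e / 2 by rewrite divr_gt0.
have [c [_ vc] bc] := H _ e20; have [K cK KP] := vc _ e20.
exists K => // x /KP h; have h1 := bc x; have := nc_dist (c x) (b x) 0.
by rewrite !subr0; lra.
Qed.

(** Outside a compact open [K] the function [b] is smaller than [e]; its truncation to [K] is a
    generator carried by the bisection of units over [K]. *)
Lemma Cred_tilde b : C0_space b -> Cred T (tilde T b).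
Proof.
move=> hb; apply/CredP; split=> [|e e0]; first exact: tilde_equivariant.
have [cb vb] := hb; have [K0 cK0 K0P] := vb e e0.
have [K [cK oK K0K]] := compact_cover_open cK0.
have hs := sect_unt T cK oK.
have hc : Cc_space (fun y => if y \in K then b y else 0).
  by apply: (Cc_space_ext T) => //; exact: continuous_subspaceT.
exists (elem T K unt (fun y => if y \in K then b y else 0)).
  exact: Cc_twist_elem.
rewrite (_ : (fun u => _) = tilde T (fun y => if y \in K then 0 else b y)).
  apply: bnd_tilde; first exact: ltW.
  move=> x; case: ifPn => [_|/negP nK]; first by rewrite nc0 ltW.
  by apply/ltW/K0P => /K0K Kx; apply: nK; exact: mem_set.
apply/funext => u; rewrite /elem.
have [[x [a [-> ->]]]|[n ->]] := tildeP b u.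
  rewrite tilde_act dom_act gdom_unt; case: ifPn => [|_].
    by rewrite inE => Kx; rewrite Delta_act // subrr mulr0.
  by rewrite mulr0 subr0.
have [[x [a [E _]]]|[_ ->]] := tildeP (fun y => if y \in K then 0 else b y) u.
  by case: n; rewrite E; exact: range_act.
have -> : Delta T (unt @` K) u = 0.
  by apply: contrapT => /(Delta_supp hs)[_ /range_proj].
by rewrite mul0r subr0.
Qed.

Lemma Bdiag_Cred f : Bdiag T f -> Cred T f.
Proof. by move=> [b hb <-]; exact: Cred_tilde. Qed.

Lemma BdiagC f k : Bdiag T f -> Bdiag T k -> f <*> k = k <*> f.
Proof.
move=> [b _ <-] [c _ <-]; rewrite !tildeM; congr tilde.
by apply/funext => x; rewrite mulrC.
Qed.

Lemma Bdiag_convol f k : Bdiag T f -> Bdiag T k -> Bdiag T (f <*> k).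
Proof.
move=> [b hb <-] [c hc <-]; rewrite tildeM.
by exists (fun x => b x * c x) => //; exact: C0_mul.
Qed.

Lemma Bdiag_star f : Bdiag T f -> Bdiag T (fstar T f).
Proof.
move=> [b hb <-]; rewrite fstar_tilde.
by exists (fun x => (b x)^*%C) => //; exact: C0_conj.
Qed.

Lemma Bdiag_abelian : abelian_subalgebra T (Bdiag T).
Proof.
split; last exact: BdiagC.
split.
- by move=> f; exact: Bdiag_Cred.
- split.
    exists (fun=> 0); first exact: C0_zero.
    have := tildeZ 0 (fun=> 0); under eq_fun do rewrite mul0r.
    by move=> ->; apply/funext => u; rewrite mul0r.
  move=> f k [b hb <-] [c hc <-]; rewrite -tildeD.
  by exists (fun x => b x + c x) => //; exact: C0_add.
- move=> z f [b hb <-]; rewrite -tildeZ.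
  by exists (fun x => z * b x) => //; exact: C0_scale.
- by split; [exact: Bdiag_convol|exact: Bdiag_star].
(* Values are dominated by the norm: a limit of elements of B still vanishes off the circle bundle
   of units, and its restriction is a uniform limit of functions of C_0(X). *)
- move=> f hf H; have ef := Cred_equivariant hf.
  have fg (e : R) : 0 < e -> exists2 g, Bdiag T g & forall u, nc (f u - g u) <= e.
    move=> e0; have [g hg hfg] := H e e0; exists g => // u.
    have eg := Cred_equivariant (Bdiag_Cred hg).
    exact: bnd_val u (red_norm_bnd ef eg e0 hfg).
  apply/BdiagP; split=> //.
    move=> u nz; apply: contrapT => nr; apply: nz; apply: nc_lt_eq0 => e e0.
    have [_ [b _ <-] /(_ u)] := fg e e0.
    by have [[x [a [E _]]]|[_ ->]] := tildeP b u;
      [case: nr; rewrite E; exact: range_act|rewrite subr0].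
  apply: C0_limit => e e0; have [_ [b hb <-] H'] := fg e e0.
  exists b => // x; rewrite QmapE -(tilde_unt b x); exact: H'.
Qed.

End reduced_algebra.

(** * Normalizers and separation *)

Section normalizers.
Context (R : realType) (X G Sigma : topologicalType).
Variable T : twisted_boolean_groupoid R X G Sigma.
Local Notation C := R[i].
Local Notation nc := (@ComplexField.Normc.normc R).
Local Notation gG := (tgrp T).
Local Notation gS := (text T).
Local Notation p := (tproj T).
Local Notation r := (grng gS).
Local Notation d := (gdom gS).
Local Notation act := (tact T).
Local Notation unt := (gunt gS).
Local Notation "f <*> k" := (convol T f k) (at level 40, left associativity).
Local Notation "f ^st" := (fstar T f) (at level 2, format "f ^st").
Local Notation De := (fun K s => Delta T (s @` K)).
Implicit Types (u v w f k g : Sigma -> C) (x y z : X) (a : circle R) (b c : X -> C).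
Implicit Types (K L : set X) (s t : X -> Sigma) (sg tau : Sigma).

Lemma fstarE f sg : f^st sg = (f (ginv gS sg))^*%C.
Proof. by []. Qed.

Local Opaque fstar convol tilde Delta Cred.

Lemma Cred_convolA f k g : Cred T f -> Cred T k -> Cred T g ->
  f <*> (k <*> g) = f <*> k <*> g.
Proof.
move=> /Cred_bnd [A fA] /Cred_bnd [B kB] /Cred_bnd [D gD].
exact: convolA fA kB gD.
Qed.

Lemma Cred_fstar_convol f k : Cred T f -> Cred T k -> (f <*> k)^st = k^st <*> f^st.
Proof.
move=> /Cred_bnd [A fA] /Cred_bnd [B kB]; exact: fstar_convol fA kB.
Qed.

Lemma convol_dom0 f k x : Cred T f -> Cred T k ->
  (forall sg, d sg = x -> k sg = 0) -> forall sg, d sg = x -> (f <*> k) sg = 0.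
Proof.
move=> /Cred_equivariant ef /Cred_equivariant ek k0 sg sx.
rewrite (@convol_singler _ _ _ _ T f k sg sg) //; first by rewrite k0 ?mulr0.
by move=> w wsg _; rewrite k0 // wsg.
Qed.

Lemma PIN_Cred u : PIN T u -> Cred T u. Proof. by case. Qed.

Lemma PIN_starl u : PIN T u -> u <*> (u^st <*> u) = u.
Proof.
by move=> [hu uuu _ _ _]; rewrite (Cred_convolA hu (Cred_star hu) hu).
Qed.

Lemma PIN_star u : PIN T u -> PIN T (u^st).
Proof.
move=> [hu uuu [h1 h2] h3 h4]; have hs := Cred_star hu.
have uus := Cred_convol hu hs.
split; [exact: hs| |rewrite fstarK; split; [exact: h2|exact: h1]
  |rewrite fstarK; exact: h4|rewrite fstarK; exact: h3].
have := congr1 (fstar T) uuu.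
by rewrite (Cred_fstar_convol uus hu) (Cred_fstar_convol hu hs) (fstarK T u) (Cred_convolA hs hu hs).
Qed.

(** In [u w w^st u^st u w] the projections [w w^st] and [u^st u] lie in B and commute, which
    collapses the product to [u w]. Normalization of B is applied once for each factor. *)
Lemma PIN_mul u w : PIN T u -> PIN T w -> PIN T (u <*> w).
Proof.
move=> Pu Pw; have [hu uuu [u1 u2] u3 u4] := Pu; have [hw www [w1 w2] w3 w4] := Pw.
have hus := Cred_star hu; have hws := Cred_star hw.
have cC f k : Cred T f -> Cred T k -> Cred T (f <*> k) by exact: Cred_convol.
have hA := cC _ _ hw hws; have hB := cC _ _ hus hu.
split; rewrite ?(Cred_fstar_convol hu hw).
- exact: cC.
- rewrite (Cred_convolA (cC _ _ hu hw) hws hus) -(Cred_convolA hu hw hws).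
  rewrite (Cred_convolA (cC _ _ (cC _ _ hu hA) hus) hu hw) -(Cred_convolA (cC _ _ hu hA) hus hu).
  rewrite -(Cred_convolA hu hA hB) (BdiagC w2 u1) (Cred_convolA hu hB hA) -(Cred_convolA (cC _ _ hu hB) hA hw).
  by rewrite www (PIN_starl Pu).
- split.
    rewrite (Cred_convolA (cC _ _ hws hus) hu hw) -(Cred_convolA hws hus hu); exact: w4.
  rewrite (Cred_convolA (cC _ _ hu hw) hws hus) -(Cred_convolA hu hw hws); exact: u3.
- move=> b hb; have cb := Bdiag_Cred hb.
  rewrite (Cred_convolA (cC _ _ (cC _ _ hu hw) cb) hws hus) -(Cred_convolA hu hw cb).
  by rewrite -(Cred_convolA hu (cC _ _ hw cb) hws); apply: u3; exact: w3.
- move=> b hb; have cb := Bdiag_Cred hb.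
  rewrite (Cred_convolA (cC _ _ (cC _ _ hws hus) cb) hu hw) -(Cred_convolA hws hus cb).
  by rewrite -(Cred_convolA hws (cC _ _ hus cb) hu); apply: w4; exact: u4.
Qed.

(** [u^st u] read on the unit space. For [u] in PIN(B) it is the characteristic function of dom(u),
    by [supp_fun1] and [supp_fun01]. *)
Definition supp_fun u x := Qmap T (u^st <*> u) x.

Lemma star_mul_tilde u : PIN T u -> u^st <*> u = tilde T (supp_fun u) /\ C0_space (supp_fun u).
Proof.
by move=> [hu _ [/BdiagP [e1 e2 e3] _] _ _]; split=> //; rewrite tilde_Qmap.
Qed.

Lemma supp_funE u sg : PIN T u -> u sg * supp_fun u (d sg) = u sg.
Proof.
move=> Pu; have := PIN_starl Pu; rewrite (star_mul_tilde Pu).1.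
rewrite convol_tilder; last exact: Cred_equivariant (PIN_Cred Pu).
by move=> /(congr1 (fun f => f sg)).
Qed.

Lemma supp_fun1 u sg : PIN T u -> u sg <> 0 -> supp_fun u (d sg) = 1.
Proof.
by move=> Pu /eqP nz; apply: (mulfI nz); rewrite supp_funE // mulr1.
Qed.

Lemma supp_fun0 u x : Cred T u -> (forall sg, d sg = x -> u sg = 0) -> supp_fun u x = 0.
Proof.
move=> hu u0; rewrite /supp_fun QmapE.
exact: (convol_dom0 (Cred_star hu) hu u0 (gdom_unt gS x)).
Qed.

(** From [u = u u^st u], a nonzero value of [u] over [x] forces the value 1 of [u^st u] at [x]; if
    [u] vanishes over [x], so does [u^st u]. *)
Lemma pin_domP u x : PIN T u -> pin_dom T u x <-> exists2 sg, d sg = x & u sg <> 0.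
Proof.
move=> Pu; split=> [ux|[sg <- nz]]; last exact: supp_fun1.
apply: contrapT => n; have u0 sg : d sg = x -> u sg = 0.
  by move=> sx; apply: contrapT => nz; apply: n; exists sg.
have : supp_fun u x = 1 := ux.
by rewrite (supp_fun0 (PIN_Cred Pu) u0) => /esym/eqP; rewrite oner_eq0.
Qed.

Lemma supp_fun01 u x : PIN T u -> ~ pin_dom T u x -> supp_fun u x = 0.
Proof.
move=> Pu nx; apply: (supp_fun0 (PIN_Cred Pu)).
move=> sg sx; apply: contrapT => nz; apply: nx; apply: (iffRL (pin_domP x Pu)).
by exists sg.
Qed.

Lemma nbhs_01 c x : continuous c -> (forall y, c y = 0 \/ c y = 1) ->
  nbhs x [set y | c y = c x].
Proof.
move=> /continuous_complexP cc c01.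
apply: filterS (cc x 1 ltr01) => y /=.
by case: (c01 x) => ->; case: (c01 y) => -> //;
  rewrite ?sub0r ?subr0 ?ncN nc1 ltxx.
Qed.

Lemma pin_dom_nbhs u x : PIN T u -> nbhs x [set y | supp_fun u y = supp_fun u x].
Proof.
move=> Pu; apply: nbhs_01; first by have [_ []] := star_mul_tilde Pu.
move=> y; case: (pselect (pin_dom T u y)) => uy; first by right.
by left; exact: supp_fun01.
Qed.

Lemma pin_dom_open u : PIN T u -> open (pin_dom T u).
Proof.
move=> Pu; rewrite openE => x ux; rewrite /interior.
by apply: filterS (pin_dom_nbhs x Pu) => y /= E; rewrite /pin_dom /= -ux; exact: E.
Qed.

Lemma pin_dom_compact u : PIN T u -> compact (pin_dom T u).
Proof.
move=> Pu; have [_ [_ /(_ 1 ltr01) [K cK KP]]] := star_mul_tilde Pu.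
apply: (subclosed_compact _ cK); last first.
  move=> x ux; apply: contrapT => /KP.
  by rewrite (ux : supp_fun u x = 1) nc1 ltxx.
rewrite -(setCK (pin_dom T u)); apply: open_closedC.
rewrite openE => x nx; rewrite /interior.
apply: filterS (pin_dom_nbhs x Pu) => y /= E uy.
have : supp_fun u y = 1 := uy; rewrite E (supp_fun01 Pu nx).
by move/esym/eqP; rewrite oner_eq0.
Qed.

Lemma convol_Delta f K s sg : equivariant T f -> sect T K s -> K (d sg) ->
  (f <*> De K s) sg = f (quo gS sg (s (d sg))).
Proof.
move=> ef hs Kd; have := @convol_elem _ _ _ _ T f K s (fun=> 1) sg ef hs Kd.
rewrite mulr1 (_ : elem T K s _ = De K s) //.
by apply/funext => tau; rewrite /elem mulr1.
Qed.

Lemma convol_Delta0 f K s sg : equivariant T f -> sect T K s -> ~ K (d sg) ->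
  (f <*> De K s) sg = 0.
Proof.
move=> ef hs Kd; have := @convol_elem0 _ _ _ _ T f K s (fun=> 1) sg ef hs Kd.
rewrite (_ : elem T K s _ = De K s) //.
by apply/funext => tau; rewrite /elem mulr1.
Qed.

Lemma Cred_Delta K s : sect T K s -> Cred T (De K s).
Proof.
move=> hs; apply: Cred_Cc; have [cK oK _ _ _] := hs.
have hc := Cc_space_ext T cK oK
  (@continuous_subspaceT _ _ K _ (@continuous_const R X (1 : C))).
rewrite (_ : De K s = elem T K s (fun y => if y \in K then 1 else 0)).
  exact: Cc_twist_elem.
apply/funext => sg; rewrite /elem; case: (pselect (De K s sg = 0)) => [->|nz].
  by rewrite mul0r.
by have [Kd _] := Delta_supp hs nz; rewrite mem_set // mulr1.
Qed.

Lemma star_Delta K s L t : sect T K s -> sect T L t ->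
  (forall y, K y -> L (r (s y)) /\ t (r (s y)) = ginv gS (s y)) ->
  (forall z, L z -> exists2 y, K y & z = r (s y)) -> (De K s)^st = De L t.
Proof.
move=> hs ht tK LK; apply/funext => sg; rewrite fstarE.
have [[z [a [Lz -> ->]]]|[n ->]] := DeltaP sg ht.
  have [y Ky ->] := LK z Lz; have [_ ->] := tK y Ky.
  by rewrite inv_act ginvK Delta_act // conjcK.
have [[y [a [Ky E _]]]|[_ ->]] := DeltaP (ginv gS sg) hs; last by rewrite conjc0.
have [Ly ty] := tK y Ky; case: (n _ Ly).
by rewrite ty -(ginvK gS sg) E inv_act proj_act.
Qed.

Lemma Delta_dom K s : sect T K s -> De K s <*> tilde T (ind R K) = De K s.
Proof.
move=> hs; rewrite convol_tilder; last exact: Delta_equivariant.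
apply/funext => sg; case: (pselect (De K s sg = 0)) => [->|nz].
  by rewrite mul0r.
by have [Kd _] := Delta_supp hs nz; rewrite ind1 // mulr1.
Qed.

(** Conjugation by [Delta_S] transports [b] along the partial homeomorphism [r \o s]. Multiplication
    by the inverse bisection leaves a single term, and both factors being nonzero forces the
    argument over a unit. *)
Lemma Delta_conj_aux K s b : sect T K s -> C0_space b ->
  Bdiag T (De K s <*> tilde T b <*> (De K s)^st) /\
  forall y, K y -> Qmap T (De K s <*> tilde T b <*> (De K s)^st) (r (s y)) = b y.
Proof.
move=> hs hb; have [L [t [ht tK LK]]] := sect_inv hs.
have [beta [bK cb]] := sect_rng_inv hs.
have [cK oK cs ds rs] := hs.
rewrite (star_Delta hs ht tK LK).
have eD := Delta_equivariant hs.
set f := De K s <*> tilde T b; have ef : equivariant T f.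
  by apply: convol_equivariant => //; exact: tilde_equivariant.
have fE tau : f tau = De K s tau * b (d tau) by rewrite /f convol_tilder.
have val sg y : K y -> d sg = r (s y) ->
    (f <*> De L t) sg = De K s (gmul gS sg (s y)) * b y.
  move=> Ky dy; have [Ly ty] := tK y Ky.
  rewrite convol_Delta ?dy // ty /quo ginvK fE gdom_mul //.
  by rewrite ds.
have Qval y : K y -> Qmap T (f <*> De L t) (r (s y)) = b y.
  move=> Ky; rewrite QmapE (val _ y) ?gdom_unt // gmul_unt_l Delta_sect //.
  by rewrite mul1r.
split=> //; apply/BdiagP; split.
- by apply: convol_equivariant => //; exact: Delta_equivariant.
- move=> sg nz; case: (pselect (L (d sg))) => [/LK [y Ky dy]|nL]; last first.
    by case: nz; rewrite convol_Delta0.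
  have : De K s (gmul gS sg (s y)) <> 0.
    by move=> E; apply: nz; rewrite (val _ y) // E mul0r.
  move=> /(Delta_supp hs)[_]; rewrite gdom_mul // ds // => E.
  have dd : d (gmul gS sg (s y)) = d (s y) by rewrite gdom_mul.
  have sgE : quo gS (gmul gS sg (s y)) (s y) = sg by rewrite /quo gmulKr.
  have := proj_quo dd; rewrite sgE E quo_self => psg.
  by apply/range_proj; rewrite psg tproj_unt dy (tproj_rng T).
- have [cL oL _ _ _] := ht; apply: (C0_intro T cL oL); last first.
    by move=> z nL; rewrite QmapE convol_Delta0 // gdom_unt.
  have [/continuous_complexP cbb _] := hb; have /within_continuousP cb' := cb.
  apply/within_continuousP => z Lz N /nbhs_complexP [e e0 eN].
  have zK : ((r \o s) @` K) z by have [y Ky ->] := LK z Lz; exists y.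
  apply: filterS (cb' z zK _ (cbb _ _ e0)) => z' /= h Lz'; apply: eN.
  have [y Ky zy] := LK z Lz; have [y' Ky' zy'] := LK z' Lz'.
  have := h (ex_intro2 _ _ y' Ky' (esym zy')).
  by rewrite zy zy' !bK // !Qval.
Qed.

Lemma PIN_Delta K s : sect T K s -> PIN T (De K s).
Proof.
move=> hs; have [cK oK cs ds rs] := hs.
have mulP K' s' : sect T K' s' -> Bdiag T (De K' s' <*> (De K' s')^st) /\
    forall y, K' y -> Qmap T (De K' s' <*> (De K' s')^st) (r (s' y)) = 1.
  move=> hs'; have [cK' oK' _ _ _] := hs'.
  have [h1 h2] := Delta_conj_aux hs' (C0_ind T cK' oK').
  rewrite Delta_dom // in h1 h2; split=> // y Ky; rewrite h2 //.
  exact: ind1.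
have [L [t [ht tK LK]]] := sect_inv hs.
have sE := star_Delta hs ht tK LK.
(* [Delta_S] is the adjoint of the function of the inverse bisection, so the clauses about [u^st]
   are those about [u] for that bisection. *)
have sE' : De K s = (De L t)^st by rewrite -sE (fstarK T).
have [hB hQ] := mulP _ _ hs.
split.
- exact: Cred_Delta.
- have [e1 e2 _] := iffLR (BdiagP _ _) hB.
  rewrite -[X in X <*> _](tilde_Qmap e1 e2) convol_tildel; last exact: Delta_equivariant.
  apply/funext => sg; case: (pselect (De K s sg = 0)) => [->|nz].
    by rewrite mulr0.
  have [Kd pd] := Delta_supp hs nz.
  have -> : r sg = r (s (d sg)) by rewrite -!(tproj_rng T) pd.
  by rewrite hQ // mul1r.
- by split=> //; rewrite {2}sE' sE; exact: (mulP _ _ ht).1.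
- by move=> _ [b hb <-]; exact: (Delta_conj_aux hs hb).1.
- by move=> _ [b hb <-]; rewrite {2}sE' sE; exact: (Delta_conj_aux ht hb).1.
Qed.

Lemma star_Delta_convol K s u sg : Cred T u -> sect T K s -> K (r sg) ->
  ((De K s)^st <*> u) sg = u (gmul gS (s (r sg)) sg).
Proof.
move=> hu hs Kr; have [cK oK cs ds rs] := hs.
have e1 := Cred_equivariant (Cred_star hu).
have -> : (De K s)^st <*> u = (u^st <*> De K s)^st.
  by rewrite (Cred_fstar_convol (Cred_star hu) (Cred_Delta hs)) (fstarK T u).
rewrite fstarE convol_Delta ?gdom_inv //.
rewrite fstarE conjcK inv_quo ?gdom_inv ?ds //.
by rewrite /quo ginvK.
Qed.

(** The projection is the indicator of [K]; as [K] is clopen, cutting by it preserves continuity. *)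
Lemma germ_trivial_intro u K x : equivariant T u -> compact K -> open K -> K x ->
  (forall sg, K (d sg) -> u sg <> 0 -> range (tcirc T) sg) ->
  {within K, continuous (u \o unt)} -> germ_trivial T u x.
Proof.
move=> eu cK oK Kx us /within_continuousP cu; have hK := C0_ind T cK oK.
exists (tilde T (ind R K)); split; [by exists (ind R K)|exact: tilde_ind_projection| |].
  by rewrite Qmap_tilde ind1.
rewrite (convol_tilder _ eu); apply/BdiagP; split.
- by move=> a sg; rewrite eu dom_act mulrA.
- move=> sg nz; case: (pselect (K (d sg))) => Kd; last first.
    by case: nz; rewrite ind0 // mulr0.
  by apply: us => // E; apply: nz; rewrite E mul0r.
- apply: (C0_intro T cK oK); last first.
    by move=> y nK; rewrite QmapE gdom_unt ind0 // mulr0.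
  apply/within_continuousP => y Ky N; rewrite QmapE gdom_unt ind1 // mulr1 => nN.
  apply: filterS (cu y Ky N nN) => z /= h Kz.
  by rewrite QmapE gdom_unt ind1 // mulr1; exact: h.
Qed.

Lemma Bis_to_separating : PIN_eq_Bis T -> Q_separating T.
Proof.
move=> H u x Pu ux nt; apply: contrapT => Qnz; apply: nt.
have [S [/(BisP T) [K [s [hs SE]]] uE]] : exists S, Bis T S /\ u = Delta T S.
  by have [S hS uS] := H u Pu; exists S.
have eD := Delta_equivariant hs.
have [cK oK cs ds rs] := hs.
move: Qnz; rewrite QmapE uE SE => Qnz.
have [Kx px] := Delta_supp hs Qnz; rewrite gdom_unt in Kx px.
have rx : range (tcirc T) (s x) by apply/range_proj; rewrite ds.
have [L [cL oL Lx LK]] := X_nbhs T (sect_nbhs hs Kx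
  (open_nbhs_nbhs (conj (range_tcirc_open T) rx))).
apply: (germ_trivial_intro eD cL oL Lx).
  move=> sg Ld nz; have [Kd pd] := Delta_supp hs nz.
  have [_ /range_proj] := LK _ Ld; rewrite ds // -pd.
  by move/range_proj.
(* Over [L] the bisection runs inside the circle bundle of units, and [Delta_S] at a unit is the
   phase of [s y], continuous by [cocycle_nbhs]. *)
have val y : L y -> exists2 a, s y = act a (unt y) &
    Delta T (s @` K) (unt y) = set_val a.
  move=> Ly; have [Ky /rangeP [a sa]] := LK y Ly.
  rewrite ds // in sa; exists a => //.
  by rewrite -(actK T a (unt y)) -sa Delta_act // conjcK.
apply/within_continuousP => y Ly N; have [a sa /= ->] := val y Ly.
move=> /nbhs_complexP [e e0 eN].
have [U [V [nU nV UV]]] := cocycle_nbhs sa e0.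
have [Ky _] := LK y Ly.
apply: filterS2 (sect_nbhs hs Ky nU) (unt_continuous nV).
move=> y' [_ Uy'] /= Vy' Ly'; apply: eN.
by have [a' sa' ->] := val y' Ly'; exact: (UV (s y') (unt y')).
Qed.

(** * Elements of PIN(B) as bisections when Q is separating *)

Section separating.
Hypothesis sep : Q_separating T.

Lemma PIN_local u x : PIN T u -> pin_dom T u x -> exists L s, [/\ sect T L s, L x,
  forall y, L y -> u (s y) = 1 &
  forall sg, L (d sg) -> u sg <> 0 -> p sg = p (s (d sg))].
Proof.
move=> Pu ux; have hu := PIN_Cred Pu; have eu := Cred_equivariant hu.
have [sg0 ds0 nz0] := iffLR (pin_domP x Pu) ux.
have [K [s [hs Ks ps _]]] := @sect_through _ _ _ _ T (p sg0) setT filterT.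
rewrite (tproj_dom T) ds0 in Ks ps.
have [cK oK cs ds rs] := hs.
have nzs : u (s x) <> 0.
  have [a ->] := proj_eq ps; rewrite eu => /eqP; rewrite mulf_eq0 conjc_eq0.
  move=> /orP[/eqP a0|/eqP //]; have := nc_circle a; rewrite a0 nc0 => /eqP.
  by rewrite eq_sym oner_eq0.
pose w := De K s; pose v := w^st <*> u.
have Pw : PIN T w by exact: PIN_Delta.
have Pws := PIN_star Pw.
have Pv : PIN T v by exact: PIN_mul.
have hw := PIN_Cred Pw; have hws := PIN_Cred Pws; have hus := Cred_star hu.
have hv := PIN_Cred Pv; have ev := Cred_equivariant hv.
have vE sg : K (r sg) -> v sg = u (gmul gS (s (r sg)) sg).
  by move=> Kr; exact: star_Delta_convol.
have vunt y : K y -> v (unt y) = u (s y).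
  move=> Ky; rewrite vE ?grng_unt //; congr (u _).
  by have := gmul_unt_r gS (s y); rewrite ds.
have vx : v (unt x) <> 0 by rewrite vunt.
have domv : pin_dom T v x by apply/pin_domP => //; exists (unt x); rewrite ?gdom_unt.
have [e [[e0 he0 eE] [ee _] Qe ve]] : germ_trivial T v x.
  by apply: contrapT => nt; apply: vx; rewrite -QmapE; exact: sep Pv domv nt.
rewrite -eE Qmap_tilde in Qe; rewrite -eE in ee ve.
have ne := nbhs_01 x (proj1 he0) (tilde_idempotent ee).
have [L [cL oL Lx LP]] := X_nbhs T
  (filterI (filterI (open_nbhs_nbhs (conj oK Ks)) ne)
    (filterI (open_nbhs_nbhs (conj (pin_dom_open Pu) ux))
             (open_nbhs_nbhs (conj (pin_dom_open Pv) domv)))).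
have LK : L `<=` K by move=> y /LP[[]].
have ve1 sg : L (d sg) -> (v <*> tilde T e0) sg = v sg.
  by move=> /LP [[_ /= E] _]; rewrite convol_tilder // E Qe mulr1.
have [_ ves [cQ _]] := iffLR (BdiagP _ _) ve.
(* Triviality of the germ of [v] controls [u] only at arrows whose range meets that of the
   bisection; the identity [key] excludes all others over [L]. *)
have usupp sg : L (d sg) -> u sg <> 0 -> p sg = p (s (d sg)).
  move=> Ld nz; have [_ [_ /= dv]] := LP _ Ld.
  have cww := Cred_convol hw hws; have cuu := Cred_convol hu hus.
  have cuu' := Cred_convol hus hu.
  have Bww : Bdiag T (w <*> w^st) by case: Pw => _ _ [].
  have Buu : Bdiag T (u <*> u^st) by case: Pu => _ _ [].
  have vv : v^st <*> v = u^st <*> (w <*> w^st) <*> u.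
    rewrite /v (Cred_fstar_convol hws hu) (fstarK T w).
    rewrite -(Cred_convolA hus cww hu) -(Cred_convolA hw hws hu).
    by rewrite -(Cred_convolA hus hw (Cred_convol hws hu)).
  (* [u v^st v] equals [u u^st w w^st u], and the two projections commute inside B. *)
  have key : w <*> w^st <*> u = u <*> (v^st <*> v).
    have [_ uuu _ _ _] := Pu; rewrite vv.
    rewrite (Cred_convolA hu (Cred_convol hus cww) hu) (Cred_convolA hu hus cww).
    by rewrite (BdiagC Buu Bww) -(Cred_convolA cww cuu hu) uuu.
  have [eB sB _] := iffLR (BdiagP _ _) Bww.
  have := congr1 (fun f => f sg) key.
  rewrite -(tilde_Qmap eB sB) convol_tildel // (star_mul_tilde Pv).1 convol_tilder //.
  rewrite [supp_fun v (d sg)]dv mulr1 => E.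
  have [y Ky ry] : exists2 y, K y & r sg = r (s y).
    apply: contrapT => ny; apply: nz; rewrite -E.
    suff -> : Qmap T (w <*> w^st) (r sg) = 0 by rewrite mul0r.
    rewrite QmapE; apply: (convol_dom0 (x := r sg)) => //; last by rewrite gdom_unt.
    move=> tau tr; rewrite fstarE; suff -> : w (ginv gS tau) = 0 by exact: conjc0.
    apply: contrapT => /(Delta_supp hs) [Kd pd]; apply: ny.
    exists (d (ginv gS tau)) => //.
    by rewrite -(tproj_rng T (s _)) -pd (tproj_rng T) grng_inv tr.
  (* [v tau = u sg] is nonzero, so [tau] lies over a unit; hence [y = d sg] and [sg] is in the orbit
     of [s y]. *)
  pose tau := gmul gS (ginv gS (s y)) sg.
  have c1 : d (ginv gS (s y)) = r sg by rewrite gdom_inv.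
  have rt : r tau = y by rewrite grng_mul // grng_inv ds.
  have dt : d tau = d sg by rewrite gdom_mul.
  have st : gmul gS (s y) tau = sg by rewrite /tau gmulKl.
  have vt : v tau = u sg by rewrite vE ?rt // st.
  have nzt : (v <*> tilde T e0) tau <> 0 by rewrite ve1 ?dt // vt.
  have rgt := ves _ nzt.
  have yd : y = d sg by rewrite -rt range_rng_dom.
  have ptau : p tau = gunt gG y by rewrite (iffLR (range_proj T _) rgt) tproj_unt dt yd.
  have gy : gdom gG (p (s y)) = y by rewrite (tproj_dom T) ds.
  rewrite -yd -{1}st tproj_mul ?ds ?rt // ptau -{2}gy.
  exact: gmul_unt_r.
(* By [usupp] the sum for [u^st u] at [y] has the single term [|u (s y)|^2], and its value is 1 on
   dom(u). *)
have us1 y : L y -> nc (u (s y)) = 1.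
  move=> Ly; have Ky := LK y Ly; have [_ [uy _]] := LP y Ly.
  have : supp_fun u y = 1 := uy.
  rewrite /supp_fun QmapE (@convol_singler _ _ _ _ T _ _ (unt y) (s y)) //.
  - rewrite fstarE inv_quo ?gdom_unt ?ds //.
    have -> : quo gS (s y) (unt y) = s y by rewrite -{2}(ds y) // quo_unt.
    rewrite mulrC nc_sqr => -[E]; apply/eqP.
    by rewrite -(@eqrXn2 _ 2) ?nc_ge0 // E expr1n.
  - exact: fstar_equivariant.
  - by rewrite gdom_unt ds.
  - move=> sg; rewrite gdom_unt => dsg psg; apply: contrapT => nz.
    by apply: psg; rewrite -{1}dsg; apply: usupp => //; rewrite dsg.
(* Moving [s y] by the phase [u (s y)] multiplies the value of [u] by the conjugate phase, making it
   1; where the modulus is not 1 the phase defaults to 1. *)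
pose th y : circle R := if pselect (nc (u (s y)) = 1) is left h then mk_circle h
  else circle_one R.
have thE y : L y -> set_val (th y) = u (s y).
  by move=> /us1 h; rewrite /th; case: pselect.
have cth : {within L, continuous th}.
  apply/within_continuousP => y Ly N /nbhs_circleP [e1 e10 eN].
  have := iffLR (continuous_complexP _) cQ y _ e10.
  apply: filterS => z /= + Lz; rewrite !QmapE !ve1 ?gdom_unt //.
  rewrite !vunt; try exact: LK.
  by move=> h; apply: eN; rewrite !thE.
have hsL := sect_sub hs cL oL LK.
exists L, (fun y => act (th y) (s y)); split=> //.
- exact: sect_act.
- by move=> y Ly; rewrite eu thE // mulrC nc_sqr us1 // expr1n.
- by move=> sg Ld nz; rewrite proj_act; exact: usupp.
Qed.

(** Over one source the support of [u] is a single orbit, and by equivariance and freeness [u] takes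
    the value 1 at most once on an orbit. *)
Lemma PIN_unique u sg tau : PIN T u -> u sg = 1 -> u tau = 1 -> d sg = d tau -> sg = tau.
Proof.
move=> Pu us ut st; have nz : u sg <> 0 by rewrite us; exact/eqP/oner_neq0.
have nzt : u tau <> 0 by rewrite ut; exact/eqP/oner_neq0.
have eu := Cred_equivariant (PIN_Cred Pu).
have [|L [s [hs Ls _ usupp]]] := @PIN_local u (d sg) Pu.
  by apply/pin_domP => //; exists sg.
have [a sa] : exists a, sg = act a tau.
  by apply: proj_eq; rewrite (usupp sg Ls nz) (usupp tau) -?st.
move: us; rewrite sa eu ut mulr1 => a1.
have -> : a = circle_one R.
  by apply: circle_inj; rewrite -[LHS]conjcK a1 conjc1.
exact: act_one.
Qed.

Lemma separating_to_Bis : PIN_eq_Bis T.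
Proof.
move=> u Pu; have eu := Cred_equivariant (PIN_Cred Pu).
have one0 : (1 : C) <> 0 by exact/eqP/oner_neq0.
have /choice [s sP] : forall y, exists sg, pin_dom T u y -> u sg = 1 /\ d sg = y.
  move=> y; case: (pselect (pin_dom T u y)) => uy; last by exists (unt y).
  have [L [s [hs Ly us1 _]]] := PIN_local Pu uy; exists (s y) => _.
  by have [_ _ _ ds _] := hs; rewrite us1 // ds.
have hs : sect T (pin_dom T u) s.
  split; [exact: pin_dom_compact|exact: pin_dom_open| | |].
  - apply/within_continuousP => y uy N nN.
    have [L [s' [hs' Ly us1 _]]] := PIN_local Pu uy.
    have [_ _ _ ds' _] := hs'.
    have ss z : pin_dom T u z -> L z -> s z = s' z.
      move=> uz Lz; have [h1 h2] := sP z uz.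
      by apply: (PIN_unique Pu) => //; rewrite ?us1 // ds'.
    rewrite ss // in nN.
    apply: filterS (sect_nbhs hs' Ly nN) => z [Lz Nz] uz.
    by rewrite ss.
  - by move=> y /sP[].
  - move=> y y' uy uy' rr; have [h1 h2] := sP y uy; have [h1' h2'] := sP y' uy'.
    (* Ranges are sources of inverses, so uniqueness for [u^st] yields injectivity of the range map
       on the section. *)
    have E : ginv gS (s y) = ginv gS (s y').
      apply: (PIN_unique (PIN_star Pu)).
      - by rewrite fstarE ginvK h1 conjc1.
      - by rewrite fstarE ginvK h1' conjc1.
      - by rewrite !gdom_inv.
    by rewrite -h2 -h2' -(ginvK gS (s y)) E ginvK.
exists (s @` pin_dom T u); first by apply: (iffRL (BisP T _)); exists (pin_dom T u), s.
apply/funext => sg.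
have [[y [a [uy -> ->]]]|[n ->]] := DeltaP sg hs.
  by have [h1 _] := sP y uy; rewrite eu h1 mulr1.
apply: contrapT => nz.
have ud : pin_dom T u (d sg) by apply/pin_domP => //; exists sg.
have [L [s' [hs' Ld us1 usupp]]] := PIN_local Pu ud.
have [h1 h2] := sP _ ud; apply: (n _ ud).
rewrite usupp //; apply/esym; rewrite -{2}h2; apply: usupp; rewrite ?h2 //.
by rewrite h1.
Qed.

End separating.

End normalizers.

(** * Maximal abelian subalgebras *)

Section masa.
Context (R : realType) (X G Sigma : topologicalType).
Variable T : twisted_boolean_groupoid R X G Sigma.
Local Notation C := R[i].
Local Notation nc := (@ComplexField.Normc.normc R).
Local Notation gG := (tgrp T).
Local Notation gS := (text T).
Local Notation p := (tproj T).
Local Notation r := (grng gS).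
Local Notation d := (gdom gS).
Local Notation act := (tact T).
Local Notation unt := (gunt gS).
Local Notation "f <*> k" := (convol T f k) (at level 40, left associativity).
Local Notation "f ^st" := (fstar T f) (at level 2, format "f ^st").
Implicit Types (u v w f k g h : Sigma -> C) (x y z : X).
Implicit Types (K L : set X) (sg tau : Sigma).

Local Opaque fstar convol tilde Delta Cred.

Lemma convol_add_r f k g : Cred T f -> Cred T k -> Cred T g ->
  g <*> (fun sg => f sg + k sg) = fun sg => (g <*> f) sg + (g <*> k) sg.
Proof.
move=> /Cred_bnd [A fA] /Cred_bnd [B kB] /Cred_bnd [D gD].
exact: convolDr fA kB gD.
Qed.

Lemma convol_add_l f k g : Cred T f -> Cred T k -> Cred T g ->
  (fun sg => f sg + k sg) <*> g = fun sg => (f <*> g) sg + (k <*> g) sg.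
Proof.
move=> /Cred_bnd [A fA] /Cred_bnd [B kB] /Cred_bnd [D gD].
exact: convolDl fA kB gD.
Qed.

Lemma convol_scale_r (l : C) f g : Cred T f -> Cred T g ->
  g <*> (fun sg => l * f sg) = fun sg => l * (g <*> f) sg.
Proof. by move=> /Cred_bnd [A fA] /Cred_bnd [D gD]; exact: convolZr fA gD. Qed.

Lemma convol_scale_l (l : C) f g : Cred T f -> Cred T g ->
  (fun sg => l * f sg) <*> g = fun sg => l * (f <*> g) sg.
Proof. by move=> /Cred_bnd [A fA] /Cred_bnd [D gD]; exact: convolZl fA gD. Qed.

Lemma convol_sub_r f k g : Cred T f -> Cred T k -> Cred T g ->
  g <*> (fun sg => f sg - k sg) = fun sg => (g <*> f) sg - (g <*> k) sg.
Proof.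
move=> /Cred_bnd [A fA] /Cred_bnd [B kB] /Cred_bnd [D gD].
exact: convolBr fA kB gD.
Qed.

Lemma convol_sub_l f k g : Cred T f -> Cred T k -> Cred T g ->
  (fun sg => f sg - k sg) <*> g = fun sg => (f <*> g) sg - (k <*> g) sg.
Proof.
move=> /Cred_bnd [A fA] /Cred_bnd [B kB] /Cred_bnd [D gD].
exact: convolBl fA kB gD.
Qed.

Lemma commute_Bdiag_star u : Cred T u ->
  (forall b, Bdiag T b -> u <*> b = b <*> u) ->
  forall b, Bdiag T b -> u^st <*> b = b <*> u^st.
Proof.
move=> hu uB b Bb; have Bbs := Bdiag_star Bb; have hbs := Bdiag_Cred Bbs.
have := congr1 (fstar T) (uB _ Bbs).
by rewrite (Cred_fstar_convol hu hbs) (Cred_fstar_convol hbs hu) (fstarK T b) => <-.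
Qed.

(** Replacing [f] by [g] changes each of the two products by at most [A] times the distance; the
    divisor [2 A + 1] stays positive when [A] is 0. *)
Lemma commute_closed f k : Cred T f -> Cred T k ->
  (forall e : R, 0 < e -> exists g, [/\ Cred T g, g <*> k = k <*> g &
     bnd T (fun sg => f sg - g sg) e]) -> f <*> k = k <*> f.
Proof.
move=> hf hk H; have [A kA] := Cred_bnd hk; have A0 := bnd_ge0 kA.
apply/funext => sg; apply/eqP; rewrite -subr_eq0; apply/eqP; apply: nc_lt_eq0 => e e0.
have s0 : 0 < 2 * A + 1 by rewrite ltr_wpDl // mulr_ge0.
have [g [hg gk fg]] := H _ (divr_gt0 e0 s0).
have h1 := bnd_val sg (bnd_convol fg kA).
have h2 := bnd_val sg (bnd_convol kA fg).
rewrite (convol_sub_l hf hg hk) in h1; rewrite (convol_sub_r hf hg hk) -gk nc_distC in h2.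
apply: (le_trans (nc_dist ((g <*> k) sg) _ _)).
have -> : e = e / (2 * A + 1) * (2 * A + 1) by rewrite divfK // gt_eqF.
have e1 : 0 < e / (2 * A + 1) by rewrite divr_gt0.
set q := e / _ in h1 h2 e1 *; nra.
Qed.

Lemma convol0r k : Cred T k -> k <*> (fun=> 0) = fun=> 0.
Proof.
move=> /Cred_bnd [A kA]; have := convolZr 0 (bnd0 T) kA.
under eq_fun do rewrite mul0r.
by move=> ->; apply/funext => sg; rewrite mul0r.
Qed.

Lemma convol0l k : Cred T k -> (fun=> 0) <*> k = fun=> 0.
Proof.
move=> /Cred_bnd [A kA]; have := convolZl 0 (bnd0 T) kA.
under eq_fun do rewrite mul0r.
by move=> ->; apply/funext => sg; rewrite mul0r.
Qed.

(** * The geometric series of a small element *)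

Section fixpoint.
Variable a : Sigma -> C.
Hypotheses (ha : Cred T a) (aq : bnd T a 8^-1).

(** Partial sums [a + ... + a^n] in Horner form, written without a unit since the algebra need not
    have one. *)
Fixpoint iterate n : Sigma -> C :=
  if n is m.+1 then fun sg => a sg + (a <*> iterate m) sg else fun=> 0.

Lemma Cred0 : Cred T (fun=> 0).
Proof. exact/Cred_Cc/Cc_twist0. Qed.

Lemma Cred_iterate n : Cred T (iterate n).
Proof.
elim: n => [|n IH] /=; first exact: Cred0.
exact: Cred_add ha (Cred_convol ha IH).
Qed.

Lemma iterate_step n :
  bnd T (fun sg => iterate n.+1 sg - iterate n sg) (8^-1 ^+ n.+1).
Proof.
elim: n => [|n IH].
  rewrite expr1; have -> : (fun sg => iterate 1 sg - iterate 0 sg) = a.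
    by apply/funext => sg; rewrite /= (convol0r ha) addr0 subr0.
  exact: aq.
have -> : (fun sg => iterate n.+2 sg - iterate n.+1 sg) =
    a <*> (fun sg => iterate n.+1 sg - iterate n sg).
  rewrite (convol_sub_r (Cred_iterate n.+1) (Cred_iterate n) ha).
  by apply/funext => sg; rewrite [iterate n.+2]/= [iterate n.+1 sg]/= opprD addrACA subrr add0r.
by rewrite exprS; exact: bnd_convol aq IH.
Qed.

(** The factor 2 leaves room for the induction: in units of [8^-1 ^+ n.+1] the step costs
    [2 / 8 + 1], which is at most 2. *)
Lemma iterate_cauchy n m0 :
  bnd T (fun sg => iterate (n + m0)%N sg - iterate n sg) (2 * 8^-1 ^+ n.+1).
Proof.
have q0 m : 0 <= 8^-1 ^+ m :> R by rewrite exprn_ge0 // invr_ge0.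
elim: m0 n => [|m0 IH] n.
  rewrite addn0; have -> : (fun sg => iterate n sg - iterate n sg) = fun=> 0.
    by apply/funext => sg; rewrite subrr.
  by apply: bnd_le (bnd0 T); rewrite mulr_ge0.
have -> : (fun sg => iterate (n + m0.+1)%N sg - iterate n sg) =
    fun sg => (iterate (n.+1 + m0)%N sg - iterate n.+1 sg) + (iterate n.+1 sg - iterate n sg).
  by apply/funext => sg; rewrite addnS addSn addrA subrK.
apply: bnd_le (bnd_add (IH n.+1) (iterate_step n)).
by rewrite [in leLHS]exprS; have := q0 n.+1; set Q := 8^-1 ^+ n.+1; lra.
Qed.

Lemma small_power (e : R) : 0 < e -> exists n : nat, 2 * 8^-1 ^+ n.+1 < e.
Proof.
move=> /small_invS [n /(_ n (leqnn n)) h1]; exists n; apply: le_lt_trans h1.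
have P m : 2 * m.+1%:R <= 8 ^+ m.+1 :> R.
  elim: m => [|m IH]; first by rewrite expr1 mulr1 ler_nat.
  rewrite exprS -[m.+2%:R]natr1; have : 1 <= m.+1%:R :> R by rewrite ler1n.
  by move: IH; lra.
rewrite exprVn ler_pdivrMr ?exprn_gt0 // mulrC ler_pdivlMr //; exact: P.
Qed.

(** [w] is the sum of the series, that is [a / (1 - a)]; the bound 1/4 is the Cauchy estimate from
    the zeroth partial sum. Approximability by partial sums is recorded because it transfers
    commutation from [a] to [w]. *)
Lemma fixpoint_exists : exists w, [/\ Cred T w, bnd T w 4^-1,
  w = (fun sg => a sg + (a <*> w) sg) &
  forall e : R, 0 < e -> exists n, bnd T (fun sg => w sg - iterate n sg) e].
Proof.
have bv n m sg : nc (iterate (n + m)%N sg - iterate n sg) <= 2 * 8^-1 ^+ n.+1.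
  exact: bnd_val sg (iterate_cauchy n m).
have lim sg : exists l : C, (fun n => iterate n sg) @ \oo --> l.
  apply: complex_cauchy_cvg => e e0.
  have [N NP] := small_power (divr_gt0 e0 (ltr0Sn R 1)).
  exists N => m n Nm Nn; apply: (le_lt_trans (nc_dist (iterate N sg) _ _)).
  have h1 := bv N (m - N)%N sg; have h2 := bv N (n - N)%N sg.
  rewrite subnKC // in h1; rewrite subnKC // in h2.
  rewrite (nc_distC (iterate N sg)) (splitr e).
  by apply: ltrD; [exact: le_lt_trans h1 NP|exact: le_lt_trans h2 NP].
have [w wP] := choice lim.
have wb n : bnd T (fun sg => w sg - iterate n sg) (2 * 8^-1 ^+ n.+1).
  apply: bnd_limit => // [m|m nm]; first exact: Cred_equivariant (Cred_iterate m).
  by have := iterate_cauchy n (m - n)%N; rewrite subnKC.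
have we e : 0 < e -> exists n, bnd T (fun sg => w sg - iterate n sg) e.
  move=> e0; have [n nP] := small_power e0; exists n.
  by apply: bnd_le (wb n); exact: ltW.
have ew : equivariant T w.
  by have [ew _] := wb 0%N => b sg; have := ew b sg; rewrite /= !subr0.
have hw : Cred T w.
  apply: (Cred_closed ew) => e /we [n nP].
  by exists (iterate n); [exact: Cred_iterate|exact: nP].
exists w; split; [exact: hw| | |exact: we].
  have := wb 0%N; have -> : (fun sg => w sg - iterate 0 sg) = w.
    by apply/funext => sg; rewrite /= subr0.
  by apply: bnd_le; rewrite expr1; lra.
apply/funext => sg; apply/eqP; rewrite -subr_eq0; apply/eqP; apply: nc_lt_eq0 => e e0.
have [n nP] := small_power (divr_gt0 e0 (ltr0Sn R 1)).
have h1 := bnd_val sg (wb n.+1).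
have h2 := bnd_val sg (bnd_convol aq (wb n)).
rewrite (convol_sub_r hw (Cred_iterate n) ha) in h2.
have -> : w sg - (a sg + (a <*> w) sg) =
    (w sg - iterate n.+1 sg) - ((a <*> w) sg - (a <*> iterate n) sg) by rewrite /=; ring.
apply: (le_trans (ncB _ _)).
have q0 : 0 <= 8^-1 ^+ n.+1 :> R by rewrite exprn_ge0 // invr_ge0.
rewrite exprS in h1.
by move: h1 h2 nP; set Q := 8^-1 ^+ n.+1 in q0 *; lra.
Qed.

Lemma iterate_commute k n : Cred T k -> a <*> k = k <*> a ->
  iterate n <*> k = k <*> iterate n.
Proof.
move=> hk ak; elim: n => [|n IH].
  by rewrite /= (convol0l hk) (convol0r hk).
have hn := Cred_iterate n.
rewrite /= (convol_add_l ha (Cred_convol ha hn) hk) (convol_add_r ha (Cred_convol ha hn) hk).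
by rewrite -(Cred_convolA ha hn hk) IH (Cred_convolA ha hk hn) ak (Cred_convolA hk ha hn).
Qed.

End fixpoint.

(* Unitarity of the Cayley transform [(1 + a) / (1 - a) = 1 + 2 w], where
   [w = a / (1 - a)]. *)
Lemma mul_star_fixpoint a w : Cred T a -> Cred T w ->
  (forall sg, a^st sg = - a sg) -> (forall sg, w sg = a sg + (w <*> a) sg) ->
  forall sg, 2 * (w <*> w^st) sg = - w sg - w^st sg.
Proof.
move=> ha hw ast w1 sg; have hws := Cred_star hw; have hwa := Cred_convol hw ha.
have h1 f : Cred T f -> Cred T (fun tau => -1 * f tau) by exact: Cred_scale.
have wE : w = fun tau => a tau + (w <*> a) tau by exact/funext.
have E1 : w^st = fun tau => a^st tau + (a^st <*> w^st) tau.
  by rewrite {1}wE fstar_add (Cred_fstar_convol hw ha).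
have aE : a^st = fun tau => -1 * a tau by apply/funext => t; rewrite ast mulN1r.
have E2 : a <*> w^st = fun tau => -1 * a tau + -1 * w^st tau.
  apply/funext => tau; have := congr1 (fun f => f tau) E1.
  rewrite aE (convol_scale_l _ ha hws) /= => ->.
  by rewrite !mulN1r opprD !opprK addKr.
have E3 : w <*> w^st = (fun tau => a tau + (w <*> a) tau) <*> w^st.
  exact: (congr1 (fun f => f <*> w^st) wE).
have := congr1 (fun f => f sg) E3.
rewrite (convol_add_l ha hwa hws) -(Cred_convolA hw ha hws) E2.
rewrite (convol_add_r (h1 _ ha) (h1 _ hws) hw).
rewrite (convol_scale_r _ ha hw) (convol_scale_r _ hws hw).
have := w1 sg; set x := (w <*> a) sg; set y := (w <*> w^st) sg.
move=> -> yE; have -> : 2 * y = y + y by ring.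
by rewrite {1}yE !mulN1r; ring.
Qed.

(** Excludes a zero of the Cayley transform at a unit: there [2 w] would have modulus 1, against the
    bound 1/4 on [w]. *)
Lemma half_quarter (n : R) : 2 * n = 1 -> n <= 4^-1 -> False.
Proof. lra. Qed.

(** Recovers [a] from [w = a / (1 - a)]: as [w] is diagonal, the equation reads [a = w - a Q(w)]
    pointwise, and the bound 1/4 on Q(w) lets the last term be absorbed in every estimate. *)
Lemma Bdiag_resolvent a w : Cred T a -> bnd T a 8^-1 -> Bdiag T w -> bnd T w 4^-1 ->
  w = (fun sg => a sg + (a <*> w) sg) -> Bdiag T a.
Proof.
move=> ha aq Bw w4 wE.
have [eqw sw [cw vw]] := iffLR (BdiagP T w) Bw.
have aw : a <*> w = fun sg => a sg * Qmap T w (d sg).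
  by rewrite -{1}(tilde_Qmap eqw sw) (convol_tilder _ (Cred_equivariant ha)).
have aE sg : a sg = w sg - a sg * Qmap T w (d sg).
  have := congr1 (fun f => f sg) wE; rewrite aw /= => ->; ring.
have a8 sg : nc (a sg) <= 8^-1 by exact: bnd_val sg aq.
have W4 x : nc (Qmap T w x) <= 4^-1 by rewrite QmapE; exact: bnd_val (unt x) w4.
apply/BdiagP; split; first exact: Cred_equivariant.
  move=> sg nz; apply: sw => w0; apply: nz; apply: nc_eq0.
  have := aE sg; rewrite w0 sub0r => E.
  have : nc (a sg) = nc (a sg) * nc (Qmap T w (d sg)) by rewrite -ncM -[RHS]ncN -E.
  clear E.
  have := W4 (d sg); have := nc_ge0 (a sg); nra.
have aQ x : Qmap T a x = Qmap T w x - Qmap T a x * Qmap T w x.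
  by rewrite !QmapE {1}aE gdom_unt QmapE.
have Q8 x : nc (Qmap T a x) <= 8^-1 by rewrite QmapE; exact: a8.
split.
  apply/continuous_complexP => x e1 e10.
  have e20 : 0 < e1 / 2 by rewrite divr_gt0.
  apply: filterS (iffLR (continuous_complexP _) cw x _ e20) => y /=.
  set D := Qmap T w x - Qmap T w y => hD.
  (* The left side recurs on the right with a factor at most 1/4, and Q(a) is at most 1/8; it is
     therefore at most [3/2] times the modulus of [D]. *)
  have E : Qmap T a x - Qmap T a y = D - Qmap T a x * D -
      (Qmap T a x - Qmap T a y) * Qmap T w y.
    rewrite /D {1}(aQ x) {1}(aQ y); ring.
  have h1 := ncB (D - Qmap T a x * D) ((Qmap T a x - Qmap T a y) * Qmap T w y).
  rewrite -E !ncM in h1; clear E.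
  have h2 := ncB D (Qmap T a x * D); rewrite ncM in h2.
  have := W4 y; have := Q8 x; have := nc_ge0 D.
  have := nc_ge0 (Qmap T a x - Qmap T a y).
  set n1 := nc (Qmap T a x - _) in h1 *; set n2 := nc D in h1 h2 hD *.
  set n3 := nc (Qmap T a x) in h1 h2 *; set n4 := nc (Qmap T w y) in h1 h2 *.
  nra.
move=> e1 e10; have e20 : 0 < e1 / 2 by rewrite divr_gt0.
have [L cL LP] := vw _ e20; exists L => // x /LP h.
have h1 := ncB (Qmap T w x) (Qmap T a x * Qmap T w x); rewrite -aQ ncM in h1.
have := W4 x; have := nc_ge0 (Qmap T a x); nra.
Qed.

(** * The commutant of B when Q is separating *)

Section commutant.
Hypothesis sep : Q_separating T.

(** Membership in B is local over a compact open set: the projection [e] is 1 near [x], so there [f]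
    coincides with an element of B. *)
Lemma Bdiag_intro f K : Cred T f -> compact K -> open K ->
  (forall sg, ~ K (d sg) -> f sg = 0) ->
  (forall x, K x -> exists e, [/\ Bdiag T e, e <*> e = e, Qmap T e x = 1 &
     Bdiag T (f <*> e)]) -> Bdiag T f.
Proof.
move=> hf cK oK f0 floc; have ef := Cred_equivariant hf.
have loc x : K x -> exists (e0 b : X -> C), [/\ continuous e0, e0 x = 1,
    forall y, e0 y = 0 \/ e0 y = 1, C0_space b &
    forall sg, f sg * e0 (d sg) = tilde T b sg].
  move=> /floc [_ [[e0 [ce _] <-] ee Qe [b hb bE]]]; rewrite Qmap_tilde in Qe.
  exists e0, b; split=> //.
    exact: tilde_idempotent ee.
  by move=> sg; rewrite bE convol_tilder.
apply/BdiagP; split=> //.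
  move=> sg nz; have Kd : K (d sg) by apply: contrapT => /f0.
  have [e0 [b [_ e1 _ _ bE]]] := loc _ Kd.
  apply: (@tilde_supp _ _ _ _ T b); rewrite -bE e1 mulr1; exact: nz.
apply: (C0_intro T cK oK).
  apply/within_continuousP => x Kx N /nbhs_complexP [e e_gt0 eN].
  have [e0 [b [ce e1 e01 [cb _] bE]]] := loc x Kx.
  have h1 := nbhs_01 x ce e01.
  have h2 := iffLR (continuous_complexP _) cb x e e_gt0.
  have bx y : e0 y = 1 -> b y = Qmap T f y.
    by move=> ey; have := bE (unt y); rewrite tilde_unt gdom_unt ey mulr1 QmapE.
  apply: filterS2 h1 h2 => y /= ey; rewrite e1 in ey.
  by rewrite !bx // => h _; exact: eN.
by move=> x nK; rewrite QmapE f0 // gdom_unt.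
Qed.

Lemma commutant_cutoff f K : Cred T f -> f^st = f ->
  (forall b, Bdiag T b -> f <*> b = b <*> f) -> compact K -> open K ->
  Bdiag T (f <*> tilde T (ind R K)).
Proof.
move=> hf fst fB cK oK; pose e := tilde T (ind R K).
have hK := C0_ind T cK oK; have Be : Bdiag T e by exists (ind R K).
have he := Bdiag_Cred Be.
have [ee est] := tilde_ind_projection T K; rewrite -/e in ee est.
have hfe := Cred_convol hf he.
have [A fA] := Cred_bnd hfe; have A0 := bnd_ge0 fA.
have s0 : 0 < A + 1 by rewrite ltr_wpDl.
(* The scaling brings the norm down to 1/8, as the series requires; the factor [z] is purely
   imaginary, so that [a] is skew-adjoint. *)
pose q : R := 8^-1 / (A + 1).
have q0 : 0 < q by rewrite divr_gt0 // invr_gt0.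
pose z : C := 0 +i* q.
have zst : z^*%C = - z by rewrite /z /=; apply/eqP; rewrite eq_complex /= oppr0 !eqxx.
have ncz : nc z = q by rewrite /= expr0n /= add0r sqrtr_sqr gtr0_norm.
have znz : z != 0.
  by apply/eqP => z0; have := ncz; rewrite z0 nc0 => E; rewrite -E ltxx in q0.
pose a sg := z * (f <*> e) sg.
have ha : Cred T a by exact: Cred_scale.
have aq : bnd T a 8^-1.
  apply: bnd_le (bnd_scale z fA).
  by rewrite ncz /q mulrAC ler_pdivrMr // ler_wpM2l ?invr_ge0 // lerDl.
have ast sg : a^st sg = - a sg.
  by rewrite /a fstar_scale (Cred_fstar_convol hf he) fst est zst -(fB _ Be) mulNr.
have ae : a <*> e = a.
  by rewrite /a (convol_scale_l _ hfe he) -(Cred_convolA hf he he) ee.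
have aB b : Bdiag T b -> a <*> b = b <*> a.
  move=> Bb; have hb := Bdiag_Cred Bb.
  rewrite /a (convol_scale_l _ hfe hb) (convol_scale_r _ hfe hb).
  rewrite -(Cred_convolA hf he hb) (BdiagC Be Bb) (Cred_convolA hf hb he) (fB _ Bb) -(Cred_convolA hb hf he) //.
have [w [hw w4 wE wapp]] := fixpoint_exists ha aq.
have hws := Cred_star hw.
have wcomm k : Cred T k -> a <*> k = k <*> a -> w <*> k = k <*> w.
  move=> hk ak; apply: (commute_closed hw hk) => e1 /wapp [n nP].
  exists (iterate a n); split; last exact: nP.
    exact: (Cred_iterate ha n).
  exact: (iterate_commute ha n hk ak).
have wa : w <*> a = a <*> w by exact: wcomm.
have wB b : Bdiag T b -> w <*> b = b <*> w.
  by move=> Bb; apply: wcomm; [exact: Bdiag_Cred|exact: aB].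
have ew : e <*> w = w.
  rewrite {1}wE (convol_add_r ha (Cred_convol ha hw) he) -(aB _ Be) ae.
  by rewrite (Cred_convolA he ha hw) -(aB _ Be) ae -wE.
have we : w <*> e = w by rewrite (wB _ Be).
have w1 sg : w sg = a sg + (w <*> a) sg by rewrite wa; exact: (congr1 (fun f => f sg) wE).
have ww := mul_star_fixpoint ha hw ast w1.
have has := Cred_star ha.
have ww' sg : 2 * (w^st <*> w) sg = - w^st sg - w sg.
  have := @mul_star_fixpoint (a^st) (w^st) has hws _ _ sg; rewrite (fstarK T w).
  apply=> tau; first by rewrite (fstarK T a) ast opprK.
  rewrite -[in RHS](Cred_fstar_convol ha hw).
  by have := congr1 (fun f => f^st tau) wE; rewrite fstar_add.
have hw2 : Cred T (fun sg => 2 * w sg) by exact: Cred_scale.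
have hws2 : Cred T (fun sg => 2 * w^st sg) by exact: Cred_scale.
(* The Cayley transform [(1 + a) / (1 - a)] in the corner of [e]. It commutes with B and is unitary
   there, hence normalizes B. *)
pose u sg := e sg + 2 * w sg.
have hu : Cred T u by exact: Cred_add.
have uE : u^st = fun sg => e sg + 2 * w^st sg.
  rewrite /u fstar_add est fstar_scale; apply/funext => sg.
  by rewrite conjc_nat.
have hus : Cred T (u^st) by exact: Cred_star.
have wse : w^st <*> e = w^st by rewrite -{1}est -(Cred_fstar_convol he hw) ew.
have ews : e <*> w^st = w^st by rewrite -{1}est -(Cred_fstar_convol hw he) we.
have uu : u <*> u^st = e.
  rewrite uE /u (convol_add_l he hw2 (Cred_add he hws2)).
  rewrite (convol_add_r he hws2 he) ee (convol_scale_r _ hws he) ews.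
  rewrite (convol_scale_l _ hw (Cred_add he hws2)) (convol_add_r he hws2 hw) we.
  rewrite (convol_scale_r _ hws hw); apply/funext => sg.
  by rewrite ww; ring.
have uu' : u^st <*> u = e.
  rewrite uE /u (convol_add_l he hws2 (Cred_add he hw2)).
  rewrite (convol_add_r he hw2 he) ee (convol_scale_r _ hw he) ew.
  rewrite (convol_scale_l _ hws (Cred_add he hw2)) (convol_add_r he hw2 hws) wse.
  rewrite (convol_scale_r _ hw hws); apply/funext => sg.
  by rewrite ww'; ring.
have uB b : Bdiag T b -> u <*> b = b <*> u.
  move=> Bb; have hb := Bdiag_Cred Bb.
  rewrite /u (convol_add_l he hw2 hb) (convol_add_r he hw2 hb) (BdiagC Be Bb).
  by rewrite (convol_scale_l _ hw hb) (convol_scale_r _ hw hb) (wB _ Bb).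
have eu : e <*> u = u.
  by rewrite /u (convol_add_r he hw2 he) ee (convol_scale_r _ hw he) ew.
have usB := commute_Bdiag_star hu uB.
have Pu : PIN T u.
  split; [exact: hu|by rewrite uu eu|by rewrite uu uu'|move=> b Bb|move=> b Bb].
    have hb := Bdiag_Cred Bb.
    rewrite (uB _ Bb) -(Cred_convolA hb hu hus) uu; exact: Bdiag_convol.
  have hb := Bdiag_Cred Bb.
  rewrite (usB _ Bb) -(Cred_convolA hb hus hu) uu'; exact: Bdiag_convol.
have Bw : Bdiag T w.
  have w0 sg : ~ K (d sg) -> w sg = 0.
    move=> nK; have := congr1 (fun f => f sg) we.
    by rewrite (convol_tilder _ (Cred_equivariant hw)) ind0 // mulr0.
  apply: (Bdiag_intro hw cK oK w0) => x Kx.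
  have ux : pin_dom T u x by rewrite /pin_dom /= uu' Qmap_tilde ind1.
  have [e' [Be' [ee' _] Qe' ue']] : germ_trivial T u x.
    apply: contrapT => nt; have := sep Pu ux nt.
    rewrite QmapE /u /e tilde_unt ind1 // => /eqP; rewrite addr_eq0 => /eqP E.
    have := bnd_val (unt x) w4; have : nc (2 * w (unt x)) = 1.
      by rewrite -ncN -E nc1.
    have -> : (2 : C) = (2 : R)%:C by rewrite rmorph_nat.
    by rewrite ncM nc_real ger0_norm // => h1 h2; exact: half_quarter h1 h2.
  exists e'; split=> //; have he' := Bdiag_Cred Be'.
  have -> : w <*> e' = fun sg => (2^-1 : C) * ((u <*> e') sg + -1 * (e <*> e') sg).
    rewrite /u (convol_add_l he hw2 he') (convol_scale_l _ hw he').
    by apply/funext => sg; field.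
  have [[_ [_ Badd] Bscale _ _] _] := Bdiag_abelian T.
  exact: (Bscale _ _ (Badd _ _ ue' (Bscale _ _ (Bdiag_convol Be Be')))).
have Ba : Bdiag T a by exact: Bdiag_resolvent ha aq Bw w4 wE.
have [[_ _ Bscale _ _] _] := Bdiag_abelian T.
have := Bscale z^-1 a Ba.
have -> : (fun sg => z^-1 * a sg) = f <*> e; last exact.
by apply/funext => sg; rewrite /a mulrA mulVf // mul1r.
Qed.

Lemma Cc_twist_cutoff f : Cc_twist T f -> exists K, [/\ compact K, open K &
  forall sg, ~ K (d sg) -> f sg = 0].
Proof.
move: f; apply: Cc_ind => [|K s b f hs hb hf [L [cL oL L0]]].
  by exists set0; split=> //; [exact: compact0|exact: open0].
have [cK oK _ _ _] := hs; exists (K `|` L); split.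
- exact: compactU.
- exact: openU.
- move=> sg nKL; rewrite L0 ?addr0; last by move=> h; apply: nKL; right.
  by apply: contrapT => /(elem_supp hs)[h _]; apply: nKL; left.
Qed.

(** All cutoffs of [f] lie in B. The support is checked point by point with a cutoff around the
    source; Q(f) is a uniform limit of cutoffs, because off a suitable compact open set an
    approximant from C_c vanishes and Q(f) is small. *)
Lemma selfadjoint_commutant f : Cred T f -> f^st = f ->
  (forall b, Bdiag T b -> f <*> b = b <*> f) -> Bdiag T f.
Proof.
move=> hf fst fB; have ef := Cred_equivariant hf.
have cut K : compact K -> open K -> f <*> tilde T (ind R K) = fun sg => f sg * ind R K (d sg).
  by move=> _ _; rewrite convol_tilder.
apply/BdiagP; split=> //.
  move=> sg nz; have [K [cK oK Kd _]] := X_nbhs T (@filterT _ (nbhs (d sg)) _).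
  have [_ + _] := iffLR (BdiagP _ _) (commutant_cutoff hf fst fB cK oK).
  by apply; rewrite cut // ind1 // mulr1.
apply: C0_limit => e e0; have [_ /(_ e e0) [g gC fg]] := iffLR (CredP _ _) hf.
have [K [cK oK gK]] := Cc_twist_cutoff gC.
have [_ _ hQ] := iffLR (BdiagP _ _) (commutant_cutoff hf fst fB cK oK).
exists (Qmap T (f <*> tilde T (ind R K))) => // x.
rewrite !QmapE cut // gdom_unt; case: (pselect (K x)) => Kx.
  by rewrite ind1 // mulr1 subrr nc0 ltW.
rewrite ind0 // mulr0.
have := bnd_val (unt x) fg; rewrite gK ?gdom_unt //.
Qed.

(** An abelian [E] is closed under adjoints, so [f] splits into the self-adjoint elements [f + f^st]
    and [i (f - f^st)] of [E], both commuting with B. *)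
Lemma separating_to_masa : maximal_abelian T (Bdiag T).
Proof.
split; first exact: Bdiag_abelian.
move=> E [[EC [_ Eadd] Escale [_ Estar] _] Ecomm] BE.
apply/seteqP; split=> // f Ef.
have Esf := Estar _ Ef.
have key g : E g -> g^st = g -> Bdiag T g.
  move=> Eg gst; apply: (selfadjoint_commutant (EC _ Eg) gst) => b /BE Eb.
  exact: Ecomm.
have B1 : Bdiag T (fun sg => f sg + f^st sg).
  apply: (key _ (Eadd _ _ Ef Esf)).
  by rewrite fstar_add (fstarK T f); apply/funext => sg; rewrite addrC.
have B2 : Bdiag T (fun sg => 'i%C * (f sg + -1 * f^st sg)).
  apply: (key _ (Escale _ _ (Eadd _ _ Ef (Escale _ _ Esf)))).
  rewrite fstar_scale fstar_add fstar_scale (fstarK T f); apply/funext => sg.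
  have -> : ('i%C : C)^*%C = - 'i%C by apply/eqP; rewrite eq_complex /= oppr0 !eqxx.
  have -> : (-1 : C)^*%C = -1 by rewrite rmorphN1.
  ring.
have [[_ [_ Badd] Bscale _ _] _] := Bdiag_abelian T.
have := Badd _ _ (Bscale 2^-1 _ B1) (Bscale (- 'i%C / 2) _ B2).
have i2 : ('i%C : C) * 'i%C = -1 by rewrite -expr2 sqr_i.
congr (Bdiag T _); apply/funext => sg.
transitivity ((2^-1 : C) * (f sg + f^st sg) - ('i%C * 'i%C : C) / (2 : C) * (f sg + -1 * f^st sg)); first by ring.
by rewrite i2; field.
Qed.

End commutant.

End masa.

(** * Effectiveness *)

Section effectiveness.
Context (R : realType) (X G Sigma : topologicalType).
Variable T : twisted_boolean_groupoid R X G Sigma.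
Local Notation C := R[i].
Local Notation nc := (@ComplexField.Normc.normc R).
Local Notation gG := (tgrp T).
Local Notation gS := (text T).
Local Notation p := (tproj T).
Local Notation r := (grng gS).
Local Notation d := (gdom gS).
Local Notation act := (tact T).
Local Notation unt := (gunt gS).
Local Notation "f <*> k" := (convol T f k) (at level 40, left associativity).
Local Notation "f ^st" := (fstar T f) (at level 2, format "f ^st").
Implicit Types (u w f k g : Sigma -> C) (x y z : X).
Implicit Types (K L : set X) (s : X -> Sigma) (sg tau : Sigma).

Local Opaque fstar convol tilde Delta Cred.

Definition commutant (D : set (Sigma -> C)) : set (Sigma -> C) :=
  [set f | Cred T f /\ forall k, D k -> f <*> k = k <*> f].

Lemma commutant_subalgebra (D : set (Sigma -> C)) : D `<=` Cred T ->
  (forall k, D k -> D (k^st)) -> sub_Cstar_algebra T (commutant D).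
Proof.
move=> DC Dst; split.
- by move=> f [].
- split.
    split; first exact: Cred0.
    by move=> k /DC hk; rewrite (convol0l hk) (convol0r hk).
  move=> f g [hf fD] [hg gD]; split; first exact: (Cred_add hf hg).
  move=> k Dk; have hk := DC _ Dk.
  by rewrite (convol_add_l hf hg hk) (convol_add_r hf hg hk) (fD _ Dk) (gD _ Dk).
- move=> c f [hf fD]; split; first exact: (Cred_scale c hf).
  move=> k Dk; have hk := DC _ Dk.
  by rewrite (convol_scale_l _ hf hk) (convol_scale_r _ hf hk) (fD _ Dk).
- split.
    move=> f g [hf fD] [hg gD]; split; first exact: (Cred_convol hf hg).
    move=> k Dk; have hk := DC _ Dk.
    by rewrite -(Cred_convolA hf hg hk) (gD _ Dk) (Cred_convolA hf hk hg) (fD _ Dk) (Cred_convolA hk hf hg).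
  move=> f [hf fD]; split; first exact: (Cred_star hf).
  move=> k Dk; have hks := DC _ (Dst _ Dk).
  have := congr1 (fstar T) (fD _ (Dst _ Dk)).
  by rewrite (Cred_fstar_convol hf hks) (Cred_fstar_convol hks hf) (fstarK T k) => ->.
- move=> f hf H; split; first exact: hf.
  move=> k Dk; have hk := DC _ Dk.
  apply: (commute_closed hf hk) => e e0; have [g [hg gD] fg] := H e e0.
  exists g; split; [exact: hg|exact: gD|].
  exact: (red_norm_bnd (Cred_equivariant hf) (Cred_equivariant hg) e0 fg).
Qed.

Lemma commutant_star (D : set (Sigma -> C)) : D `<=` Cred T ->
  (forall k, D k -> D (k^st)) -> forall f, commutant D f -> commutant D (f^st).
Proof. by move=> DC Dst; have [_ _ _ [_ h] _] := commutant_subalgebra DC Dst. Qed.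

(** [D] lies in its commutant, so the bicommutant does too; its elements thus commute with one
    another. *)
Lemma bicommutant_abelian (D : set (Sigma -> C)) : D `<=` Cred T ->
  (forall k, D k -> D (k^st)) -> (forall f k, D f -> D k -> f <*> k = k <*> f) ->
  abelian_subalgebra T (commutant (commutant D)) /\ D `<=` commutant (commutant D).
Proof.
move=> DC Dst Dcomm.
have sub1 : D `<=` commutant D by move=> f Df; split; [exact: DC|move=> k; exact: Dcomm].
have sub2 : D `<=` commutant (commutant D).
  by move=> f Df; split; [exact: DC|move=> k [_ /(_ _ Df)]].
split=> //; split.
  apply: commutant_subalgebra; first by move=> f [].
  exact: commutant_star.
move=> f k [hf fD] [hk kD]; apply: fD; split; first exact: hk.
by move=> g Dg; apply: kD; exact: sub1.
Qed.

Lemma masa_to_effective : maximal_abelian T (Bdiag T) -> effective gG.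
Proof.
move=> [_ maxB]; rewrite /effective; apply/seteqP; split; last first.
  have -> : range (gunt gG) = (range (gunt gG))°.
    exact/esym/interior_id/(units_open T).
  by apply: interiorS => _ [x _ <-] /=; rewrite grng_unt gdom_unt.
move=> h hint; apply: contrapT => nh.
have [K [s [hs Kh ph iso]]] := @sect_through _ _ _ _ T h _ hint.
have [cK oK cs ds rs] := hs.
have rd y : K y -> r (s y) = y.
  by move=> Ky; have := iso y Ky; rewrite /= (tproj_rng T) (tproj_dom T) ds.
pose w := Delta T (s @` K); have Pw : PIN T w := PIN_Delta hs.
have hw := PIN_Cred Pw; have hws := Cred_star hw; have ew := Cred_equivariant hw.
have wB b : Bdiag T b -> w <*> b = b <*> w.
  move=> [c hc <-]; rewrite (convol_tilder _ ew) (convol_tildel _ ew).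
  apply/funext => sg; case: (pselect (w sg = 0)) => [->|nz].
    by rewrite mulr0 mul0r.
  have [Kd pd] := Delta_supp hs nz.
  have -> : r sg = d sg by rewrite -[LHS](tproj_rng T) pd (tproj_rng T) rd.
  by rewrite mulrC.
have wsB := commute_Bdiag_star hw wB.
(* Inside the isotropy, source and range sets of the bisection both equal [K], so the two products
   are the same projection. *)
have normal : w <*> w^st = w^st <*> w.
  have Pws := PIN_star Pw.
  have [E1 _] := star_mul_tilde Pw; have [E2 _] := star_mul_tilde Pws.
  rewrite (fstarK T w) in E2; rewrite E1 E2; congr tilde; apply/funext => y.
  case: (pselect (K y)) => Ky.
    have w1 : w (s y) <> 0.
      by rewrite /w (Delta_sect hs Ky); exact/eqP/oner_neq0.
    have ws1 : w^st (ginv gS (s y)) <> 0.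
      by rewrite fstarE ginvK => /eqP; rewrite conjc_eq0 => /eqP.
    have := supp_fun1 Pw w1; rewrite ds // => ->.
    by have := supp_fun1 Pws ws1; rewrite gdom_inv rd.
  rewrite (supp_fun0 hw) ?(supp_fun0 hws) // => sg sy.
    rewrite fstarE; suff -> : w (ginv gS sg) = 0 by exact: conjc0.
    apply: contrapT => /(Delta_supp hs)[Kd pd]; apply: Ky.
    have := rd _ Kd; rewrite -(tproj_rng T) -pd (tproj_rng T) grng_inv sy.
    by move=> ->.
  by apply: contrapT => /(Delta_supp hs)[]; rewrite sy.
pose D : set (Sigma -> C) := [set f | f = w \/ f = w^st \/ Bdiag T f].
have DC : D `<=` Cred T.
  by move=> f [->|[->|Bf]]; [exact: hw|exact: hws|exact: Bdiag_Cred].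
have Dst k : D k -> D (k^st).
  move=> [->|[->|Bk]]; first by right; left.
    by left; exact: fstarK.
  by right; right; exact: Bdiag_star.
have Dcomm f k : D f -> D k -> f <*> k = k <*> f.
  move=> [->|[->|Bf]] [->|[->|Bk]].
  - by [].
  - exact: normal.
  - exact: wB.
  - exact: esym normal.
  - by [].
  - exact: wsB.
  - exact/esym/wB.
  - exact/esym/wsB.
  - exact: BdiagC.
have [abE DE] := bicommutant_abelian DC Dst Dcomm.
(* Maximality puts [w] into B, so its support lies over units; yet [w] is nonzero over [h]. *)
have EB := maxB _ abE (fun f Bf => DE f (or_intror (or_intror Bf))).
have : Bdiag T w by rewrite -EB; apply: DE; left.
move=> /BdiagP [_ ws _]; apply: nh.
have : w (s (gdom gG h)) <> 0.
  by rewrite /w (Delta_sect hs Kh); exact/eqP/oner_neq0.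
by move=> /ws /range_tcircP; rewrite ph.
Qed.

(** * Continuity and separation over a Hausdorff effective groupoid *)

Section hausdorff.
Hypothesis hG : hausdorff_space G.

(** The projected bisection is compact, hence closed in the Hausdorff [G], so [Delta_S] vanishes
    near every point off its saturation; on the saturation, which is open, it is the conjugate of a
    continuous phase. *)
Lemma Delta_continuous K s : sect T K s -> continuous (Delta T (s @` K)).
Proof.
move=> hs; have [cK oK cs ds rs] := hs.
apply/continuous_complexP => sg e e0.
have cpS : closed (p @` (s @` K)).
  apply: (compact_closed hG); rewrite image_comp; apply: continuous_compact => //.
  by have [] := sect_section hs.
have opS : open (p @` (s @` K)) by exact: (sect_proj_open hs oK).
case: (pselect ((p @` (s @` K)) (p sg))) => [pS|npS]; last first.
  have h : nbhs sg [set tau | ~ (p @` (s @` K)) (p tau)].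
    exact: (@tproj_continuous _ _ _ _ T sg _
      (open_nbhs_nbhs (conj (closed_openC cpS) npS))).
  have Z tau : ~ (p @` (s @` K)) (p tau) -> Delta T (s @` K) tau = 0.
    move=> n; apply: contrapT => /(Delta_supp hs)[Kd pd]; apply: n.
    by rewrite pd; exists (s (d tau)) => //; exists (d tau).
  by apply: filterS h => tau /= h; rewrite !Z // subrr nc0.
have DP tau : (p @` (s @` K)) (p tau) -> K (d tau) /\
    exists2 a, tau = act a (s (d tau)) & Delta T (s @` K) tau = (set_val a)^*%C.
  move=> [_ [y Ky <-] /esym/proj_eq [a ta]].
  have dt : d tau = y by rewrite ta dom_act ds.
  rewrite dt; split=> //; exists a => //.
  by rewrite [in LHS]ta Delta_act.
have [Kd [a sa ->]] := DP _ pS.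
have [U [V [nU nV UV]]] := cocycle_nbhs sa e0.
have h1 : nbhs sg [set tau | (p @` (s @` K)) (p tau)].
  exact: (@tproj_continuous _ _ _ _ T sg _ (open_nbhs_nbhs (conj opS pS))).
have h2 : nbhs sg [set tau | K (d tau) /\ V (s (d tau))].
  exact: (@dom_continuous _ _ _ _ T sg _ (sect_nbhs hs Kd nV)).
apply: filterS3 nU h1 h2 => tau Ut /= pt [_ Vt].
have [_ [b tb ->]] := DP _ pt.
by rewrite -rmorphB nc_conj; exact: (UV tau (s (d tau))).
Qed.

(** The norm dominates the uniform distance, so [f] is a uniform limit of continuous functions. *)
Lemma Cred_continuous f : Cred T f -> continuous f.
Proof.
have cC g : Cc_twist T g -> continuous g.
  move: g; apply: Cc_ind => [|K s b f' hs [cb _] _ cf']; first exact: continuous_const.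
  have cb' : continuous (fun sg => b (d sg)).
    by move=> sg N nN; exact: (dom_continuous (cb _ _ nN)).
  exact: (@continuous_complexD R Sigma _ _
    (@continuous_complexM R Sigma _ _ (Delta_continuous hs) cb') cf').
move=> /CredP [_ H]; apply/continuous_complexP => sg e e0.
have e40 : 0 < e / 4 by rewrite divr_gt0.
have [g gC fg] := H _ e40.
apply: filterS (iffLR (continuous_complexP _) (cC g gC) sg _ e40) => tau /= h.
have h1 := bnd_val sg fg; have h2 := bnd_val tau fg.
apply: (le_lt_trans (nc_dist (g sg) _ _)).
have h3 := nc_dist (g tau) (g sg) (f tau); rewrite (nc_distC (g tau) (f tau)) in h3.
lra.
Qed.

Lemma C0_separates x y : (forall b : X -> C, C0_space b -> b x = b y) -> x = y.
Proof.
move=> H; apply: (X_hausdorff T) => A B nA nB.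
have [L [cL oL Lx LA]] := X_nbhs T nA.
have := H _ (C0_ind T cL oL); rewrite ind1 // => E.
exists y; split; last exact: nbhs_singleton.
apply: LA; apply: contrapT => nL; move: E; rewrite ind0 // => /eqP.
by rewrite oner_eq0.
Qed.

Lemma effective_to_separating : effective gG -> Q_separating T.
Proof.
move=> effG u x Pu ux nt; apply: contrapT; rewrite QmapE => nz; apply: nt.
have hu := PIN_Cred Pu; have eu := Cred_equivariant hu; have hus := Cred_star hu.
have cu := Cred_continuous hu.
have nzo : open [set sg | u sg <> 0].
  rewrite openE => sg usg; rewrite /interior.
  have n0 : 0 < nc (u sg).
    rewrite lt_def nc_ge0 andbT; apply/eqP => /nc_eq0; exact: usg.
  apply: filterS (iffLR (continuous_complexP _) cu sg _ n0) => tau /= h t0.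
  by move: h; rewrite t0 subr0 ltxx.
have nx : nbhs x [set y | u (unt y) <> 0].
  exact: (@unt_continuous _ _ _ _ T x _ (open_nbhs_nbhs (conj nzo nz))).
have [K [cK oK Kx KP]] := X_nbhs T nx.
have iso sg : K (d sg) -> u sg <> 0 -> r sg = d sg.
  move=> /KP /= nzd nzs; apply: C0_separates => b hb.
  have Bb : Bdiag T (tilde T b) by exists b.
  have hBb := Bdiag_Cred Bb; have hbu := Cred_convol hBb hu.
  have [_ uuu [_ Buu] _ u4] := Pu.
  (* [u u^st] lies in B, so it commutes with [b], and it fixes [u]. *)
  have key : tilde T b <*> u = u <*> (u^st <*> tilde T b <*> u).
    rewrite -(Cred_convolA hus hBb hu) (Cred_convolA hu hus hbu) (Cred_convolA (Cred_convol hu hus) hBb hu).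
    rewrite (BdiagC Buu Bb) -(Cred_convolA hBb (Cred_convol hu hus) hu) uuu.
    by [].
  have [eB sB _] := iffLR (BdiagP _ _) (u4 _ Bb).
  move: key; rewrite -(tilde_Qmap eB sB) (convol_tildel _ eu) (convol_tilder _ eu).
  (* [m] is [u^st b u] as a function on [X], and [key] says [b (r sg) u sg = u sg m (d sg)].
     Evaluating at [sg] and at the unit over [d sg], where [u] is nonzero by the choice of [K],
     gives [b (r sg) = m (d sg) = b (d sg)]. *)
  set m := Qmap T _ => key.
  have k1 := congr1 (fun f => f sg) key.
  have k2 := congr1 (fun f => f (unt (d sg))) key.
  rewrite /= grng_unt gdom_unt in k2; rewrite /= mulrC in k1; rewrite mulrC in k2.
  have -> : b (d sg) = m (d sg) by apply: (mulfI (introN eqP nzd)); exact: k2.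
  by apply: (mulfI (introN eqP nzs)); exact: k1.
have usupp sg : K (d sg) -> u sg <> 0 -> range (tcirc T) sg.
  move=> Kd nzs; apply/range_tcircP.
  pose O := [set tau | u tau <> 0] `&` d @^-1` K.
  have oO : open O.
    by apply: openI => //; apply: open_comp => // tau _; exact: dom_continuous.
  have : p @` O `<=` [set h | grng gG h = gdom gG h].
    move=> _ [tau [nzt Kt] <-] /=; rewrite (tproj_rng T) (tproj_dom T).
    exact: iso.
  move=> /interiorS; rewrite effG; apply.
  by rewrite (iffLR (interior_id _) (tproj_open T oO)); exists sg.
apply: (germ_trivial_intro eu cK oK Kx usupp).
apply: continuous_subspaceT => y N nN.
exact: (@unt_continuous _ _ _ _ T y _ (cu (unt y) N nN)).
Qed.

End hausdorff.

End effectiveness.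

Theorem proposition2p10 (R : realType) (X G Sigma : topologicalType)
    (T : twisted_boolean_groupoid R X G Sigma) :
  [/\ PIN_eq_Bis T <-> Q_separating T,
      PIN_eq_Bis T -> maximal_abelian T (Bdiag T),
      maximal_abelian T (Bdiag T) -> effective (tgrp T) &
      hausdorff_space G ->
        [<-> PIN_eq_Bis T;
             Q_separating T;
             maximal_abelian T (Bdiag T);
             effective (tgrp T)]].
Proof.
split.
- by split; [exact: Bis_to_separating|exact: separating_to_Bis].
- by move=> /Bis_to_separating; exact: separating_to_masa.
- exact: masa_to_effective.
- move=> hG; tfae.
  + exact: Bis_to_separating.
  + exact: separating_to_masa.
  + exact: masa_to_effective.
  + by move=> /(effective_to_separating hG); exact: separating_to_Bis.
Qed.
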